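(* Fix $\alpha\ge0$, $\eta,\theta>0$ and integers $1\le M\le N$. For $\epsilon>0$ let $q=e^{-\epsilon}$, $a=e^{-\alpha\epsilon}$ and let $\Lambda$ be distributed according to the plane-partition measure of the context with these parameters. Then as $\epsilon\to0^+$ the finite random array $\big(q^{\lambda^{(t)}_i}\big)_{-M+1\le t\le N-1,\,1\le i\le L_t}$ converges in distribution to a random array $\mathbf X=(x^{(t)}_i)_{-M+1\le t\le N-1,\,1\le i\le L_t}$ with the following properties: almost surely all entries lie in $(0,1)$, $x^{(t)}_1<\dots<x^{(t)}_{L_t}$ for each $t$, and the slices interlace: for $-M+1\le t\le-1$, $x^{(t+1)}_i<x^{(t)}_i<x^{(t+1)}_{i+1}$ for $1\le i\le L_t$; for $0\le t\le N-2$, $x^{(t)}_i<x^{(t+1)}_i<x^{(t)}_{i+1}$ for $1\le i\le L_{t+1}$, with the convention $x^{(t)}_{L_t+1}:=1$. Moreover for each $t$ the vector $x^{(t)}=(x^{(t)}_1,\dots,x^{(t)}_{L_t})$ has density on $\{0<x_1<\dots<x_{L_t}<1\}$ proportional to $$\prod_{1\le i<j\le L_t}(x_j^\eta-x_i^\eta)(x_j^\theta-x_i^\theta)\prod_{i=1}^{L_t}w_c(x_i),$$ $$w_c(x)=\begin{cases}x^{\alpha+\frac{\eta+\theta}{2}+|t|\eta-1}(1-x^\theta)^{N-(M-|t|)}&t\le0,\\ x^{\alpha+\frac{\eta+\theta}{2}+t\theta-1}(1-x^\theta)^{N-t-M}& t>0,\ N-t\ge M,\\ x^{\alpha+\frac{\eta+\theta}{2}+t\theta-1}(1-x^\eta)^{M-(N-t)}&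 t>0,\ N-t<M.\end{cases}$$
   Context: Fix $0<q<1$, $0\le a<1$, $\eta,\theta\ge0$, integers $1\le M\le N$. A partition is a non-increasing eventually-zero sequence of nonnegative integers, $|\lambda|=\sum\lambda_i$. A plane partition with base in the $M\times N$ rectangle is an array $\Lambda=(\Lambda_{i,j})_{1\le i\le M,1\le j\le N}$ of nonnegative integers with $\Lambda_{i,j}\ge\Lambda_{i+1,j}$, $\Lambda_{i,j}\ge\Lambda_{i,j+1}$. Its slice $\lambda^{(t)}$ ($-M\le t\le N$) is $(\Lambda_{k+|t|,k})_{k\ge1}$ if $t\le0$ and $(\Lambda_{k,k+t})_{k\ge1}$ if $t>0$ (out-of-range entries $0$). Left volume $=\sum_{t=-M}^{-1}|\lambda^{(t)}|$, central volume $=|\lambda^{(0)}|$, right volume $=\sum_{t=1}^N|\lambda^{(t)}|$; $\mathbb P(\Lambda)\propto q^{\eta\cdot\text{left vol}}(aq^{(\eta+\theta)/2})^{\text{central vol}}q^{\theta\cdot\text{right vol}}$. $L_t=M-|t|$ for $t\le0$ and $L_t=\min(N-t,M)$ for $t>0$. *)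

(* Defs.v *)
From HB Require Import structures.
From mathcomp Require Import all_boot all_order all_algebra.
From mathcomp Require Import all_classical all_reals all_analysis.
Set Implicit Arguments.
Unset Strict Implicit.
Unset Printing Implicit Defensive.
Import Order.TTheory GRing.Theory Num.Theory numFieldNormedType.Exports.
Local Open Scope ring_scope.
Local Open Scope classical_set_scope.

(* raw arrays (Lambda_{i,j}) ; entries indexed 0-based by 'I_M * 'I_N *)
Definition PParray (M N : nat) := {ffun 'I_M * 'I_N -> nat}.

(* Lambda_{i,j} with 1-based indices i, j; 0 outside the rectangle *)
Definition pp_entry (M N : nat) (L : PParray M N) (i j : nat) : nat :=
  match (insub i.-1 : option 'I_M), (insub j.-1 : option 'I_N) with
  | Some i', Some j' => if (0 < i)%N && (0 < j)%N then L (i', j') else 0%N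
  | _, _ => 0%N
  end.

Definition is_plane_partition (M N : nat) (L : PParray M N) : Prop :=
  forall i j : nat, (0 < i)%N -> (0 < j)%N -> (i <= M)%N -> (j <= N)%N ->
    (pp_entry L i.+1 j <= pp_entry L i j)%N /\ (pp_entry L i j.+1 <= pp_entry L i j)%N.

Definition pp_slice (M N : nat) (L : PParray M N) (t : int) (k : nat) : nat :=
  if (t <= 0)%R then pp_entry L (k + `|t|)%N k else pp_entry L k (k + `|t|)%N.

(* |lambda^(t)| (all nonzero parts have index k <= M) *)
Definition slice_size (M N : nat) (L : PParray M N) (t : int) : nat :=
  (\sum_(1 <= k < (M + N).+1) pp_slice L t k)%N.

Definition left_vol (M N : nat) (L : PParray M N) : nat :=
  (\sum_(1 <= s < M.+1) slice_size L (- (s%:Z)))%N.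
Definition central_vol (M N : nat) (L : PParray M N) : nat := slice_size L 0.
Definition right_vol (M N : nat) (L : PParray M N) : nat :=
  (\sum_(1 <= s < N.+1) slice_size L (s%:Z))%N.

Definition pp_weight {R : realType} (M N : nat) (q a eta theta : R) (L : PParray M N) : R :=
  q `^ (eta * (left_vol L)%:R) * (a * q `^ ((eta + theta) / 2)) ^+ central_vol L
  * q `^ (theta * (right_vol L)%:R).

Definition pp_sum {R : realType} (M N : nat) (F : PParray M N -> R) : \bar R :=
  \esum_(L in [set L : PParray M N | is_plane_partition L]) (F L)%:E.

Definition pp_expect {R : realType} (M N : nat) (q a eta theta : R)
    (F : PParray M N -> R) : R :=
  (fine (pp_sum (fun L => pp_weight q a eta theta L * Num.max (F L) 0))
   - fine (pp_sum (fun L => pp_weight q a eta theta L * Num.max (- F L) 0)))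
  / fine (@pp_sum R M N (pp_weight q a eta theta)).

Definition Lt (M N : nat) (t : int) : nat :=
  if (t <= 0)%R then (M - `|t|)%N else minn (N - `|t|)%N M.

(* pairs (t, i), -M+1 <= t <= N-1, 1 <= i <= L_t, encoded as s = t + M - 1
   and i-1 *)
Definition Ix (M N : nat) :=
  {s : 'I_(M + N - 1) & 'I_(Lt M N ((s : nat)%:Z - (M - 1)%N%:Z))}.

Definition ix_t (M N : nat) (k : Ix M N) : int := ((tag k : nat)%:Z - (M - 1)%N%:Z).
Definition ix_i (M N : nat) (k : Ix M N) : nat := (tagged k : nat).+1.

Definition pp_array {R : realType} (M N : nat) (q : R) (L : PParray M N) : Ix M N -> R :=
  fun k => q ^+ pp_slice L (ix_t k) (ix_i k).

Definition bounded_continuous {R : realType} (I : finType) (f : (I -> R) -> R) : Prop :=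
  (exists C : R, forall x, `|f x| <= C) /\
  (forall x (e : R), 0 < e -> exists d : R, 0 < d /\
     forall y, (forall k, `|x k - y k| < d) -> `|f x - f y| < e).

Definition t_range (M N : nat) (t : int) : Prop := (- (M%:Z) + 1 <= t)%R /\ (t <= N%:Z - 1)%R.

Definition xext {R : realType} (M N : nat) (x : int -> nat -> R) (t : int) (i : nat) : R :=
  if i == (Lt M N t).+1 then 1 else x t i.

Definition limit_array_props {R : realType} (M N : nat) (x : int -> nat -> R) : Prop :=
  (forall t i, t_range M N t -> (1 <= i <= Lt M N t)%N -> 0 < x t i < 1) /\
  (forall t i, t_range M N t -> (1 <= i)%N -> (i < Lt M N t)%N -> x t i < x t i.+1) /\
  (forall t i, (- (M%:Z) + 1 <= t)%R -> (t <= -1)%R -> (1 <= i <= Lt M N t)%N ->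
      x (t + 1) i < x t i < x (t + 1) i.+1) /\
  (forall t i, (0 <= t)%R -> (t <= N%:Z - 2)%R -> (1 <= i <= Lt M N (t + 1))%N ->
      x t i < x (t + 1) i < xext M N x t i.+1).

(* iterated Lebesgue integral over [0,1]^n of F(x_1,...,x_n) (1-based) *)
Fixpoint iint01 {R : realType} (n : nat) (F : (nat -> R) -> \bar R) : \bar R :=
  match n with
  | 0 => F (fun _ => 0)
  | n'.+1 => (\int[@lebesgue_measure R]_(y in [set` `[0%R, 1%R]])
               iint01 n' (fun x => F (fun k => if k == n then y else x k)))%E
  end.

Definition weyl_chamber {R : realType} (n : nat) : set (nat -> R) :=
  [set x | 0 < x 1%N /\ (forall i, (1 <= i)%N -> (i < n)%N -> x i < x i.+1) /\ x n < 1].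

Definition wc {R : realType} (M N : nat) (alpha eta theta : R) (t : int) (x : R) : R :=
  if (t <= 0)%R then
    x `^ (alpha + (eta + theta) / 2 + (`|t|%:R) * eta - 1) * (1 - x `^ theta) ^+ (N - (M - `|t|))
  else if (M <= N - `|t|)%N then
    x `^ (alpha + (eta + theta) / 2 + (`|t|%:R) * theta - 1) * (1 - x `^ theta) ^+ (N - `|t| - M)
  else
    x `^ (alpha + (eta + theta) / 2 + (`|t|%:R) * theta - 1) * (1 - x `^ eta) ^+ (M - (N - `|t|)).

Definition slice_density {R : realType} (M N : nat) (alpha eta theta : R) (t : int)
    (x : nat -> R) : R :=
  let L := Lt M N t in
  \1_(weyl_chamber L) x *
  (\prod_(1 <= j < L.+1) \prod_(1 <= i < j)
      ((x j `^ eta - x i `^ eta) * (x j `^ theta - x i `^ theta))) *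
  \prod_(1 <= i < L.+1) wc M N alpha eta theta t (x i).

(* Main.v *)
(** The limit array [X] has density proportional to the product of [x^(g_t - 1)]
over all entries, restricted to the interlacing region, where [g_t] is [eta]
left of the diagonal, [alpha + (eta + theta) / 2] on it and [theta] right of it.

Convergence: equip the array indices with independent variables [y] of density
[g y^(g - 1)] on (0, 1]. Then [- ln y] is exponential of rate [g], so
[floor (- ln y / eps)] is geometric of ratio [e^(- eps g)], and the discretised
array carries exactly the weights of the plane partition measure, conditioned on
being a plane partition. As [eps] tends to 0 this event tends almost surely to
strict interlacing, and [q] to the power of the discretised array tends to [y];
dominated convergence gives the limit of the numerator and of the denominator.

Marginals: the slices on either side of slice [t] are integrated out one at a
time, starting from the ends. The partial results stay of the form
prod x_i^e (1 - x_i^c)^K * prod_(i < j) (x_j^c - x_i^c) with [c = eta] from the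
left and [c = theta] from the right. Each step is an integral of a Vandermonde
type determinant over a product of intervals whose end points are the entries of
the next slice; it is computed entry by entry and reassembled by telescoping row
operations. *)

Require Import Defs.
From HB Require Import structures.
From mathcomp Require Import all_boot all_order all_algebra.
From mathcomp Require Import all_classical all_reals all_analysis.
From mathcomp Require Import perm.
From mathcomp Require Import measurable_realfun uniform_distribution zify ring lra.
Set Implicit Arguments.
Unset Strict Implicit.
Unset Printing Implicit Defensive.
Import Order.TTheory GRing.Theory Num.Theory numFieldNormedType.Exports.
Local Open Scope ring_scope.
Local Open Scope classical_set_scope.

(** * Product sigma-algebra on real families; iterated integrals over unit cubes *)

Section coordinate_space.
Context (R : realType) (I : eqType).

(** Only nonnegative integrals are iterated, so Tonelli applies without integrability conditions.
    The obstacle is the signed terms of a determinant expansion; their negative coefficients are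
    moved to the other side of an equation.

    All slices live in one space of real functions on pairs (slice, position). A step integrates
    some coordinates and freezes the others, so a function of one slice needs no projection, and the
    limit law is a density against a uniform cube.

    Two Vandermonde products appear because the weights left of the diagonal, x^(eta - 1), are up to
    a constant the derivative of x^eta: integration from the left turns powers of x^eta into powers
    of x^eta, and likewise for theta from the right. Once factors (1 - x^c)^K appear, single
    antiderivatives are incomplete beta functions, which do not factor. Integration by parts shows
    that suitable combinations of two adjacent columns do factor, and this is what keeps the
    determinants in product form. *)

Definition cylinders : set (set (I -> R)) :=
  [set A | exists k (B : set R), measurable B /\ A = [set w | B (w k)]].

Definition coord_space := g_sigma_algebraType cylinders.

Lemma measurable_coord (k : I) :
  measurable_fun setT (fun w : coord_space => w k).
Proof.
move=> _ B mB; rewrite setTI; apply: sub_sigma_algebra.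
by exists k, B; split.
Qed.

Lemma measurable_coord_space d (T : measurableType d) (f : T -> coord_space) :
  (forall k, measurable_fun setT (fun x => f x k)) -> measurable_fun setT f.
Proof.
move=> mf; apply: (@measurability _ _ _ _ setT f cylinders) => //.
move=> _ [_ [k [B [mB ->]]] <-].
by have := mf k measurableT B mB; congr (measurable _).
Qed.

Definition upd (w : coord_space) (k : I) (y : R) : coord_space :=
  fun l => if l == k then y else w l.

Lemma upd_swap w k l y z : k != l ->
  upd (upd w k y) l z = upd (upd w l z) k y.
Proof.
move=> kl; apply/funext => i; rewrite /upd.
by case: (eqVneq i l) => // ->; rewrite eq_sym (negbTE kl).
Qed.

Lemma measurable_upd d (T : measurableType d) (k : I)
    (f : T -> coord_space) (g : T -> R) :
  measurable_fun setT f -> measurable_fun setT g ->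
  measurable_fun setT (fun x => upd (f x) k (g x)).
Proof.
move=> mf mg; apply: measurable_coord_space => l; rewrite /upd.
case: (l == k) => //.
exact: (measurableT_comp (measurable_coord l) mf).
Qed.

Local Notation mR := (measurableTypeR R).

Definition unif01 : probability mR R := uniform_prob (@ltr01 R).

Lemma integral_unif01 (f : mR -> \bar R) :
  measurable_fun setT f -> (forall x, 0 <= f x)%E ->
  (\int[unif01]_x f x = \int[@lebesgue_measure R]_(x in `[0%R, 1%R]) f x)%E.
Proof. by move=> mf f0; rewrite integral_uniform// subr0 invr1 mul1e. Qed.

Definition J1 (k : I) (F : coord_space -> \bar R) (w : coord_space) : \bar R :=
  (\int[unif01]_y F (upd w k y))%E.

(* [J s F w] integrates [F] over the unit cube in the coordinates listed in [s],
   the other coordinates being frozen at their values in [w]. *)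
Fixpoint J (s : seq I) (F : coord_space -> \bar R) : coord_space -> \bar R :=
  if s is k :: s' then J1 k (J s' F) else F.

Lemma J_cat s1 s2 F : J (s1 ++ s2) F = J s1 (J s2 F).
Proof. by elim: s1 => //= k s ->. Qed.

Let mupd2 k (F : coord_space -> \bar R) : measurable_fun setT F ->
  measurable_fun setT (fun z : coord_space * mR => F (upd z.1 k z.2)).
Proof. by move=> mF; apply: measurableT_comp => //; exact: measurable_upd. Qed.

Lemma J1_ge0 k F w : (forall w, 0 <= F w)%E -> (0 <= J1 k F w)%E.
Proof. by move=> F0; exact: integral_ge0. Qed.

Lemma measurable_J1 k F : measurable_fun setT F -> (forall w, 0 <= F w)%E ->
  measurable_fun setT (J1 k F).
Proof.
move=> mF F0.
exact: (@measurable_fun_fubini_tonelli_F _ _ _ _ _ unif01 _ (mupd2 k mF)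
  (fun z => F0 _)).
Qed.

Lemma J_ge0 s F w : (forall w, 0 <= F w)%E -> (0 <= J s F w)%E.
Proof. by elim: s w => //= k s IH w F0; apply: J1_ge0 => w'; exact: IH. Qed.

Lemma measurable_J s F : measurable_fun setT F -> (forall w, 0 <= F w)%E ->
  measurable_fun setT (J s F).
Proof.
move=> mF F0; elim: s => //= k s IH; apply: measurable_J1 => // w.
exact: J_ge0.
Qed.

Lemma measurable_upd1 k F w : measurable_fun setT F ->
  measurable_fun setT (fun y : mR => F (upd w k y) : \bar R).
Proof. by move=> mF; apply: measurableT_comp => //; exact: measurable_upd. Qed.

Lemma J1_swap k l F w : measurable_fun setT F -> (forall w, 0 <= F w)%E ->
  J1 k (J1 l F) w = J1 l (J1 k F) w.
Proof.
move=> mF F0; have [->//|kl] := eqVneq k l.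
rewrite /J1.
have mG : measurable_fun setT
    (fun z : mR * mR => F (upd (upd w k z.1) l z.2)).
  apply: measurableT_comp => //; apply: measurable_upd => //.
  exact: measurable_upd.
rewrite (@fubini_tonelli _ _ _ _ _ unif01 unif01 _ mG) => [|z//].
apply: eq_integral => z _; apply: eq_integral => y _.
by rewrite /= upd_swap.
Qed.

(** Tonelli. This is what allows the coordinates to be regrouped slice by slice, or cell by cell. *)
Lemma perm_J s1 s2 F : perm_eq s1 s2 ->
  measurable_fun setT F -> (forall w, 0 <= F w)%E -> J s1 F = J s2 F.
Proof.
move=> + mF F0; elim: s1 s2 => [|k s IH] s2.
  by rewrite perm_sym => /perm_nilP ->.
move=> ks2.
have : k \in s2 by rewrite -(perm_mem ks2) mem_head.
move=> /splitPr ks; case: ks ks2 => p1 p2 ks2.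
have {}ks2 : perm_eq s (p1 ++ p2).
  by move: ks2; rewrite perm_sym -cat1s perm_catCA /= perm_cons perm_sym.
rewrite /= (IH _ ks2) !J_cat /=.
(* The variable [k] is moved to the front past the prefix [p1], one swap at a time. *)
have : forall G, measurable_fun setT G -> (forall w, 0 <= G w)%E ->
    J1 k (J p1 G) = J p1 (J1 k G).
  elim: p1 {ks2} => //= l p1 IHp G mG G0; rewrite -IHp//.
  apply/funext => w; apply: J1_swap; first exact: measurable_J.
  by move=> ?; exact: J_ge0.
by apply; [exact: measurable_J|move=> ?; exact: J_ge0].
Qed.

Lemma J_local s F G w :
  (forall v, (forall k, k \notin s -> v k = w k) -> F v = G v) ->
  J s F w = J s G w.
Proof.
elim: s w => [|k s IH] w FG /=; first by apply: FG.
apply: eq_integral => y _; apply: IH => v vE; apply: FG => l.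
by rewrite inE negb_or => /andP[lk ls]; rewrite vE// /upd (negbTE lk).
Qed.

Lemma eq_J s F G : F =1 G -> J s F = J s G.
Proof. by move=> /funext ->. Qed.

Lemma JD s F G w : measurable_fun setT F -> (forall w, 0 <= F w)%E ->
  measurable_fun setT G -> (forall w, 0 <= G w)%E ->
  J s (fun w => F w + G w)%E w = (J s F w + J s G w)%E.
Proof.
move=> mF F0 mG G0; elim: s w => //= k s IH w; rewrite /J1.
under eq_integral do rewrite IH.
by rewrite ge0_integralD//;
  first [by apply: measurable_upd1; exact: measurable_J|by move=> *; exact: J_ge0].
Qed.

Lemma JZ s F (c : R) w : measurable_fun setT F -> (forall w, 0 <= F w)%E ->
  0 <= c -> J s (fun w => c%:E * F w)%E w = (c%:E * J s F w)%E.
Proof.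
move=> mF F0 c0; elim: s w => //= k s IH w; rewrite /J1.
under eq_integral do rewrite IH.
by rewrite ge0_integralZl//;
  first [by apply: measurable_upd1; exact: measurable_J|by move=> *; exact: J_ge0].
Qed.

Lemma J_sum s (A : Type) (r : seq A) (F : A -> coord_space -> \bar R) w :
  (forall a, measurable_fun setT (F a)) -> (forall a w, 0 <= F a w)%E ->
  J s (fun w => \sum_(a <- r) F a w)%E w = (\sum_(a <- r) J s (F a) w)%E.
Proof.
move=> mF F0; elim: r w => [|a r IH] w.
  rewrite big_nil (eq_J _ (G := fun w => 0%:E * 0)%E).
    by rewrite JZ ?mul0e.
  by move=> v; rewrite big_nil mul0e.
rewrite big_cons -IH -JD//; last 2 first.
  exact: emeasurable_sum.
  by move=> v; exact: sume_ge0.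
by apply: J_local => v _; rewrite big_cons.
Qed.

Lemma J_mulconst s F (g : coord_space -> R) w :
  measurable_fun setT F -> (forall w, 0 <= F w)%E -> (forall w, 0 <= g w) ->
  (forall v, (forall k, k \notin s -> v k = w k) -> g v = g w) ->
  J s (fun w => (g w)%:E * F w)%E w = ((g w)%:E * J s F w)%E.
Proof.
move=> mF F0 g0 gE; rewrite -JZ//.
by apply: J_local => v vE; rewrite gE.
Qed.

Definition updp (k : I) (z : coord_space * mR) : coord_space := upd z.1 k z.2.

Let measurable_updp k : measurable_fun setT (updp k).
Proof. exact: measurable_upd. Qed.

HB.instance Definition _ k :=
  isMeasurableFun.Build _ _ _ _ (updp k) (measurable_updp k).

Definition origin : coord_space := fun=> 0.

(** Law of independent uniform variables in the coordinates [s], the others being 0: each listed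
    coordinate of the origin is resampled in turn. *)
Fixpoint cube (s : seq I) : probability coord_space R :=
  if s is k :: s' then distribution (cube s' \x unif01)%E (updp k)
  else @dirac _ coord_space origin R.

(** The head of [s] is resampled last and is therefore integrated innermost, whereas [J] integrates
    it outermost; hence the reversal. *)
Lemma integral_cube_rev s F : measurable_fun setT F -> (forall w, 0 <= F w)%E ->
  (\int[cube s]_w F w = J (rev s) F origin)%E.
Proof.
elim: s F => [|k s IH] F mF F0; first by rewrite integral_dirac// diracT mul1e.
rewrite rev_cons -cats1 J_cat -IH; first last.
- by move=> w; exact: J1_ge0.
- exact: measurable_J1.
rewrite [LHS]ge0_integral_distribution//.
rewrite fubini_tonelli1//; last by move=> z; exact: F0.
exact: mupd2.
Qed.

Lemma integral_cube s F : measurable_fun setT F -> (forall w, 0 <= F w)%E ->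
  (\int[cube s]_w F w = J s F origin)%E.
Proof.
move=> mF F0; rewrite integral_cube_rev//.
by rewrite (@perm_J (rev s) s)// perm_rev.
Qed.

End coordinate_space.

(** * Integrals of powers over subintervals of the unit interval *)

Section power_integrals.
Context (R : realType).
Local Notation mu := (@lebesgue_measure R).
Local Notation mR := (measurableTypeR R).

Lemma measurable_itv_bool (a b : R) :
  measurable_fun setT (fun y : R => ((a < y < b)%R%:R : R)).
Proof.
rewrite (_ : (fun y => _) = \1_(`]a, b[%classic)); last first.
  by apply/funext => y; rewrite indicE mem_setE in_itv.
exact: measurable_indic.
Qed.

Lemma integral_unif01_itv (f : R -> R) (a b : R) : 0 <= a -> b <= 1 ->
  measurable_fun setT f -> (forall y, 0 <= f y) ->
  (\int[unif01 R]_y ((a < y < b)%R%:R * f y)%:E =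
   \int[mu]_(y in `]a, b[) (f y)%:E)%E.
Proof.
move=> a0 b1 mf f0.
rewrite integral_unif01; first last.
- by move=> x; rewrite lee_fin mulr_ge0.
- by apply/measurable_EFinP/measurable_funM => //; exact: measurable_itv_bool.
rewrite [LHS]integral_mkcond [RHS]integral_mkcond; apply: eq_integral => y _.
rewrite !patchE !mem_setE !in_itv/=; case: ifPn => [_|].
  by case: ifPn => _; rewrite ?mul1r ?mul0r.
case: ifPn => // /andP[ay yb].
by rewrite (le_trans a0 (ltW ay)) (le_trans (ltW yb) b1).
Qed.

Lemma measurable_powR_sub1 (c : R) : measurable_fun setT (fun y : R => y `^ (c - 1)).
Proof. exact: measurable_powR. Qed.

Let integral_powR_gt0 (a b c : R) : 0 < a -> a < b -> b <= 1 -> 0 < c ->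
  (\int[unif01 R]_y ((a < y < b)%R%:R * y `^ (c - 1))%:E =
   ((b `^ c - a `^ c) / c)%:E)%E.
Proof.
move=> a0 ab b1 c0; have := @integral_unif01_itv (fun y => y `^ (c - 1)) a b (ltW a0) b1
  (measurable_powR_sub1 c) (fun y => powR_ge0 y _) => ->.
rewrite -(@integral_itv_bndoo _ a b _ true false); last first.
  by apply/measurable_EFinP; apply: measurable_funTS; exact: measurable_powR_sub1.
have dpow (e x : R) : 0 < x -> derivable (fun y : R => y `^ e) x 1.
  by move=> x0; have /(@derivable_powR R 1 e) : x \in `]0, +oo[%R by rewrite in_itv/= x0.
have cpow (e x : R) : 0 < x -> {for x, continuous (fun y : R => y `^ e)}.
  move=> x0; apply: differentiable_continuous; apply/derivable1_diffP.
  exact: dpow.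
rewrite (@continuous_FTC2 R (fun y => y `^ (c - 1)) (fun y => y `^ c / c))//.
- by rewrite -EFinB mulrBl.
- apply: continuous_in_subspaceT => x; rewrite inE/= in_itv/= => /andP[ax _].
  exact: cpow (lt_le_trans a0 ax).
- have cF (x : R) : 0 < x -> {for x, continuous (fun y : R => y `^ c / c)}.
    by move=> x0; apply: cvgM; [exact: cpow|exact: cvg_cst].
  split.
  + move=> x; rewrite in_itv/= => /andP[ax _].
    apply: derivableM; last exact: derivable_cst.
    exact: dpow (lt_trans a0 ax).
  + exact/cvg_at_right_filter/cF.
  + exact/cvg_at_left_filter/cF/(lt_trans a0).
- move=> x; rewrite in_itv/= => /andP[ax _].
  have xp : x \in `]0%R, +oo[%R by rewrite in_itv/= (lt_trans a0 ax).
  rewrite derive1Mr; last exact: dpow (lt_trans a0 ax).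
  by rewrite powR_derive1// mulrAC mulfV ?mul1r// gt_eqF.
Qed.

(** For c < 1 the integrand is unbounded at 0, so the case a = 0 is reached by monotone convergence
    from positive lower end points. *)
Lemma integral_powR_itv (a b c : R) : 0 <= a -> a <= b -> b <= 1 -> 0 < c ->
  (\int[unif01 R]_y ((a < y < b)%R%:R * y `^ (c - 1))%:E =
   ((b `^ c - a `^ c) / c)%:E)%E.
Proof.
move=> a0; rewrite le_eqVlt => /predU1P[<- b1 c0|ab b1 c0].
  rewrite subrr mul0r integral0_eq// => y _.
  by case: ltgtP => //; rewrite mul0r.
move: a0; rewrite le_eqVlt => /predU1P[a0|a0]; last exact: integral_powR_gt0.
rewrite -{}a0 in ab *; rewrite powR0 ?gt_eqF// subr0.
(* The shift by 2 makes [u n < b] strict already for n = 0. *)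
pose u n : R := b / n.+2%:R.
have u0 n : 0 < u n by rewrite divr_gt0.
have ub n : u n < b by rewrite ltr_pdivrMr// ltr_pMr// ltr1n.
pose g n y : \bar R := ((u n < y < b)%R%:R * y `^ (c - 1))%:E.
have g0 n y : (0 <= g n y)%E by rewrite lee_fin mulr_ge0// powR_ge0.
have mg n : measurable_fun setT (g n : mR -> \bar R).
  apply/measurable_EFinP/measurable_funM; first exact: measurable_itv_bool.
  exact: measurable_powR_sub1.
have ug n : (\int[unif01 R]_y g n y = ((b `^ c - (u n) `^ c) / c)%:E)%E.
  exact: integral_powR_gt0.
have cu : u n @[n --> \oo] --> (0:R).
  rewrite -(mulr0 b); apply: cvgM; first exact: cvg_cst.
  by have := @cvg_harmonic R; rewrite -cvg_shiftS.
have cp : u n `^ c @[n --> \oo] --> (0:R).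
  exact: (cvg_at_rightP _ _ _).1 (powR_cvg0 c0) u (conj u0 cu).
have Icvg : (\int[unif01 R]_y g n y)%E @[n --> \oo] --> (b `^ c / c)%:E.
  under eq_fun do rewrite ug.
  apply: cvg_EFin; first by near=> n.
  apply: cvgM; last exact: cvg_cst.
  by rewrite -[X in _ --> X]subr0; apply: cvgB => //; exact: cvg_cst.
have ndg : forall y : mR, setT y -> {homo g^~ y : n m / (n <= m)%N >-> (n <= m)%E}.
  move=> y _ n m nm; rewrite lee_fin ler_wpM2r ?powR_ge0//.
  rewrite ler_nat leq_eqVlt; case: (boolP (u n < y < b)) => [/andP[uy yb]|_].
    rewrite yb andbT (le_lt_trans _ uy)//.
    by rewrite ler_pM2l// lef_pV2 ?posrE// ler_nat.
  by case: (_ < _ < _).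
have := @cvg_monotone_convergence _ mR R (unif01 R) setT measurableT g mg
  (fun n y _ => g0 n y) ndg.
move=> /(cvg_unique _) /(_ Icvg) <- //.
apply: eq_integral => y _; apply/esym/cvg_lim => //.
apply: cvg_near_cst; rewrite /g.
have [y0|y0] := ltP 0 y; last first.
  near=> n; suff -> : (u n < y) = false by [].
  by apply/negbTE; rewrite -leNgt (le_trans y0)// ltW.
by near=> n; suff -> : u n < y by []; near: n; exact: cvgr_lt cu _ y0.
Unshelve. all: by end_near. Qed.
(** Half-open intervals are the level sets of the discretisation [flo]; the added end point is a
    null set. *)
Lemma integral_powR_itvoc (a b c : R) : 0 <= a -> a <= b -> b <= 1 -> 0 < c ->
  (\int[unif01 R]_y ((a < y <= b)%R%:R * y `^ (c - 1))%:E =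
   ((b `^ c - a `^ c) / c)%:E)%E.
Proof.
move=> a0 ab b1 c0; rewrite -integral_powR_itv//.
have mp : measurable_fun setT (fun y : R => y `^ (c - 1)) := measurable_powR_sub1 c.
have p0 (y : R) : 0 <= y `^ (c - 1) by exact: powR_ge0.
rewrite (integral_unif01_itv a0 b1 mp p0).
rewrite integral_unif01; first last.
- by move=> y; rewrite lee_fin mulr_ge0.
- apply/measurable_EFinP/measurable_funM => //.
  rewrite (_ : (fun y => _) = \1_(`]a, b]%classic)); last first.
    by apply/funext => y; rewrite indicE mem_setE in_itv.
  exact: measurable_indic.
rewrite -(@integral_itv_bndoo _ a b _ false false); last first.
  by apply/measurable_EFinP; apply: measurable_funTS.
rewrite [LHS]integral_mkcond [RHS]integral_mkcond; apply: eq_integral => y _.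
rewrite !patchE !mem_setE !in_itv/=; case: ifPn => [_|].
  by case: ifPn => _; rewrite ?mul1r ?mul0r.
case: ifPn => // /andP[ay yb].
by rewrite (le_trans a0 (ltW ay)) (le_trans yb b1).
Qed.

End power_integrals.

(** * Entrywise integration of determinants *)

Section determinant_integrals.
Context (R : realType) (I : eqType).
Local Notation mR := (measurableTypeR R).
Local Notation Om := (coord_space R I).

(* Signed combinations reduce to nonnegative ones by moving the negative
   coefficients to the other side. *)
Lemma J_lincomb (s : seq I) (A : Type) (r : seq A) (c : A -> R)
    (F : A -> Om -> R) (g : A -> R) w :
  (forall a, measurable_fun setT (F a)) -> (forall a w, 0 <= F a w) ->
  (forall a, J s (fun w => (F a w)%:E) w = (g a)%:E) ->
  (forall w, 0 <= \sum_(a <- r) c a * F a w) ->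
  J s (fun w => (\sum_(a <- r) c a * F a w)%:E) w =
  (\sum_(a <- r) c a * g a)%:E.
Proof.
move=> mF F0 Fg cF0.
have part (e : A -> R) : (forall a, 0 <= e a) ->
    J s (fun w => (\sum_(a <- r) e a * F a w)%:E) w =
    (\sum_(a <- r) e a * g a)%:E.
  move=> e0.
  rewrite (eq_J s (G := fun v => \sum_(a <- r) (e a)%:E * (F a v)%:E)%E); last first.
    by move=> v; rewrite -sumEFin; apply: eq_bigr => a _; rewrite EFinM.
  rewrite J_sum; first last.
  - by move=> a v; rewrite mule_ge0 ?lee_fin.
  - by move=> a; apply: emeasurable_funM => //; exact/measurable_EFinP.
  rewrite -sumEFin; apply: eq_bigr => a _.
  rewrite JZ ?Fg//; last by move=> v; rewrite lee_fin.
  exact/measurable_EFinP.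
pose cp a := Num.max (c a) 0; pose cm a := Num.max (- c a) 0.
have cpm a : c a = cp a - cm a by rewrite /cp /cm; case: (leP (c a) 0) => ?;
  case: (leP (- c a) 0) => ?; lra.
have cp0 a : 0 <= cp a by rewrite le_max lexx orbT.
have cm0 a : 0 <= cm a by rewrite le_max lexx orbT.
have msum (e : A -> R) :
    measurable_fun setT (fun w : Om => (\sum_(a <- r) e a * F a w)%:E : \bar R).
  apply/measurable_EFinP/measurable_sum => a.
  by apply: measurable_funM => //.
have : (J s (fun w => (\sum_(a <- r) c a * F a w)%:E) w +
        (\sum_(a <- r) cm a * g a)%:E = (\sum_(a <- r) cp a * g a)%:E)%E.
  rewrite -(part cm cm0) -(part cp cp0) -JD//; last first.
    by move=> v; rewrite lee_fin sumr_ge0// => a _; rewrite mulr_ge0.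
  apply: J_local => v _; rewrite -EFinD -big_split/=; congr (_%:E).
  by apply: eq_bigr => a _; rewrite -mulrDl cpm subrK.
move=> /(congr1 (fun x => x - (\sum_(a <- r) cm a * g a)%:E)%E).
rewrite addeK// => ->; rewrite -EFinB -sumrB; congr (_%:E).
by apply: eq_bigr => a _; rewrite -mulrBl -cpm.
Qed.

Lemma J_prod (A : eqType) (p : A -> I) (r : seq A) (f : A -> R -> R)
    (g : A -> R) w :
  injective p -> uniq r ->
  (forall a, measurable_fun setT (f a)) -> (forall a y, 0 <= f a y) ->
  (forall a, \int[unif01 R]_y (f a y)%:E = (g a)%:E)%E ->
  J (map p r) (fun w => (\prod_(a <- r) f a (w (p a)))%:E) w =
  (\prod_(a <- r) g a)%:E.
Proof.
move=> ip ur mf f0 fg; elim: r ur w => [|a r IH]/=.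
  by move=> _ w; rewrite !big_nil.
move=> /andP[ar ur] w; rewrite big_cons EFinM -(fg a) muleC.
have gr0 : 0 <= \prod_(b <- r) g b.
  rewrite prodr_ge0// => b _; rewrite -lee_fin -fg.
  by apply: integral_ge0 => y _; rewrite lee_fin.
rewrite /J1 -ge0_integralZl//; first last.
- by move=> y _; rewrite lee_fin.
- by apply/measurable_EFinP; exact: mf.
apply: eq_integral => y _; rewrite -(IH ur (upd w (p a) y)) muleC.
transitivity (J (map p r) (fun v => (f a (v (p a)))%:E *
    (\prod_(b <- r) f b (v (p b)))%:E)%E (upd w (p a) y)).
  by apply: J_local => v _; rewrite big_cons EFinM.
have pr : p a \notin map p r by rewrite mem_map.
rewrite (@J_mulconst _ _ (map p r) _ (fun v => f a (v (p a)))).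
- by rewrite /upd eqxx.
- apply/measurable_EFinP/measurable_prod => b _.
  by apply: measurableT_comp (mf b) _; exact: measurable_coord.
- by move=> v; rewrite lee_fin prodr_ge0.
- by move=> v.
- by move=> v /(_ _ pr) ->.
Qed.

(** Row i involves the single variable [w (p i)], so each Leibniz term is a product of functions of
    distinct variables and integrates factor by factor. Linearity for signed sums comes from
    [J_lincomb], whence the assumption that the whole integrand is nonnegative. *)
Lemma J_det n (p : 'I_n -> I) (f : 'I_n -> 'I_n -> R -> R)
    (A : 'M[R]_n) (c : R) (w : Om) :
  injective p ->
  (forall i j, measurable_fun setT (f i j)) -> (forall i j y, 0 <= f i j y) ->
  (forall i j, \int[unif01 R]_y (f i j y)%:E = (A i j)%:E)%E ->
  (forall w : Om, 0 <= c * \det (\matrix_(i, j) f i j (w (p i)))) ->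
  J [seq p i | i <- enum 'I_n]
    (fun w => (c * \det (\matrix_(i, j) f i j (w (p i))))%:E) w =
  (c * \det A)%:E.
Proof.
move=> ip mf f0 fA det0.
have detE (v : Om) : c * \det (\matrix_(i, j) f i j (v (p i))) =
    \sum_(s : 'S_n) (c * (-1) ^+ s) * \prod_(i <- enum 'I_n) f i (s i) (v (p i)).
  rewrite /determinant big_distrr/=; apply: eq_bigr => s _.
  rewrite mulrA; congr (_ * _); rewrite big_enum/=.
  by apply: eq_bigr => i _; rewrite mxE.
rewrite (eq_J _ (G := fun v => (\sum_(s : 'S_n)
   (c * (-1) ^+ s) * \prod_(i <- enum 'I_n) f i (s i) (v (p i)))%:E)); last first.
  by move=> v; rewrite detE.
rewrite (J_lincomb (g := fun s : 'S_n => \prod_(i <- enum 'I_n) A i (s i))).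
- congr (_%:E); rewrite /determinant big_distrr/=; apply: eq_bigr => s _.
  by rewrite mulrA big_enum.
- move=> s; apply: measurable_prod => i _.
  by apply: measurableT_comp (mf _ _) _; exact: measurable_coord.
- by move=> s v; rewrite prodr_ge0.
- by move=> s; apply: (J_prod (p := p) (f := fun i => f i (s i)) (g := fun i => A i (s i))) => //; exact: enum_uniq.
- by move=> v; rewrite -detE.
Qed.

End determinant_integrals.

(** * Polynomials in a real power of the variable *)

Section generalized_polynomials.
Context (R : realType).

Lemma integral_gpoly (q : {poly R}) (a b c e : R) :
  0 <= a -> a <= b -> b <= 1 -> 0 < e -> 0 <= c ->
  (forall u, 0 <= u <= 1 -> 0 <= q.[u]) ->
  (\int[unif01 R]_y ((a < y < b)%R%:R * (y `^ (e - 1) * q.[y `^ c]))%:E =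
   (\sum_(j < size q) q`_j * ((b `^ (e + c * j%:R) - a `^ (e + c * j%:R))
       / (e + c * j%:R)))%:E)%E.
Proof.
move=> a0 ab b1 e0 c0 q0.
(* The coefficients of [q] may be negative. Indexing by [unit] makes the integral an instance of [J]
   in one coordinate, so that [J_lincomb] applies. *)
pose F (j : 'I_(size q)) (v : coord_space R unit) : R :=
  (a < v tt < b)%R%:R * v tt `^ (e + c * j%:R - 1).
have ej (j : nat) : 0 < e + c * j%:R by rewrite ltr_wpDr// mulr_ge0.
have FE (v : coord_space R unit) :
    (a < v tt < b)%R%:R * (v tt `^ (e - 1) * q.[v tt `^ c]) =
    \sum_(j < size q) q`_j * F j v.
  rewrite /F; case: (boolP (a < v tt < b)) => [/andP[av vb]|_]; last first.
    by rewrite mul0r big1// => j _; rewrite mul0r mulr0.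
  rewrite mul1r horner_coef big_distrr/=; apply: eq_bigr => j _.
  have v0 : 0 < v tt by exact: le_lt_trans av.
  rewrite mul1r mulrCA; congr (_ * _).
  rewrite -powR_mulrn ?powR_ge0// -powRrM -powRD; last by rewrite (gt_eqF v0) implybT.
  by congr (_ `^ _); lra.
have := @J_lincomb R unit [:: tt] _ (index_enum 'I_(size q)) (fun j => q`_j) F
  (fun j => (b `^ (e + c * j%:R) - a `^ (e + c * j%:R)) / (e + c * j%:R))
  (@origin R unit).
move=> <-; last first.
- move=> v; rewrite -FE; case: (boolP (a < v tt < b)) => [/andP[av vb]|_].
    rewrite mul1r mulr_ge0 ?powR_ge0// q0// powR_ge0/=.
    have : v tt `^ c <= 1 `^ c.
      apply: ge0_ler_powR => //; rewrite ?nnegrE //.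
        exact: le_trans a0 (ltW av).
      exact: le_trans (ltW vb) b1.
    by rewrite powR1.
  by rewrite mul0r.
- move=> j; rewrite -integral_powR_itv//.
- by move=> j v; rewrite mulr_ge0// powR_ge0.
- move=> j; apply: measurable_funM.
    by apply: measurableT_comp (measurable_itv_bool a b) _; exact: measurable_coord.
  by apply: measurableT_comp (measurable_powR_sub1 _) _; exact: measurable_coord.
by apply: eq_integral => y _; rewrite -FE.
Qed.

End generalized_polynomials.

(** * Determinants of increments and Vandermonde determinants *)

Section determinants.
Context (R : realType).

(** Since row 0 of [F] vanishes, each later row is a partial sum of increments, and partial
    summation is multiplication by a lower unitriangular matrix. *)
Lemma det_telescope n (F : nat -> nat -> R) : (forall j, F 0%N j = 0) ->
  \det (\matrix_(i < n, j < n) (F i.+1 j - F i j)) =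
  \det (\matrix_(i < n, j < n) F i.+1 j).
Proof.
move=> F0; pose L : 'M[R]_n := \matrix_(i, j) (j <= i)%N%:R.
have -> : \matrix_(i < n, j < n) F i.+1 j =
    L *m \matrix_(i < n, j < n) (F i.+1 j - F i j).
  apply/matrixP => i j; rewrite !mxE.
  under eq_bigr do rewrite !mxE.
  rewrite -[LHS]subr0 -[X in _ - X = _](F0 j) -(telescope_sumr (fun k => F k j) (leq0n i.+1)).
  rewrite big_mkord (big_ord_widen n (fun k => F k.+1 j - F k j) (ltn_ord i)).
  rewrite [LHS]big_mkcond/=; apply: eq_bigr => k _.
  by rewrite ltnS; case: leqP => _; rewrite ?mul1r ?mul0r.
rewrite det_mulmx det_trig; last first.
  by apply/is_trig_mxP => i j ij; rewrite mxE leqNgt ij.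
by rewrite big1 ?mul1r// => i _; rewrite mxE leqnn.
Qed.

(** With the vanishing row at the other end, the increments are summed from i upwards and give minus
    row i; each of the n rows contributes one sign. *)
Lemma det_telescope_rev n (F : nat -> nat -> R) : (forall j, F n j = 0) ->
  \det (\matrix_(i < n, j < n) (F i.+1 j - F i j)) =
  (-1) ^+ n * \det (\matrix_(i < n, j < n) F i j).
Proof.
move=> Fn; pose U : 'M[R]_n := \matrix_(i, j) (i <= j)%N%:R.
rewrite -detZ.
have -> : -1 *: \matrix_(i < n, j < n) F i j =
    U *m \matrix_(i < n, j < n) (F i.+1 j - F i j).
  apply/matrixP => i j; rewrite !mxE.
  under eq_bigr do rewrite !mxE.
  rewrite mulN1r -[LHS]add0r -[X in X - _ = _](Fn j).
  rewrite -(telescope_sumr (fun k => F k j) (ltnW (ltn_ord i))).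
  rewrite -[in RHS](big_mkord xpredT (fun k => (i <= k)%N%:R * (F k.+1 j - F k j))).
  rewrite [RHS](big_cat_nat (n := i))//=; last exact: ltnW.
  rewrite [X in _ = X + _](_ : _ = 0) ?add0r; last first.
    by rewrite big_nat big1// => k /andP[_ ki]; rewrite leqNgt ki mul0r.
  rewrite [RHS]big_nat [LHS]big_nat; apply: eq_bigr => k /andP[ik kn].
  by rewrite ik mul1r.
rewrite det_mulmx -(det_tr U) det_trig; last first.
  by apply/is_trig_mxP => i j ij; rewrite !mxE leqNgt ij.
by rewrite big1 ?mul1r// => i _; rewrite !mxE leqnn.
Qed.

Definition Vc (c : R) (n : nat) (z : nat -> R) : R :=
  \prod_(1 <= j < n.+1) \prod_(1 <= i < j) (z j `^ c - z i `^ c).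

Lemma det_powers c n (z : nat -> R) :
  \det (\matrix_(i < n, j < n) (z i.+1 `^ c) ^+ j) = Vc c n z.
Proof.
have -> : \matrix_(i < n, j < n) (z i.+1 `^ c) ^+ j =
    (Vandermonde n (\row_(i < n) (z i.+1 `^ c)))^T.
  by apply/matrixP => i j; rewrite !mxE.
rewrite det_tr det_Vandermonde (exchange_big_dep xpredT)//= /Vc big_add1/= big_mkord.
apply: eq_bigr => j _; rewrite big_add1/= big_mkord.
rewrite (big_ord_widen n (fun i => z j.+1 `^ c - z i.+1 `^ c)); last exact: ltnW.
by apply: eq_bigr => i _; rewrite !mxE.
Qed.

Lemma Vc_gt0 c n (z : nat -> R) : 0 < c ->
  (forall i, (1 <= i <= n)%N -> 0 < z i) ->
  (forall i j, (1 <= i)%N -> (i < j)%N -> (j <= n)%N -> z i < z j) ->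
  0 < Vc c n z.
Proof.
move=> c0 z0 zlt; rewrite /Vc big_nat prodr_gt0// => j /andP[j1 jn].
rewrite big_nat prodr_gt0// => i /andP[i1 ij].
rewrite subr_gt0 gt0_ltr_powR ?nnegrE//.
- by rewrite ltW// z0// i1/= (leq_trans (ltnW ij)).
- by rewrite ltW// z0// j1.
- exact: zlt.
Qed.

Lemma eq_Vc c n (z z' : nat -> R) :
  (forall i, (1 <= i <= n)%N -> z i = z' i) -> Vc c n z = Vc c n z'.
Proof.
move=> zz'; rewrite /Vc !big_nat; apply: eq_bigr => j /andP[j1 jn].
rewrite !big_nat; apply: eq_bigr => i /andP[i1 ij].
by rewrite !zz'// ?j1 ?i1//= (leq_trans (ltnW ij)).
Qed.

Lemma det_scaled_powers c n (z h : nat -> R) (k : nat -> R) :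
  \det (\matrix_(i < n, j < n) (h i.+1 * (z i.+1 `^ c) ^+ j * k j)) =
  (\prod_(1 <= i < n.+1) h i) * Vc c n z * \prod_(j < n) k j.
Proof.
have -> : \matrix_(i < n, j < n) (h i.+1 * (z i.+1 `^ c) ^+ j * k j) =
   diag_mx (\row_(i < n) h i.+1) *m (\matrix_(i < n, j < n) (z i.+1 `^ c) ^+ j)
   *m diag_mx (\row_(j < n) k j).
  rewrite mul_diag_mx mul_mx_diag.
  by apply/matrixP => i j; rewrite !mxE.
rewrite !det_mulmx !det_diag det_powers big_add1/= big_mkord.
by congr (_ * _ * _); apply: eq_bigr => i _; rewrite mxE.
Qed.

End determinants.

(** * Antiderivatives of y^(e - 1) q(y^c) *)

Section antiderivative.
Context (R : realType) (e c : R).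
Context (e0 : 0 < e) (c0 : 0 < c).

(** Termwise integration of y^(e - 1) q(y^c): the term of degree k becomes y^(e + c k) / (e + c k).
    Thus [gint q] is the antiderivative that vanishes at 0. *)
Definition intpoly (q : {poly R}) : {poly R} :=
  \poly_(k < size q) (q`_k / (e + c * k%:R)).

Definition gint (q : {poly R}) (x : R) : R := x `^ e * (intpoly q).[x `^ c].

Let ec0 (k : nat) : e + c * k%:R != 0.
Proof. by rewrite gt_eqF// ltr_pwDl// mulr_ge0// ltW. Qed.

Lemma coef_intpoly q k : (intpoly q)`_k = q`_k / (e + c * k%:R).
Proof.
rewrite coef_poly; case: ltnP => // /leq_sizeP/(_ k (leqnn k)) ->.
by rewrite mul0r.
Qed.

Lemma intpoly_lin (a b : R) p q :
  intpoly (a *: p + b *: q) = a *: intpoly p + b *: intpoly q.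
Proof.
apply/polyP => k; rewrite coefD !coefZ !coef_intpoly coefD !coefZ.
by rewrite mulrDl !mulrA.
Qed.

Lemma gint_lin (a b : R) p q x :
  gint (a *: p + b *: q) x = a * gint p x + b * gint q x.
Proof. by rewrite /gint intpoly_lin hornerD !hornerZ; ring. Qed.

(** The derivative of x^e p(x^c) is x^(e - 1) times the polynomial e p + c X p' taken at x^c. On X^k
    this operator multiplies by e + c k, the factor that [intpoly] divides by. *)
Lemma intpolyK p : intpoly (e *: p + c *: ('X * deriv p)) = p.
Proof.
apply/polyP => k; rewrite coef_intpoly coefD !coefZ coefXM coef_deriv.
case: k => [|k]/=; first by rewrite ?mulr0n !mulr0 !addr0 mulrAC mulfV ?mul1r ?gt_eqF.
rewrite -(mulr_natr p`_k.+1); have -> : e * p`_k.+1 + c * (p`_k.+1 * k.+1%:R) =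
    p`_k.+1 * (e + c * k.+1%:R) by ring.
by rewrite mulfK.
Qed.

Lemma gintK p x : gint (e *: p + c *: ('X * deriv p)) x = x `^ e * p.[x `^ c].
Proof. by rewrite /gint intpolyK. Qed.

Lemma gint0 q : gint q 0 = 0.
Proof. by rewrite /gint powR0 ?mul0r// gt_eqF. Qed.

Lemma gintE q x : 0 <= x ->
  gint q x = \sum_(k < size q) q`_k * (x `^ (e + c * k%:R) / (e + c * k%:R)).
Proof.
move=> x0; rewrite /gint horner_poly big_distrr/=; apply: eq_bigr => k _.
rewrite powRD ?(negbTE (ec0 k))//.
rewrite powRrM powR_mulrn ?powR_ge0//; ring.
Qed.

Lemma gintXn k x : 0 <= x ->
  gint 'X^k x = x `^ e * (x `^ c) ^+ k / (e + c * k%:R).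
Proof.
move=> x0; rewrite /gint -mulrA; congr (_ * _).
rewrite (_ : intpoly 'X^k = (e + c * k%:R)^-1 *: 'X^k).
  by rewrite hornerZ hornerXn mulrC.
apply/polyP => i; rewrite coef_intpoly coefZ coefXn.
by case: eqVneq => [->|_]; rewrite ?mul0r ?mulr0// mul1r mulr1.
Qed.

Lemma integral_gint (q : {poly R}) (a b : R) :
  0 <= a -> a <= b -> b <= 1 -> (forall u, 0 <= u <= 1 -> 0 <= q.[u]) ->
  (\int[unif01 R]_y ((a < y < b)%R%:R * (y `^ (e - 1) * q.[y `^ c]))%:E =
   (gint q b - gint q a)%:E)%E.
Proof.
move=> a0 ab b1 q0; rewrite integral_gpoly ?(ltW c0)//; congr (_%:E).
rewrite !gintE ?(le_trans a0 ab)// -sumrB; apply: eq_bigr => j _.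
by rewrite -mulrBr mulrBl.
Qed.

(** Column j of a Vandermonde matrix with the weight (1 - u)^K absorbed. *)
Definition jpol K j : {poly R} := 'X^j * (1 - 'X) ^+ K.

Lemma horner_jpol K j u : (jpol K j).[u] = u ^+ j * (1 - u) ^+ K.
Proof. by rewrite /jpol hornerM hornerXn horner_exp !hornerE. Qed.

Lemma jpol_ge0 K j u : 0 <= u <= 1 -> 0 <= (jpol K j).[u].
Proof.
move=> /andP[u0 u1]; rewrite horner_jpol.
by rewrite mulr_ge0 ?exprn_ge0// subr_ge0.
Qed.

Let deriv_jpol K j : e *: jpol K.+1 j + c *: ('X * deriv (jpol K.+1 j)) =
  (e + c * j%:R) *: jpol K j + (- (e + c * j%:R + c * K.+1%:R)) *: jpol K j.+1.
Proof.
have hX : 'X * deriv ('X^j : {poly R}) = j%:R * 'X^j.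
  rewrite derivXn -mulr_natl mulrCA; case: j => [|j]; first by rewrite !mul0r.
  by rewrite -exprS.
have hY : deriv ((1 - 'X) ^+ K.+1 : {poly R}) = - (K.+1%:R * (1 - 'X) ^+ K).
  by rewrite deriv_exp derivB derivX -polyC1 derivC sub0r mulN1r mulNrn mulr_natl.
rewrite /jpol derivM hY mulrDr [in 'X * (_ * _)]mulrA hX.
rewrite -!mul_polyC polyCN !polyCD !polyCM !polyC_natr [in 'X^(j.+1)]exprS.
rewrite [(1 - 'X) ^+ K.+1]exprS.
move: ('X^j) ((1 - 'X) ^+ K) (j%:R : {poly R}) (K.+1%:R : {poly R}) e%:P c%:P => A B a b E C.
by rewrite mulrN; ring.
Qed.

(** Integration by parts for the incomplete beta function. A single [gint (jpol K j)] does not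
    factor, but this combination of two adjacent columns does, it raises the exponent of 1 - x^c by
    one, and it vanishes at x = 1. *)
Lemma gint_jpol K j x :
  (e + c * j%:R) * gint (jpol K j) x
    - (e + c * j%:R + c * K.+1%:R) * gint (jpol K j.+1) x =
  x `^ e * ((x `^ c) ^+ j * (1 - x `^ c) ^+ K.+1).
Proof.
rewrite -mulNr -gint_lin -deriv_jpol gintK.
by rewrite horner_jpol.
Qed.

(** These are values B_K of the beta function, up to scaling; the recursion at x = 1 gives (e + c (K
    + 1)) B_(K + 1) = c (K + 1) B_K. *)
Lemma gint_jpol1_gt0 K : 0 < gint (jpol K 0) 1.
Proof.
elim: K => [|K IH].
  have -> : jpol 0 0 = 'X^0 by rewrite /jpol !expr0 mulr1.
  by rewrite gintXn// expr0 mulr0 addr0 powR1 !mul1r invr_gt0.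
have := gint_jpol K 0 1; rewrite powR1 subrr expr0n !mulr0 addr0.
move=> /eqP; rewrite subr_eq0 => /eqP E.
have EK : gint (jpol K.+1 0) 1 = gint (jpol K 0) 1 - gint (jpol K 1) 1.
  rewrite -[X in X - _]mul1r -mulN1r -gint_lin; congr (gint _ _).
  by rewrite /jpol exprS scale1r scaleN1r expr1; ring.
have p1 : 0 < c * K.+1%:R by rewrite mulr_gt0.
have p2 : 0 < e + c * K.+1%:R by exact: addr_gt0.
rewrite -(pmulr_rgt0 _ p2) EK mulrBr -E; 
have -> : (e + c * K.+1%:R) * gint (jpol K 0) 1 - e * gint (jpol K 0) 1 =
  c * K.+1%:R * gint (jpol K 0) 1 by ring.
exact: mulr_gt0.
Qed.

End antiderivative.

(** * Integration of one slice over a product of intervals *)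

Section row_integrals.
Context (R : realType).
Local Notation Om := (coord_space R (nat * nat)%type).

(** Listed from n downwards, so that [J] integrates the last variable outermost, as [iint01]
    does. *)
Fixpoint rowix (s n : nat) : seq (nat * nat) :=
  if n is n'.+1 then (s, n) :: rowix s n' else [::].

Lemma mem_rowix s n k : (k \in rowix s n) = (k.1 == s) && (0 < k.2 <= n)%N.
Proof.
case: k => t j; elim: n => [|n IH]/=; first by move: j => i /=; rewrite in_nil; case: (t == s) => //=; lia.
rewrite inE IH /= xpair_eqE.
by case: (t == s) => //=; lia.
Qed.

Lemma uniq_rowix s n : uniq (rowix s n).
Proof. by elim: n => //= n ->; rewrite mem_rowix/= ltnn andbF. Qed.

Lemma perm_rowix s n : perm_eq (rowix s n) [seq (s, i.+1) | i : 'I_n <- enum 'I_n].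
Proof.
apply: uniq_perm; first exact: uniq_rowix.
  by rewrite map_inj_uniq ?enum_uniq// => i j [] /val_inj.
move=> [t i]; rewrite mem_rowix/=; apply/idP/mapP.
  move=> /andP[/eqP -> /andP[i0 ilen]].
  have h : (i.-1 < n)%N by lia.
  by exists (Ordinal h); rewrite ?mem_enum//= prednK.
by move=> [j _ [-> ->]]; rewrite eqxx/=.
Qed.

(** Common integrand of all the one-slice integrations; [lo] and [hi] will be read off the
    neighbouring slice. *)
Definition rowint (s n : nat) (lo hi : nat -> R) (e c : R) (K : nat)
    (w : Om) : R :=
  (\prod_(1 <= i < n.+1) ((lo i < w (s, i) < hi i)%R%:R *
     (w (s, i) `^ (e - 1) * (1 - w (s, i) `^ c) ^+ K))) *
  Vc c n (fun i => w (s, i)).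

Lemma measurable_Vc c n s :
  measurable_fun setT (fun w : Om => Vc c n (fun i => w (s, i))).
Proof.
apply: measurable_prod => j _; apply: measurable_prod => i _.
by apply: measurable_funB; apply: measurableT_comp (measurable_powR _) _;
  exact: measurable_coord.
Qed.

Lemma measurable_rowint s n lo hi e c K :
  measurable_fun setT (rowint s n lo hi e c K).
Proof.
apply: measurable_funM; last exact: measurable_Vc.
apply: measurable_prod => i _; apply: measurable_funM.
  by apply: measurableT_comp (measurable_itv_bool _ _) _; exact: measurable_coord.
apply: measurable_funM.
  by apply: measurableT_comp (measurable_powR _) _; exact: measurable_coord.
apply: measurable_funX; apply: measurable_funB => //.
by apply: measurableT_comp (measurable_powR _) _; exact: measurable_coord.
Qed.

Lemma measurable_jpol (e c : R) K j (a b : R) : measurable_fun setT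
  (fun y : R => (a < y < b)%R%:R * (y `^ (e - 1) * (jpol R K j).[y `^ c])).
Proof.
apply: measurable_funM; first exact: measurable_itv_bool.
apply: measurable_funM; first exact: measurable_powR.
rewrite (_ : (fun y => _) = (fun y : R => (y `^ c) ^+ j * (1 - y `^ c) ^+ K)); last first.
  by apply/funext => y; rewrite horner_jpol.
apply: measurable_funM; apply: measurable_funX; first exact: measurable_powR.
by apply: measurable_funB => //; exact: measurable_powR.
Qed.

Lemma powR_le1 (x c : R) : 0 <= x <= 1 -> 0 <= c -> 0 <= x `^ c <= 1.
Proof.
move=> /andP[x0 x1] c0; rewrite powR_ge0/=.
have : x `^ c <= 1 `^ c by apply: ge0_ler_powR; rewrite ?nnegrE.
by rewrite powR1.
Qed.

Section row.
Context (s n : nat) (lo hi : nat -> R) (e c : R) (K : nat).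
Context (e0 : 0 < e) (c0 : 0 < c).
Context (lohi : forall i, (1 <= i <= n)%N -> [/\ 0 <= lo i, lo i <= hi i & hi i <= 1]).
Context (sep : forall i j, (1 <= i)%N -> (i < j)%N -> (j <= n)%N -> hi i <= lo j).

(** Where the indicators are nonzero, the separated intervals force the variables to increase, which
    makes the Vandermonde product positive. *)
Lemma rowint_ge0 w : 0 <= rowint s n lo hi e c K w.
Proof.
have [/allP bx|] := boolP (all (fun i => lo i < w (s, i) < hi i) (index_iota 1 n.+1)).
  have {}bx i : (1 <= i <= n)%N -> lo i < w (s, i) < hi i.
    by move=> hi1; apply: bx; rewrite mem_index_iota ltnS.
  rewrite mulr_ge0//.
    rewrite big_nat prodr_ge0// => i hi1.
    have /andP[lw wh] := bx i hi1; have [l0 lh h1] := lohi hi1.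
    rewrite !mulr_ge0 ?powR_ge0// exprn_ge0// subr_ge0.
    have : 0 <= w (s, i) <= 1.
      by rewrite (le_trans l0 (ltW lw)) (le_trans (ltW wh) h1).
    by move=> /powR_le1 /(_ (ltW c0)) /andP[].
  apply/ltW/Vc_gt0 => //.
    by move=> i hi1; have /andP[lw _] := bx i hi1; have [l0 _ _] := lohi hi1;
      exact: le_lt_trans lw.
  move=> i j i1 ij jn.
  have /andP[_ wh] : lo i < w (s, i) < hi i by apply: bx; lia.
  have /andP[lw _] : lo j < w (s, j) < hi j by apply: bx; lia.
  exact: lt_trans wh (le_lt_trans (sep i1 ij jn) lw).
move=> /allPn[i]; rewrite mem_index_iota => hi1 /negbTE ni.
by rewrite /rowint (big_rem i)/= ?mem_index_iota// ni !mul0r.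
Qed.

(** The indicator and the weights of the i-th variable are absorbed into row i of the Vandermonde
    matrix, after which every row depends on one variable. *)
Lemma J_rowint w :
  J (rowix s n) (fun w => (rowint s n lo hi e c K w)%:E) w =
  (\det (\matrix_(i < n, j < n)
    (gint e c (jpol R K j) (hi i.+1) - gint e c (jpol R K j) (lo i.+1))))%:E.
Proof.
rewrite (perm_J (perm_rowix s n)); first last.
- by move=> v; rewrite lee_fin rowint_ge0.
- by apply/measurable_EFinP; exact: measurable_rowint.
pose f (i j : 'I_n) (y : R) : R :=
  (lo i.+1 < y < hi i.+1)%R%:R * (y `^ (e - 1) * (jpol R K j).[y `^ c]).
have detE (v : Om) : rowint s n lo hi e c K v =
    1 * \det (\matrix_(i, j) f i j (v (s, i.+1))).
  have := @det_scaled_powers _ c n (fun i => v (s, i))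
     (fun i => (lo i < v (s, i) < hi i)%R%:R *
       (v (s, i) `^ (e - 1) * (1 - v (s, i) `^ c) ^+ K)) (fun=> 1).
  rewrite [\prod_(j < n) _]big1// mulr1 mul1r /rowint => <-.
  congr (\det _); apply/matrixP => i j; rewrite !mxE mulr1 /f.
  by rewrite horner_jpol -!mulrA [in RHS](mulrC (_ ^+ j)).
rewrite (eq_J _ (G := fun v : Om => (1 * \det (\matrix_(i, j) f i j (v (s, i.+1))))%:E)); last first.
  by move=> v; rewrite detE.
rewrite (@J_det R _ n (fun i => (s, i.+1)) f (\matrix_(i < n, j < n)
    (gint e c (jpol R K j) (hi i.+1) - gint e c (jpol R K j) (lo i.+1)))) ?mul1r//.
- by move=> i j [] /val_inj.
- by move=> i j; exact: measurable_jpol.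
- move=> i j y; rewrite /f; case: (boolP (_ < _ < _)) => [/andP[ly yh]|_]; last by rewrite mul0r.
  rewrite mul1r mulr_ge0 ?powR_ge0// jpol_ge0// powR_le1 ?(ltW c0)//.
  have /lohi[l0 _ h1] : (1 <= i.+1 <= n)%N by rewrite /= ltn_ord.
  by rewrite (le_trans l0 (ltW ly)) (le_trans (ltW yh) h1).
- move=> i j; rewrite mxE.
  have /lohi[l0 lh h1] : (1 <= i.+1 <= n)%N by rewrite /= ltn_ord.
  by apply: integral_gint => // u; exact: jpol_ge0.
- by move=> v; rewrite -detE rowint_ge0.
Qed.

End row.

End row_integrals.

(** * Closed forms of the one-slice integrals, by position of the end points *)

Section one_step_integrals.
Context (R : realType).
Local Notation Om := (coord_space R (nat * nat)%type).

(** Right multiplication by an upper bidiagonal matrix. It combines each column with its left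
    neighbour, as required by [gint_jpol]. *)
Lemma det_bidiag n (G : nat -> nat -> R) (d u : nat -> R) :
  \det (\matrix_(i < n, j < n)
     (d j * G i j + (if (j : nat) is l.+1 then u l * G i l else 0))) =
  \det (\matrix_(i < n, j < n) G i j) * \prod_(j < n) d j.
Proof.
pose T : 'M[R]_n := \matrix_(k, j)
  (if k == j then d j else if k.+1 == j :> nat then u k else 0).
have -> : \matrix_(i < n, j < n)
     (d j * G i j + (if (j : nat) is l.+1 then u l * G i l else 0)) =
    (\matrix_(i < n, j < n) G i j) *m T.
  apply/matrixP => i j; rewrite !mxE (bigD1 j)//= !mxE eqxx mulrC.
  congr (_ + _); case: j => -[|l] jn /=.
    by rewrite big1// => k kj; rewrite !mxE (negbTE kj)/= mulr0.
  have ln : (l < n)%N by exact: ltnW.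
  rewrite (bigD1 (Ordinal ln))/=; last by rewrite -val_eqE/= neq_ltn ltnSn.
  rewrite !mxE -val_eqE/= eqxx (ltn_eqF (ltnSn l)) mulrC big1 ?addr0// => k.
  move=> /andP[/negbTE kj]; rewrite -val_eqE/= => /negbTE kl.
  by rewrite !mxE kj eqSS kl mulr0.
rewrite det_mulmx; congr (_ * _); rewrite -det_tr det_trig; last first.
  apply/is_trig_mxP => i j ij; rewrite !mxE.
  by rewrite -val_eqE/= (gtn_eqF ij) (gtn_eqF (leqW ij)).
by apply: eq_bigr => j _; rewrite !mxE eqxx.
Qed.

Lemma det_scale_col n (G : nat -> nat -> R) (d : nat -> R) :
  \det (\matrix_(i < n, j < n) (G i j * d j)) =
  \det (\matrix_(i < n, j < n) G i j) * \prod_(j < n) d j.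
Proof.
rewrite -(det_bidiag n G d (fun=> 0)); congr (\det _).
by apply/matrixP => i j; rewrite !mxE mulrC; case: (j : nat) => [|l];
  rewrite ?mul0r addr0.
Qed.

(** Subtracting consecutive rows of the Vandermonde matrix of size n + 1 turns its column of ones
    into (1, 0, ..., 0); expansion along it leaves the increments. *)
Lemma det_power_increments c n (a : nat -> R) :
  \det (\matrix_(i < n, j < n)
     ((a i.+2 `^ c) ^+ j.+1 - (a i.+1 `^ c) ^+ j.+1)) = Vc c n.+1 a.
Proof.
(* The extra zero row makes the first increment equal to the first row itself. *)
pose F i j : R := if i is i'.+1 then (a i'.+1 `^ c) ^+ j else 0.
rewrite -det_powers -(@det_telescope _ n.+1 F)//.
rewrite (expand_det_col _ ord0) (bigD1 ord0)//= big1 ?addr0; last first.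
  move=> i i0; rewrite !mxE/=; case: i i0 => -[|i] ni // _ /=.
  by rewrite !expr0 subrr mul0r.
rewrite !mxE/= expr0 subr0 mul1r /cofactor/= expr0 mul1r.
by congr (\det _); apply/matrixP => i j; rewrite !mxE.
Qed.

Section increments.
Context (e c : R) (e0 : 0 < e) (c0 : 0 < c).

Let ec0 (k : nat) : 0 < e + c * k%:R.
Proof. by rewrite ltr_pwDl// mulr_ge0// ltW. Qed.

Lemma gint_jpol0 j x : 0 <= x ->
  gint e c (jpol R 0 j) x = x `^ e * (x `^ c) ^+ j * (e + c * j%:R)^-1.
Proof.
by move=> x0; rewrite /jpol expr0 mulr1 gintXn.
Qed.

(** As many variables as points, with 0 as the only added end point. For K = 0 the antiderivatives
    are monomials, and the one at 0 vanishes, so telescoping returns a scaled Vandermonde matrix. *)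
Lemma J_rowint_left n : exists2 k, k != 0 &
  forall s (a : nat -> R) (w : Om), a 0%N = 0 -> a n <= 1 ->
    (forall i j, (i < j)%N -> (j <= n)%N -> a i < a j) ->
  J (rowix s n) (fun w => (rowint s n (fun i => a i.-1) a e c 0 w)%:E) w =
  (k * ((\prod_(1 <= i < n.+1) a i `^ e) * Vc c n a))%:E.
Proof.
exists (\prod_(j < n) (e + c * j%:R)^-1).
  by apply/prodf_neq0 => j _; rewrite invr_eq0 gt_eqF.
move=> s a w a0 an alt.
have ale i j : (i <= j)%N -> (j <= n)%N -> a i <= a j.
  by rewrite leq_eqVlt => /predU1P[->//|ij] jn; exact/ltW/alt.
rewrite J_rowint//; first last.
- by move=> i j i1 ij jn; apply: ale; lia.
- move=> i /andP[i1 ilen]; split; [rewrite -a0; apply: ale; lia| |].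
    by apply: ale; lia.
  exact: le_trans (ale _ _ ilen (leqnn n)) an.
congr (_%:E).
pose F i j := gint e c (jpol R 0 j) (a i).
transitivity (\det (\matrix_(i < n, j < n) (F i.+1 j - F i j))) => //.
rewrite det_telescope; last by move=> j; rewrite /F a0 gint0.
rewrite [RHS]mulrC -(@det_scaled_powers _ c n a (fun i => a i `^ e)
  (fun j => (e + c * j%:R)^-1)); congr (\det _).
apply/matrixP => i j; rewrite !mxE /F gint_jpol0//.
by rewrite -a0; apply: ale; rewrite ?ltn_ord.
Qed.

(** One variable more than points, with both 0 and 1 as added end points. Telescoping uses the
    vanishing at 0; the column operations use the vanishing at 1 and thereby remove one row and one
    column. *)
Lemma J_rowint_both m K : exists2 k, k != 0 &
  forall s (a : nat -> R) (w : Om), a 0%N = 0 -> a m.+1 = 1 ->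
    (forall i j, (i < j)%N -> (j <= m.+1)%N -> a i < a j) ->
  J (rowix s m.+1)
    (fun w => (rowint s m.+1 (fun i => a i.-1) a e c K w)%:E) w =
  (k * ((\prod_(1 <= i < m.+1) (a i `^ e * (1 - a i `^ c) ^+ K.+1))
        * Vc c m a))%:E.
Proof.
(* Together with [u] below, these are the coefficients of [gint_jpol]; column 0 has no left
   neighbour and is kept. *)
pose d j : R := if j is l.+1 then - (e + c * l%:R + c * K.+1%:R) else 1.
have d0 j : d j != 0.
  case: j => [|l]; first exact: oner_neq0.
  by rewrite /d oppr_eq0 gt_eqF// addr_gt0// mulr_gt0.
have D0 : \prod_(j < m.+1) d j != 0 by apply/prodf_neq0.
exists (gint e c (jpol R K 0) 1 * (-1) ^+ m / \prod_(j < m.+1) d j).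
  apply: mulf_neq0; last by rewrite invr_eq0.
  apply: mulf_neq0; last by rewrite signr_eq0.
  by apply: lt0r_neq0; exact: gint_jpol1_gt0.
move=> s a w a0 am alt.
have ale i j : (i <= j)%N -> (j <= m.+1)%N -> a i <= a j.
  by rewrite leq_eqVlt => /predU1P[->//|ij] jn; exact/ltW/alt.
rewrite J_rowint//; first last.
- by move=> i j i1 ij jn; apply: ale; lia.
- move=> i /andP[i1 ilen]; split; [rewrite -a0; apply: ale; lia| |].
    by apply: ale; lia.
  by rewrite -am ale.
congr (_%:E).
pose F i j := gint e c (jpol R K j) (a i).
transitivity (\det (\matrix_(i < m.+1, j < m.+1) (F i.+1 j - F i j))) => //.
rewrite det_telescope; last by move=> j; rewrite /F a0 gint0.
pose u l := e + c * l%:R.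
have := det_bidiag m.+1 (fun i j => F i.+1 j) d u.
set H := (X in \det X = _) => HE.
rewrite -[LHS](mulfK D0) -HE.
(* The last row is evaluated at 1, where every combined column vanishes; only the beta value in
   column 0 survives, and its cofactor has sign (-1)^m. *)
rewrite (expand_det_row _ ord_max) (bigD1 ord0)//= big1 ?addr0; last first.
  move=> j j0; case: j j0 => -[|l] lm // _; rewrite !mxE /F /d/= am addrC mulNr.
  by rewrite gint_jpol// powR1 subrr expr0n/= !mulr0 mul0r.
rewrite !mxE /F/= am mul1r addr0 -[LHS]mulrA -[RHS]mulrA -[RHS]mulrA; congr (_ * _).
rewrite mulrC [RHS]mulrCA; congr (_ * _).
rewrite /cofactor/= addn0; congr (_ * _).
have := @det_scaled_powers R c m a (fun i => a i `^ e * (1 - a i `^ c) ^+ K.+1) (fun=> 1).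
rewrite [\prod_(j < m) _]big1// mulr1 => <-; congr (\det _).
apply/matrixP => i j; rewrite !mxE /= /bump/= leqNgt ltn_ord/= ?add0n mulr1.
by rewrite /F addrC mulNr gint_jpol//; ring.
Qed.

End increments.

Section equal_exponents.
Context (c : R) (c0 : 0 < c).

(** One variable fewer than points. With e = c and K = 0, column j integrates to a multiple of
    (x^c)^(j + 1), which is exactly the increment matrix of a Vandermonde determinant one size
    larger. *)
Lemma J_rowint_inner n : exists2 k, k != 0 &
  forall s (a : nat -> R) (w : Om),
    (forall i, (1 <= i <= n.+1)%N -> 0 <= a i <= 1) ->
    (forall i j, (1 <= i)%N -> (i < j)%N -> (j <= n.+1)%N -> a i < a j) ->
  J (rowix s n) (fun w => (rowint s n a (fun i => a i.+1) c c 0 w)%:E) w =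
  (k * Vc c n.+1 a)%:E.
Proof.
have cc0 (j : nat) : 0 < c + c * j%:R by rewrite ltr_pwDl// mulr_ge0// ltW.
exists (\prod_(j < n) (c + c * j%:R)^-1).
  by apply/prodf_neq0 => j _; rewrite invr_eq0 gt_eqF.
move=> s a w a01 alt.
have ale i j : (1 <= i)%N -> (i <= j)%N -> (j <= n.+1)%N -> a i <= a j.
  by move=> i1; rewrite leq_eqVlt => /predU1P[->//|ij] jn; exact/ltW/alt.
rewrite J_rowint//; first last.
- by move=> i j i1 ij jn; apply: ale; lia.
- move=> i /andP[i1 ilen]; split.
  + by have /andP[] : 0 <= a i <= 1 by apply: a01; lia.
  + by apply: ale; lia.
  + by have /andP[] : 0 <= a i.+1 <= 1 by apply: a01; lia.
congr (_%:E); rewrite [RHS]mulrC -det_power_increments.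
rewrite -(det_scale_col n (fun i j => (a i.+2 `^ c) ^+ j.+1 - (a i.+1 `^ c) ^+ j.+1)
  (fun j => (c + c * j%:R)^-1)); congr (\det _).
apply/matrixP => i j; rewrite !mxE.
have nn k : (1 <= k <= n.+1)%N -> 0 <= a k by move=> /a01/andP[].
have := ltn_ord i => iln.
rewrite !gint_jpol0//; first by rewrite !exprS mulrBl.
all: by apply: nn; lia.
Qed.

(** For e = c the integrand is a constant multiple of the derivative of (1 - x^c)^(K + 1), so column
    0 too has a closed form. *)
Lemma gint_jpol_base K x : 0 <= x ->
  c * K.+1%:R * gint c c (jpol R K 0) x = 1 - (1 - x `^ c) ^+ K.+1.
Proof.
move=> x0; elim: K => [|K IH].
  rewrite gint_jpol0// !expr0 mulr1 mulr0 addr0 mulr1 mulrCA mulfV ?gt_eqF//.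
  by rewrite expr1; ring.
have E := gint_jpol c0 c0 K 0 x.
have EK : gint c c (jpol R K.+1 0) x =
    gint c c (jpol R K 0) x - gint c c (jpol R K 1) x.
  rewrite -[X in X - _]mul1r -mulN1r -gint_lin; congr (gint _ _ _ _).
  by rewrite /jpol exprS scale1r scaleN1r expr1; ring.
rewrite EK mulrBr.
rewrite mulr0 addr0 expr0 mul1r in E.
have -> : c * K.+2%:R * gint c c (jpol R K 1) x =
    c * gint c c (jpol R K 0) x - x `^ c * (1 - x `^ c) ^+ K.+1.
  by rewrite -E; ring.
have -> : c * K.+2%:R * gint c c (jpol R K 0) x =
    c * K.+1%:R * gint c c (jpol R K 0) x + c * gint c c (jpol R K 0) x by ring.
by rewrite IH [in RHS]exprS; ring.
Qed.

(** As many variables as points, with 1 as the only added end point. There is no row vanishing at 0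
    to start the telescoping; it is run backwards from 1, after column operations that make the
    entries vanish there. *)
Lemma J_rowint_right n K : exists2 k, k != 0 &
  forall s (a : nat -> R) (w : Om), a n.+1 = 1 ->
    (forall i, (1 <= i <= n.+1)%N -> 0 <= a i) ->
    (forall i j, (1 <= i)%N -> (i < j)%N -> (j <= n.+1)%N -> a i < a j) ->
  J (rowix s n) (fun w => (rowint s n a (fun i => a i.+1) c c K w)%:E) w =
  (k * ((\prod_(1 <= i < n.+1) (1 - a i `^ c) ^+ K.+1) * Vc c n a))%:E.
Proof.
(* The coefficients of [gint_jpol] at e = c; for j = 0 the value agrees with [gint_jpol_base]. *)
pose d (j : nat) : R := - (c * (j + K.+1)%:R).
have d0 j : d j != 0 by rewrite oppr_eq0 gt_eqF// mulr_gt0// ltr0n addnS.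
have D0 : \prod_(j < n) d j != 0 by apply/prodf_neq0.
exists ((-1) ^+ n / \prod_(j < n) d j).
  by rewrite mulf_neq0 ?invr_eq0// signr_eq0.
move=> s a w an a0 alt.
have ale i j : (1 <= i)%N -> (i <= j)%N -> (j <= n.+1)%N -> a i <= a j.
  by move=> i1; rewrite leq_eqVlt => /predU1P[->//|ij] jn; exact/ltW/alt.
rewrite J_rowint//; first last.
- by move=> i j i1 ij jn; apply: ale; lia.
- move=> i /andP[i1 ilen]; split.
  + by apply: a0; lia.
  + by apply: ale; lia.
  + by rewrite -an; apply: ale; lia.
congr (_%:E).
pose F i j := gint c c (jpol R K j) (a i.+1).
transitivity (\det (\matrix_(i < n, j < n) (F i.+1 j - F i j))) => //.
pose u (l : nat) := c * l.+1%:R.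
have := det_bidiag n (fun i j => F i.+1 j - F i j) d u.
pose Psi i j : R := (a i.+1 `^ c) ^+ j * (1 - a i.+1 `^ c) ^+ K.+1.
(* Column 0 equals [Psi] only up to the constant 1, which cancels in the differences of consecutive
   rows. *)
have FPsi i j : (i <= n)%N -> d j * F i j + (if j is l.+1 then u l * F i l else 0) =
    Psi i j - (j == 0%N)%:R.
  move=> ilen; rewrite /F /Psi /d /u; case: j => [|l]/=.
    rewrite add0n addr0 mulNr gint_jpol_base ?expr0; first by ring.
    by apply: a0; lia.
  rewrite subr0 [X in _ = X * _]exprS -[RHS]mulrA -(gint_jpol c0 c0 K l (a i.+1)).
  by rewrite addSn -addnS natrD; ring.
set H := (X in \det X = _) => HE.
rewrite -[LHS](mulfK D0) -HE.
have -> : H = \matrix_(i < n, j < n) (Psi i.+1 j - Psi i j).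
  apply/matrixP => i j; rewrite !mxE.
  have := FPsi i.+1 j (ltn_ord i); have := FPsi i j (ltnW (ltn_ord i)).
  case: (j : nat) => [|l] E1 E2.
    by rewrite addr0 mulrBr; move: E1 E2; rewrite !addr0 => -> ->; ring.
  have -> : Psi i.+1 l.+1 = Psi i.+1 l.+1 - (l.+1 == 0%N)%:R by rewrite subr0.
  have -> : Psi i l.+1 = Psi i l.+1 - (l.+1 == 0%N)%:R by rewrite subr0.
  by rewrite -E1 -E2; ring.
rewrite det_telescope_rev; last by move=> j; rewrite /Psi an powR1 subrr expr0n mulr0.
rewrite [RHS]mulrAC; congr (_ / _); congr (_ * _).
have := @det_scaled_powers R c n a (fun i => (1 - a i `^ c) ^+ K.+1) (fun=> 1).
rewrite [\prod_(j < n) _]big1// mulr1 => <-; congr (\det _).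
by apply/matrixP => i j; rewrite !mxE /Psi mulr1 mulrC.
Qed.

End equal_exponents.

End one_step_integrals.

(** * Probability measures given by a density *)

Section density_probability.
Local Open Scope ereal_scope.
Context d (T : measurableType d) (R : realType).
Context (mu : {measure set T -> \bar R}) (g : T -> R).
Context (mg : measurable_fun setT g) (g0 : forall x, (0 <= g x)%R).
Context (g1 : \int[mu]_x (g x)%:E = 1).

(** The proofs are arguments so that the measure and probability instances below can be attached to
    the term itself. *)
Definition density_prob of measurable_fun setT g & (forall x, (0 <= g x)%R) &
    \int[mu]_x (g x)%:E = 1 : set T -> \bar R :=
  fun A => \int[mu]_(x in A) (g x)%:E.

Local Notation nu := (density_prob mg g0 g1).

Let nu0 : nu set0 = 0.
Proof. by rewrite /density_prob integral_set0. Qed.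

Let nu_ge0 A : 0 <= nu A.
Proof. by apply: integral_ge0 => x _; rewrite lee_fin. Qed.

Let nu_sigma_additive : semi_sigma_additive nu.
Proof.
move=> /= F mF tF mUF; rewrite /density_prob; apply: cvg_toP.
  apply: ereal_nondecreasing_is_cvgn => m n mn.
  apply: lee_sum_nneg_natr => // k _ _.
  by apply: integral_ge0 => /= x Fkx; rewrite lee_fin.
rewrite ge0_integral_bigcup//=.
- by apply: measurable_funTS; apply: measurableT_comp.
- by move=> x _; rewrite lee_fin.
Qed.

HB.instance Definition _ := isMeasure.Build _ _ _ nu
  nu0 nu_ge0 nu_sigma_additive.

Let nu_setT : nu [set: _] = 1%:E.
Proof. by rewrite /density_prob g1. Qed.

HB.instance Definition _ := @Measure_isProbability.Build _ _ R nu nu_setT.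

Let integral_density_indic E : measurable E ->
  \int[nu]_x (\1_E x)%:E = \int[mu]_x ((\1_E x)%:E * (g x)%:E).
Proof.
move=> mE; rewrite integral_indic//= /density_prob setIT [LHS]integral_mkcond/=.
apply: eq_integral => x _; rewrite patchE indicE.
by case: ifPn => _; rewrite ?mul1e ?mul0e.
Qed.

Import HBNNSimple.

Let integral_density_nnsfun (f : {nnsfun T >-> R}) :
  \int[nu]_x (f x)%:E = \int[mu]_x ((f x)%:E * (g x)%:E).
Proof.
under [LHS]eq_integral do rewrite fimfunE -fsumEFin//.
rewrite [LHS]ge0_integral_fsum//; last 2 first.
  - by move=> r; exact/measurable_EFinP/measurableT_comp.
  - by move=> n x _; rewrite EFinM nnfun_muleindic_ge0.
under [RHS]eq_integral.
  move=> x _; rewrite fimfunE -fsumEFin// ge0_mule_fsuml; last first.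
    by move=> r; rewrite EFinM nnfun_muleindic_ge0.
  over.
rewrite [RHS]ge0_integral_fsum//; last 2 first.
  - move=> r; apply: emeasurable_funM; last exact/measurable_EFinP.
    by apply/measurable_EFinP/measurableT_comp.
  - by move=> n x _; rewrite mule_ge0 ?lee_fin// -lee_fin EFinM nnfun_muleindic_ge0.
apply: eq_fsbigr => r _.
have mfr : measurable (f @^-1` [set r]) by exact: measurable_funPTI.
have [r0|r0] := ltP r 0%R.
  have -> : f @^-1` [set r] = set0.
    by apply: preimage_nnfun0.
  rewrite [LHS]integral0_eq; last by move=> x _; rewrite indic0 mulr0.
  by rewrite integral0_eq// => x _; rewrite indic0 mulr0 mul0e.
transitivity (\int[nu]_x (r%:E * (\1_(f @^-1` [set r]) x)%:E)).
  by apply: eq_integral => x _; rewrite EFinM.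
rewrite ge0_integralZl//; first last.
- exact/measurable_EFinP/measurable_indic.
rewrite integral_density_indic//.
transitivity (\int[mu]_x (r%:E * ((\1_(f @^-1` [set r]) x)%:E * (g x)%:E))).
  rewrite ge0_integralZl//.
    by apply: emeasurable_funM; exact/measurable_EFinP.
  by move=> x _; rewrite mule_ge0// lee_fin.
by apply: eq_integral => x _; rewrite EFinM muleA.
Qed.

Lemma ge0_integral_density (f : T -> \bar R) :
  measurable_fun setT f -> (forall x, 0 <= f x) ->
  \int[nu]_x f x = \int[mu]_x (f x * (g x)%:E).
Proof.
move=> mf f0; pose f_ := nnsfun_approx measurableT mf.
transitivity (lim (\int[nu]_x (f_ n x)%:E @[n --> \oo])).
  rewrite -monotone_convergence//=.
  - apply: eq_integral => ? /[!inE] xD; apply/esym/cvg_lim => //=.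
    exact: cvg_nnsfun_approx.
  - by move=> n; exact/measurable_EFinP/measurable_funTS.
  - by move=> n ? _; rewrite lee_fin.
  - by move=> ? _ ? ? mn; rewrite lee_fin; exact/lefP/nd_nnsfun_approx.
under eq_fun do rewrite integral_density_nnsfun.
rewrite -monotone_convergence//=.
- apply: eq_integral => x _; apply/cvg_lim => //.
  apply: cvgeZr => //.
  exact: cvg_nnsfun_approx.
- move=> n; apply: emeasurable_funM; last exact/measurable_EFinP.
  by exact/measurable_EFinP/measurable_funTS.
- by move=> n x _; rewrite mule_ge0// lee_fin.
- move=> x _ m n mn; rewrite lee_wpmul2r ?lee_fin//.
  exact/lefP/nd_nnsfun_approx.
Qed.

End density_probability.

(** * Functions that factor through a countable set *)

Section countable_valued.
Context d (T : measurableType d) (R : realType).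

Lemma measurable_countable_factor (C : countType) (c : T -> C) (f : C -> R) :
  (forall a, measurable [set x | c x = a]) ->
  measurable_fun setT (fun x => f (c x)).
Proof.
move=> mc _ B mB; rewrite setTI.
pose A n := if @pickle_inv C n is Some a then
  (if `[< B (f a) >] then [set x | c x = a] else set0) else set0.
rewrite (_ : _ @^-1` _ = \bigcup_n A n); last first.
  apply/seteqP; split => [x /= Bx|x [n _]].
    by exists (pickle (c x)) => //; rewrite /A pickleK_inv asboolT.
  rewrite /A; case: pickle_inv => // a.
  by case: ifPn => // /asboolP Ba /= cxa; rewrite cxa.
apply: bigcupT_measurable => n; rewrite /A; case: pickle_inv => // a.
by case: ifP.
Qed.

(** Splits an integral along the fibres of [c]. With [c] the discretisation, it converts integrals
    over the cube into sums over integer arrays. *)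
Lemma integral_countable_valued (mu : {measure set T -> \bar R})
    (C : countType) (c : T -> C) (f : C -> R) (g : T -> R) :
  (forall a, measurable [set x | c x = a]) -> (forall a, 0 <= f a) ->
  measurable_fun setT g -> (forall x, 0 <= g x) ->
  (\int[mu]_x (f (c x) * g x)%:E =
   \esum_(a in [set: C]) ((f a)%:E * \int[mu]_x ((c x == a)%:R * g x)%:E))%E.
Proof.
move=> mc f0 mg g0.
pose u n x : \bar R := if @pickle_inv C n is Some a then
  ((f a)%:E * ((c x == a)%:R * g x)%:E)%E else 0%E.
have mceq a : measurable_fun setT (fun x => (c x == a)%:R : R).
  exact: (@measurable_countable_factor C c (fun b => (b == a)%:R) mc).
have mca a : measurable_fun setT (fun x => ((c x == a)%:R * g x)%:E).
  by apply/measurable_EFinP/measurable_funM.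
have ca0 a x : (0 <= ((c x == a)%:R * g x)%:E)%E by rewrite lee_fin mulr_ge0.
have u0 n x : (0 <= u n x)%E.
  by rewrite /u; case: pickle_inv => // a; rewrite mule_ge0// lee_fin.
have mu_ n : measurable_fun setT (u n).
  rewrite /u; case: pickle_inv => [a|]; last exact: measurable_cst.
  exact: measurable_funeM.
transitivity (\int[mu]_x (\sum_(n <oo) u n x))%E.
  apply: eq_integral => x _; rewrite nneseries_esumT//.
  (* At a given x the only nonzero term of the series is the code of [c x]. *)
  have -> : (\esum_(n in [set: nat]) u n x)%E =
      (\esum_(n in [set pickle (c x)]) u n x)%E.
    rewrite [RHS]esum_mkcond; apply: eq_esum => n _.
    case: ifPn => //; rewrite notin_setE/= => nc; rewrite /u.
    case E : pickle_inv => [a|] //; case: eqP => [ca|_]; last by rewrite mul0r mule0.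
    by exfalso; apply: nc; rewrite ca; have := @pickle_invK C n; rewrite E.
  rewrite esum_set1// /u pickleK_inv eqxx mul1r EFinM//.
rewrite integral_nneseries// nneseries_esumT; last by move=> n; exact: integral_ge0.
have -> : (\esum_(n in [set: nat]) \int[mu]_x u n x)%E =
    (\esum_(n in (@pickle C) @` setT) \int[mu]_x u n x)%E.
  rewrite [RHS]esum_mkcond; apply: eq_esum => n _.
  case: ifPn => //; rewrite notin_setE/= => nc.
  apply: integral0_eq => x _; rewrite /u; case E : pickle_inv => [a|] //.
  by exfalso; apply: nc; exists a => //; have := @pickle_invK C n; rewrite E.
rewrite esum_image; last by move=> a b _ _; exact: (pcan_inj pickleK).
apply: eq_esum => a _; rewrite -ge0_integralZl//; last by rewrite lee_fin.
by apply: eq_integral => x _; rewrite /u pickleK_inv.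
Qed.

Lemma measurable_truncn_eq (h : T -> R) n : measurable_fun setT h ->
  measurable [set x | Num.truncn (h x) = n].
Proof.
move=> mh.
have mle m : measurable [set x | (Num.truncn (h x) <= m)%N].
  have := @measurable_fun_ltr _ _ R setT h (cst m.+1%:R) mh (measurable_cst _).
  move=> /(_ measurableT [set true] I); rewrite setTI; congr (measurable _).
  by apply/seteqP; split => x /=; rewrite truncn_le_nat.
case: n => [|n].
  have := mle 0%N; congr (measurable _).
  apply/seteqP; split => x /=; first by rewrite leqn0 => /eqP.
  by move=> ->.
rewrite (_ : [set x | _] = [set x | (Num.truncn (h x) <= n.+1)%N] `\`
    [set x | (Num.truncn (h x) <= n)%N]); first exact: measurableD.
apply/seteqP; split => x /= => [->|[h1 /negP h2]]; last lia.
by rewrite leqnn ltnn.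
Qed.

Lemma measurable_floor_eq (h : T -> R) z : measurable_fun setT h ->
  measurable [set x | Num.floor (h x) = z].
Proof.
move=> mh.
have := @measurable_and _ _ setT (fun x => z%:~R <= h x) (fun x => h x < (z + 1)%:~R).
move=> /(_ (measurable_fun_ler (measurable_cst _) mh)
           (measurable_fun_ltr mh (measurable_cst _))).
move=> /(_ measurableT [set true] I); rewrite setTI; congr (measurable _).
apply/seteqP; split => x /= => [/floor_def//|<-].
by rewrite floor_itv.
Qed.

(** Rounding every coordinate down to a multiple of 1 / (n + 1) makes the composite countably
    valued, hence measurable; continuity of [f] recovers it as a pointwise limit. *)
Lemma measurable_continuous_coords (I : finType) (X : I -> T -> R)
    (f : (I -> R) -> R) :
  (forall k, measurable_fun setT (X k)) ->
  (forall x (e : R), 0 < e -> exists d : R, 0 < d /\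
     forall y, (forall k, `|x k - y k| < d) -> `|f x - f y| < e) ->
  measurable_fun setT (fun w => f (fun k => X k w)).
Proof.
move=> mX fc.
pose c n w : {ffun I -> int} := [ffun k => Num.floor (n.+1%:R * X k w)].
pose g n (z : {ffun I -> int}) : R := f (fun k => (z k)%:~R / n.+1%:R).
apply: (@measurable_fun_cvg _ _ _ setT (fun n w => g n (c n w))).
  move=> n; apply: measurable_countable_factor => z.
  rewrite (_ : [set _ | _] = \bigcap_(k in [set: I])
      [set w | Num.floor (n.+1%:R * X k w) = z k]).
    apply: fin_bigcap_measurable => // k _; apply: measurable_floor_eq.
    exact: measurable_funM.
  apply/seteqP; split => [w /= <- k _|w /= h]; first by rewrite /= ffunE.
  by apply/ffunP => k; rewrite ffunE; exact: h.
move=> w _; apply/cvgrPdist_lt => e e0.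
have [dl [d0 fd]] := fc (fun k => X k w) e e0.
near=> n; apply: fd => k; rewrite ffunE.
have n0 : 0 < n.+1%:R :> R by [].
have /andP[h1 h2] := floor_itv (n.+1%:R * X k w).
have nd : n.+1%:R^-1 < dl by near: n; exact: near_infty_natSinv_lt (PosNum d0).
apply: le_lt_trans nd; rewrite ger0_norm.
  rewrite lerBlDr -[X in X + _]mul1r -mulrDl ler_pdivlMr// [leLHS]mulrC addrC.
  by move: h2; rewrite intrD => /ltW.
by rewrite subr_ge0 ler_pdivrMr// [leRHS]mulrC.
Unshelve. all: by end_near. Qed.

End countable_valued.

(** * Slices of the limit array: lengths, ordering, interlacing and weights *)

Section slices.
Context (R : realType) (alpha eta theta : R) (M N : nat).
Context (halpha : 0 <= alpha) (heta : 0 < eta) (htheta : 0 < theta).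
Context (hM : (1 <= M)%N) (hMN : (M <= N)%N).
Local Notation Om := (coord_space R (nat * nat)%type).
Local Notation S := (M + N - 1)%N.

(* The slice [t] is indexed by [s = t + M - 1], so that [s] runs from [0] to
   [S - 1] and the diagonal slice is [s = M.-1]; then [ell s] is the paper's
   [L_t]. *)
Definition ell s : nat := minn (minn s.+1 M) (S - s).

Definition beta : R := alpha + (eta + theta) / 2.

Definition gam s : R :=
  if (s < M.-1)%N then eta else if s == M.-1 then beta else theta.

Lemma beta_gt0 : 0 < beta.
Proof. by rewrite /beta ltr_wpDl// divr_gt0// addr_gt0. Qed.

Lemma gam_gt0 s : 0 < gam s.
Proof. by rewrite /gam; case: ifP => // _; case: ifP => // _; exact: beta_gt0. Qed.

Definition chamber s (w : Om) : bool :=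
  all (fun i => 0 < w (s, i) < 1) (iota 1 (ell s)) &&
  all (fun i => w (s, i) < w (s, i.+1)) (iota 1 (ell s).-1).

Definition interlace s (w : Om) : bool :=
  if (s < M.-1)%N then
    all (fun i => w (s.+1, i) < w (s, i) < w (s.+1, i.+1)) (iota 1 (ell s))
  else
    all (fun i => w (s, i) < w (s.+1, i) <
                  (if i.+1 == (ell s).+1 then 1 else w (s, i.+1)))
        (iota 1 (ell s.+1)).

Lemma chamberP s w : reflect
  ((forall i, (1 <= i <= ell s)%N -> 0 < w (s, i) < 1) /\
   (forall i, (1 <= i)%N -> (i < ell s)%N -> w (s, i) < w (s, i.+1)))
  (chamber s w).
Proof.
apply: (iffP andP) => -[h1 h2]; split.
- by move=> i hi; apply: (allP h1); rewrite mem_iota; lia.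
- by move=> i i1 il; apply: (allP h2); rewrite mem_iota; lia.
- by apply/allP => i; rewrite mem_iota => hi; apply: h1; lia.
- by apply/allP => i; rewrite mem_iota => hi; apply: h2; lia.
Qed.

Lemma chamber_lt s w i j : chamber s w ->
  (1 <= i)%N -> (i < j)%N -> (j <= ell s)%N -> w (s, i) < w (s, j).
Proof.
move=> /chamberP[_ lt1] i1; elim: j => // j IH; rewrite ltnS leq_eqVlt.
move=> /predU1P[<-|ij] jl; first exact: lt1.
by apply: lt_trans (IH ij (ltnW jl)) _; apply: lt1; lia.
Qed.

Lemma interlace_growP s w : (s < M.-1)%N -> reflect
  (forall i, (1 <= i <= ell s)%N -> w (s.+1, i) < w (s, i) < w (s.+1, i.+1))
  (interlace s w).
Proof.
move=> sM; rewrite /interlace sM; apply: (iffP allP) => h i.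
  by move=> hi; apply: h; rewrite mem_iota; lia.
by rewrite mem_iota => hi; apply: h; lia.
Qed.

Lemma interlace_shrinkP s w : (M.-1 <= s)%N -> reflect
  (forall i, (1 <= i <= ell s.+1)%N -> w (s, i) < w (s.+1, i) <
      (if i.+1 == (ell s).+1 then 1 else w (s, i.+1)))
  (interlace s w).
Proof.
move=> sM; rewrite /interlace ltnNge sM/=; apply: (iffP allP) => h i.
  by move=> hi; apply: h; rewrite mem_iota; lia.
by rewrite mem_iota => hi; apply: h; lia.
Qed.

Definition gw s (w : Om) : R :=
  \prod_(1 <= i < (ell s).+1) w (s, i) `^ (gam s - 1).

(* The condition linking slices [s] and [s.+1] is charged to slice [s] when
   integrating from the left end and to slice [s.+1] when integrating from the
   right end. *)
Definition hL s (w : Om) : R :=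
  (chamber s w && interlace s w)%:R * gw s w.
Definition hR s (w : Om) : R :=
  (chamber s.+1 w && interlace s w)%:R * gw s.+1 w.
Definition FL s (w : Om) : R := \prod_(0 <= r < s) hL r w.
Definition FR s n (w : Om) : R := \prod_(s <= r < s + n) hR r w.

Fixpoint leftix s : seq (nat * nat) :=
  if s is s'.+1 then rowix s' (ell s') ++ leftix s' else [::].
Fixpoint rightix n s : seq (nat * nat) :=
  if n is n'.+1 then rowix s.+1 (ell s.+1) ++ rightix n' s.+1 else [::].

Lemma mem_leftix s k : (k \in leftix s) = (k.1 < s)%N && (0 < k.2 <= ell k.1)%N.
Proof.
elim: s => //= s IH; rewrite mem_cat mem_rowix IH ltnS (leq_eqVlt k.1 s).
by case: (eqVneq k.1 s) => [->|_] //=; rewrite ltnn/= orbF.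
Qed.

Lemma leftix_lt s k : k \in leftix s -> (k.1 < s)%N.
Proof. by rewrite mem_leftix => /andP[]. Qed.

Lemma rightix_gt n s k : k \in rightix n s -> (s < k.1)%N.
Proof.
elim: n s => //= n IH s; rewrite mem_cat mem_rowix => /orP[/andP[/eqP -> _]//|].
by move=> /IH; exact: ltnW.
Qed.

Lemma uniq_leftix s : uniq (leftix s).
Proof.
elim: s => //= s IH; rewrite cat_uniq uniq_rowix IH andbT/=.
apply/hasPn => k /leftix_lt ks; apply/negP; rewrite /= mem_rowix => /andP[/eqP kE _].
by rewrite kE ltnn in ks.
Qed.

Lemma perm_leftix n s :
  perm_eq (leftix (s.+1 + n)) (rowix s (ell s) ++ leftix s ++ rightix n s).
Proof.
elim: n s => [|n IH] s; first by rewrite addn0 /= cats0.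
rewrite -addSnnS (perm_trans (IH s.+1))//= -catA.
rewrite perm_catCA perm_cat2l.
by rewrite perm_catCA.
Qed.

Lemma measurable_all d (T : measurableType d) (A : Type) (r : seq A)
    (b : A -> T -> bool) : (forall a, measurable_fun setT (b a)) ->
  measurable_fun setT (fun x => all (b^~ x) r).
Proof.
move=> mb; elim: r => [|a r IH] /=; first exact: measurable_cst.
exact: measurable_and.
Qed.

Lemma measurable_natr_bool d (T : measurableType d) (b : T -> bool) :
  measurable_fun setT b -> measurable_fun setT (fun x => (b x)%:R : R).
Proof.
move=> mb.
rewrite (_ : (fun x => _) = (fun x => if b x then 1 else 0 : R)); last first.
  by apply/funext => x; case: (b x).
exact: measurable_fun_ifT.
Qed.

Lemma measurable_chamber s : measurable_fun setT (chamber s).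
Proof.
apply: measurable_and; apply: measurable_all => i.
  by apply: measurable_and; apply: measurable_fun_ltr => //; exact: measurable_coord.
by apply: measurable_fun_ltr; exact: measurable_coord.
Qed.

Lemma measurable_interlace s : measurable_fun setT (interlace s).
Proof.
rewrite /interlace; case: (s < M.-1)%N; apply: measurable_all => i;
  apply: measurable_and; apply: measurable_fun_ltr; try exact: measurable_coord.
by case: (i.+1 == (ell s).+1); [exact: measurable_cst|exact: measurable_coord].
Qed.

Lemma measurable_gw s : measurable_fun setT (gw s).
Proof.
apply: measurable_prod => i _.
by apply: measurableT_comp (measurable_powR _) _; exact: measurable_coord.
Qed.

Lemma gw_ge0 s w : 0 <= gw s w.
Proof. by rewrite prodr_ge0// => i _; exact: powR_ge0. Qed.

Lemma hL_ge0 s w : 0 <= hL s w. Proof. by rewrite mulr_ge0// gw_ge0. Qed.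
Lemma hR_ge0 s w : 0 <= hR s w. Proof. by rewrite mulr_ge0// gw_ge0. Qed.
Lemma FL_ge0 s w : 0 <= FL s w.
Proof. by rewrite prodr_ge0// => r _; exact: hL_ge0. Qed.
Lemma FR_ge0 s n w : 0 <= FR s n w.
Proof. by rewrite prodr_ge0// => r _; exact: hR_ge0. Qed.

Lemma measurable_hL s : measurable_fun setT (hL s).
Proof.
apply: measurable_funM; last exact: measurable_gw.
apply: measurable_natr_bool; apply: measurable_and.
  exact: measurable_chamber.
exact: measurable_interlace.
Qed.

Lemma measurable_hR s : measurable_fun setT (hR s).
Proof.
apply: measurable_funM; last exact: measurable_gw.
apply: measurable_natr_bool; apply: measurable_and.
  exact: measurable_chamber.
exact: measurable_interlace.
Qed.

Lemma measurable_FL s : measurable_fun setT (FL s).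
Proof. by apply: measurable_prod => r _; exact: measurable_hL. Qed.

Lemma measurable_FR s n : measurable_fun setT (FR s n).
Proof. by apply: measurable_prod => r _; exact: measurable_hR. Qed.

Definition agree (P : nat -> bool) (v w : Om) :=
  forall k : nat * nat, P k.1 -> v k = w k.

Lemma eq_chamber s v w : agree (pred1 s) v w -> chamber s v = chamber s w.
Proof.
move=> vw; congr (_ && _); apply: eq_all => i; rewrite !vw//= eqxx.
Qed.

Lemma eq_interlace s v w : agree (pred2 s s.+1) v w ->
  interlace s v = interlace s w.
Proof.
move=> vw; rewrite /interlace; case: ifP => _; apply: eq_all => i;
  by rewrite !vw//= ?eqxx ?orbT.
Qed.

Lemma eq_gw s v w : agree (pred1 s) v w -> gw s v = gw s w.
Proof. by move=> vw; apply: eq_bigr => i _; rewrite !vw//= eqxx. Qed.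

Lemma eq_hL s v w : agree (pred2 s s.+1) v w -> hL s v = hL s w.
Proof.
move=> vw; have vw' : agree (pred1 s) v w by move=> k /= /eqP ks; apply: vw; rewrite /= ks eqxx.
by rewrite /hL (eq_chamber vw') (eq_interlace vw) (eq_gw vw').
Qed.

Lemma eq_hR s v w : agree (pred2 s s.+1) v w -> hR s v = hR s w.
Proof.
move=> vw; have vw' : agree (pred1 s.+1) v w.
  by move=> k /= /eqP ks; apply: vw; rewrite /= ks eqxx orbT.
by rewrite /hR (eq_chamber vw') (eq_interlace vw) (eq_gw vw').
Qed.

(** * Integrating out all slices on one side of a given slice *)

Definition Lf s : Om -> \bar R := J (leftix s) (fun w => (FL s w)%:E).
Definition Rf n s : Om -> \bar R := J (rightix n s) (fun w => (FR s n w)%:E).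

(** [hL s] involves only slices s and s + 1, which are frozen while the slices before s are
    integrated, so it leaves the inner integral. *)
Lemma LfS s w :
  Lf s.+1 w = J (rowix s (ell s)) (fun w => (hL s w)%:E * Lf s w)%E w.
Proof.
rewrite /Lf /= J_cat; apply: J_local => v _.
rewrite (eq_J _ (G := fun v => (hL s v)%:E * (FL s v)%:E)%E); last first.
  by move=> u; rewrite -EFinM /FL big_nat_recr//= mulrC.
rewrite J_mulconst//.
- by apply/measurable_EFinP; exact: measurable_FL.
- by move=> u; rewrite lee_fin FL_ge0.
- by move=> u; exact: hL_ge0.
- move=> u uv; apply: eq_hL => k ks; apply: uv; apply/negP => /leftix_lt.
  by case/orP: ks => /eqP ->; rewrite ?ltnn// ltnNge leqnSn.
Qed.

Lemma RfS n s w :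
  Rf n.+1 s w =
  J (rowix s.+1 (ell s.+1)) (fun w => (hR s w)%:E * Rf n s.+1 w)%E w.
Proof.
rewrite /Rf /= J_cat; apply: J_local => v _.
rewrite (eq_J _ (G := fun v => (hR s v)%:E * (FR s.+1 n v)%:E)%E); last first.
  by move=> u; rewrite -EFinM /FR addnS big_nat_recl ?leq_addr//= big_add1.
rewrite J_mulconst//.
- by apply/measurable_EFinP; exact: measurable_FR.
- by move=> u; rewrite lee_fin FR_ge0.
- by move=> u; exact: hR_ge0.
- move=> u uv; apply: eq_hR => k ks; apply: uv; apply/negP => /rightix_gt.
  by case/orP: ks => /eqP ->; rewrite ?ltnn// ltnNge leqnSn.
Qed.

Lemma prod_natr_all n (b : nat -> bool) (f : nat -> R) :
  \prod_(1 <= i < n.+1) ((b i)%:R * f i) =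
  (all b (iota 1 n))%:R * \prod_(1 <= i < n.+1) f i.
Proof.
rewrite big_split/=; congr (_ * _).
rewrite /index_iota subn1/=; elim: (iota 1 n) => [|i r IH]; first by rewrite big_nil.
by rewrite big_cons IH/=; case: (b i); rewrite ?mul1r ?mul0r.
Qed.

(** The weight of a slice and the result already integrated up to it merge by adding exponents; this
    is valid because the nonnegative lower end points make the variables positive on the support. *)
Lemma rowintE s n (lo hi : nat -> R) (g e1 e c : R) K (b : bool) (v : Om) :
  b = all (fun i => lo i < v (s, i) < hi i) (iota 1 n) ->
  (forall i, (1 <= i <= n)%N -> 0 <= lo i) -> g + e1 = e ->
  b%:R * (\prod_(1 <= i < n.+1) v (s, i) `^ (g - 1)) *
    ((\prod_(1 <= i < n.+1) (v (s, i) `^ e1 * (1 - v (s, i) `^ c) ^+ K))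
     * Vc c n (fun i => v (s, i))) =
  rowint s n lo hi e c K v.
Proof.
move=> bE lo0 <-; rewrite /rowint prod_natr_all -bE.
case: b bE => bE; last by rewrite !mul0r.
rewrite !mul1r mulrA -big_split/=; congr (_ * _).
rewrite !big_nat; apply: eq_bigr => i hi1.
have : i \in iota 1 n by rewrite mem_iota; lia.
move=> /(allP (esym bE)) /= /andP[lv _].
have v0 : 0 < v (s, i) := le_lt_trans (lo0 _ hi1) lv.
rewrite mulrA -powRD; last by rewrite (gt_eqF v0) implybT.
by congr (_ `^ _ * _); ring.
Qed.

(** * Shape and exponents of the one-sided integrals *)

Definition Agen (e c : R) (K s : nat) (w : Om) : R :=
  (\prod_(1 <= i < (ell s).+1) (w (s, i) `^ e * (1 - w (s, i) `^ c) ^+ K)) *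
  Vc c (ell s) (fun i => w (s, i)).

Lemma measurable_Agen e c K s : measurable_fun setT (Agen e c K s).
Proof.
apply: measurable_funM; last exact: measurable_Vc.
apply: measurable_prod => i _; apply: measurable_funM.
  by apply: measurableT_comp (measurable_powR _) _; exact: measurable_coord.
apply: measurable_funX; apply: measurable_funB => //.
by apply: measurableT_comp (measurable_powR _) _; exact: measurable_coord.
Qed.

Lemma Agen_gt0 e c K s w : 0 < c -> chamber s w -> 0 < Agen e c K s w.
Proof.
move=> c0 cw; have [w01 _] := chamberP _ _ cw.
rewrite mulr_gt0//.
  rewrite big_nat prodr_gt0// => i /w01 /andP[wi0 wi1].
  rewrite mulr_gt0 ?powR_gt0// exprn_gt0// subr_gt0.
  have : w (s, i) `^ c < 1 `^ c by apply: gt0_ltr_powR; rewrite ?nnegrE// ltW.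
  by rewrite powR1.
apply: Vc_gt0 => // [i /w01/andP[]//|i j i1 ij jl].
exact: chamber_lt cw i1 ij jl.
Qed.

(* The sign of [k] is forced by [A' w > 0] and the positivity of [J]. *)
Lemma J_step row (h : Om -> R) (F : Om -> \bar R) (A A' : Om -> R)
    (ch : Om -> bool) (c k : R) w :
  measurable_fun setT h -> (forall v, 0 <= h v) -> measurable_fun setT A ->
  (forall v, ~~ ch v -> h v = 0) -> (forall v, ch v -> 0 < A v) ->
  (forall v, ch v -> F v = (c * A v)%:E) -> 0 < c -> 0 < A' w ->
  J row (fun v => (h v * A v)%:E) w = (k * A' w)%:E ->
  J row (fun v => (h v)%:E * F v)%E w = (c * `|k| * A' w)%:E.
Proof.
move=> mh h0 mA hch A0 FA c0 A'0 JE.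
have hA0 v : (0 <= (h v * A v)%:E)%E.
  rewrite lee_fin; case: (boolP (ch v)) => cv; last by rewrite hch// mul0r.
  by rewrite mulr_ge0// ltW// A0.
have k0 : 0 <= k.
  have : (0 <= (k * A' w)%:E)%E by rewrite -JE; exact: J_ge0.
  by rewrite lee_fin pmulr_lge0.
rewrite (eq_J _ (G := fun v => c%:E * (h v * A v)%:E)%E); last first.
  move=> v; case: (boolP (ch v)) => cv; last by rewrite hch// mul0r mul0e mule0.
  by rewrite FA// -!EFinM; congr (_%:E); ring.
rewrite JZ ?(ltW c0)//.
  by rewrite JE -EFinM ger0_norm// mulrA.
by apply/measurable_EFinP; exact: measurable_funM.
Qed.

(** Up to the diagonal s = M - 1 only a Vandermonde product is produced. Afterwards each step adds
    the rate of the slice just integrated, beginning with the diagonal one, and each loss of an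
    entry adds one factor 1 - x^eta; the length lost since the diagonal is M - [ell s]. *)
Definition eL s : R := if (s < M)%N then 0 else beta + (s - M)%:R * theta.
Definition kL s : nat := if (s < M)%N then 0 else (M - ell s)%N.
Definition AL s : Om -> R := Agen (eL s) eta (kL s) s.

(** Mirror image. From the right, factors 1 - x^theta appear as soon as the length has reached M and
    stays constant, N - M of them up to the diagonal; left of the diagonal each step loses an entry
    and adds one more. *)
Definition eR s : R :=
  if (M.-1 <= s)%N then 0 else beta + (M - 2 - s)%:R * eta.
Definition kR s : nat :=
  if (M.-1 <= s)%N then (S - s - ell s)%N else (N - ell s)%N.
Definition AR s : Om -> R := Agen (eR s) theta (kR s) s.

Lemma Agen00 c s w : Agen 0 c 0 s w = Vc c (ell s) (fun i => w (s, i)).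
Proof.
rewrite /Agen big1 ?mul1r// => i _.
by rewrite powRr0 expr0 mulr1.
Qed.

(* The fixed slice seen as the sequence of end points of the intervals in which
   the variables of the next slice range, with 0 and 1 as extreme points. *)
Definition pts s (w : Om) (i : nat) : R :=
  if i == 0%N then 0 else if i == (ell s).+1 then 1 else w (s, i).

Lemma pts0 s w : pts s w 0 = 0. Proof. by []. Qed.
Lemma ptsS s w : pts s w (ell s).+1 = 1. Proof. by rewrite /pts/= eqxx. Qed.
Lemma ptsE s w i : (1 <= i <= ell s)%N -> pts s w i = w (s, i).
Proof. by move=> hi; rewrite /pts; case: eqP => [|_]; [lia|]; case: eqP => //; lia. Qed.

Lemma pts_lt s w i j : chamber s w ->
  (i < j)%N -> (j <= (ell s).+1)%N -> pts s w i < pts s w j.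
Proof.
move=> cw ij jl; have [w01 _] := chamberP _ _ cw.
have [->|i0] := eqVneq i 0%N.
  have [->|jn] := eqVneq j (ell s).+1; first by rewrite pts0 ptsS.
  rewrite pts0 ptsE; last by lia.
  by have /andP[] : 0 < w (s, j) < 1 by apply: w01; lia.
rewrite [X in X < _]ptsE; last by lia.
have [->|jn] := eqVneq j (ell s).+1.
  by rewrite ptsS; have /andP[] : 0 < w (s, i) < 1 by apply: w01; lia.
by rewrite ptsE; [apply: (chamber_lt cw)|]; lia.
Qed.

Lemma eq_pts s v w i : agree (pred1 s) v w -> pts s v i = pts s w i.
Proof. by move=> vw; rewrite /pts vw//= eqxx. Qed.

Lemma pts_ge0 s w i : chamber s w -> (i <= (ell s).+1)%N -> 0 <= pts s w i.
Proof.
move=> cw; case: i => [|i] il //.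
by apply/ltW; rewrite -{1}(pts0 s w); exact: pts_lt.
Qed.

Lemma pts_le1 s w i : chamber s w -> (i <= (ell s).+1)%N -> pts s w i <= 1.
Proof.
move=> cw; rewrite leq_eqVlt => /predU1P[->|il]; first by rewrite ptsS.
by apply/ltW; rewrite -(ptsS s w); apply: pts_lt.
Qed.

(** With slice f frozen and ordered, interlacing confines each entry of r to its own interval
    between consecutive points of 0, f, 1. The ordering of r is then automatic, so the domain is a
    box. *)
Lemma box_outer r f v : (ell f <= ell r)%N -> (ell r <= (ell f).+1)%N ->
  chamber f v ->
  (chamber r v /\ (forall i, (1 <= i <= ell f)%N ->
     v (r, i) < v (f, i) < (if i.+1 == (ell r).+1 then 1 else v (r, i.+1)))) <->
  (forall i, (1 <= i <= ell r)%N -> pts f v i.-1 < v (r, i) < pts f v i).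
Proof.
move=> fr rf cf; have [f01 _] := chamberP _ _ cf; split.
  move=> [cr inter] i hi; have [r01 _] := chamberP _ _ cr.
  apply/andP; split.
    have [iE|i1] := eqVneq i 1%N.
      by rewrite {}iE pts0 in hi *; have /andP[] : 0 < v (r, 1%N) < 1 by apply: r01; lia.
    have /inter/andP[_] : (1 <= i.-1 <= ell f)%N by lia.
    by rewrite ptsE ?prednK; [case: eqP => // ?| |]; lia.
  have [iE|il] := eqVneq i (ell f).+1.
    by rewrite {}iE ptsS in hi *; have /andP[] : 0 < v (r, (ell f).+1) < 1 by apply: r01; lia.
  have hi' : (1 <= i <= ell f)%N by lia.
  by rewrite ptsE//; have /andP[] := inter _ hi'.
move=> box; split.
  apply/chamberP; split => [i hi|i i1 il].
    have /andP[lo hi'] := box _ hi; apply/andP; split.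
      by apply: le_lt_trans lo; apply: pts_ge0 => //; lia.
    by apply: lt_le_trans hi' _; apply: pts_le1 => //; lia.
  have /box/andP[_ h1] : (1 <= i <= ell r)%N by lia.
  have /box/andP[h2 _] : (1 <= i.+1 <= ell r)%N by lia.
  exact: lt_trans h1 h2.
move=> i hi; apply/andP; split.
  have /box/andP[_] : (1 <= i <= ell r)%N by lia.
  by rewrite ptsE.
have [E|ne] := eqVneq i.+1 (ell r).+1; first by have /andP[] := f01 _ hi.
have /box/andP[] : (1 <= i.+1 <= ell r)%N by lia.
by rewrite ptsE.
Qed.

(** The same mechanism when the intervals of r start at the first entry of f instead of at 0. *)
Lemma box_inner r f v : (ell r <= ell f)%N -> (ell f <= (ell r).+1)%N ->
  chamber f v ->
  (forall i, (1 <= i <= ell r)%N -> pts f v i < v (r, i) < pts f v i.+1) ->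
  chamber r v.
Proof.
move=> rf fr cf box; apply/chamberP; split => [i hi|i i1 il].
  have /andP[lo hi'] := box _ hi; apply/andP; split.
    by apply: le_lt_trans lo; apply: pts_ge0 => //; lia.
  by apply: lt_le_trans hi' _; apply: pts_le1 => //; lia.
have /box/andP[_ h1] : (1 <= i <= ell r)%N by lia.
have /box/andP[h2 _] : (1 <= i.+1 <= ell r)%N by lia.
exact: lt_trans h1 h2.
Qed.

Lemma all_iotaP n (b : nat -> bool) :
  reflect (forall i, (1 <= i <= n)%N -> b i) (all b (iota 1 n)).
Proof.
apply: (iffP allP) => h i; first by move=> hi; apply: h; rewrite mem_iota; lia.
by rewrite mem_iota => hi; apply: h; lia.
Qed.

Lemma left_box_grow s v : (s < M.-1)%N -> chamber s.+1 v ->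
  chamber s v && interlace s v =
  all (fun i => pts s.+1 v i < v (s, i) < pts s.+1 v i.+1) (iota 1 (ell s)).
Proof.
move=> sM cf; have E : ell s.+1 = (ell s).+1 by rewrite /ell; lia.
have pE i : (1 <= i <= ell s)%N ->
    (pts s.+1 v i < v (s, i) < pts s.+1 v i.+1) =
    (v (s.+1, i) < v (s, i) < v (s.+1, i.+1)).
  by move=> hi; rewrite !ptsE//; lia.
apply/idP/idP.
  move=> /andP[_ /(interlace_growP _ sM) h]; apply/all_iotaP => i hi.
  by rewrite pE// h.
move=> /all_iotaP box; apply/andP; split.
  by apply: (box_inner _ _ cf box); rewrite E.
by apply/(interlace_growP _ sM) => i hi; rewrite -pE// box.
Qed.

Lemma left_box_shrink s v : (M.-1 <= s)%N -> (s.+1 < S)%N -> chamber s.+1 v ->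
  chamber s v && interlace s v =
  all (fun i => pts s.+1 v i.-1 < v (s, i) < pts s.+1 v i) (iota 1 (ell s)).
Proof.
move=> sM sS cf.
have [E1 E2] : (ell s.+1 <= ell s)%N /\ (ell s <= (ell s.+1).+1)%N.
  by rewrite /ell; lia.
have := box_outer E1 E2 cf => bx; apply/idP/idP.
  by move=> /andP[cs /(interlace_shrinkP _ sM) h]; apply/all_iotaP/bx.
move=> /all_iotaP/bx[cs h]; rewrite cs/=.
exact/(interlace_shrinkP _ sM).
Qed.

Lemma right_box_grow s v : (s < M.-1)%N -> chamber s v ->
  chamber s.+1 v && interlace s v =
  all (fun i => pts s v i.-1 < v (s.+1, i) < pts s v i) (iota 1 (ell s.+1)).
Proof.
move=> sM cf; have E : ell s.+1 = (ell s).+1 by rewrite /ell; lia.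
have [E1 E2] : (ell s <= ell s.+1)%N /\ (ell s.+1 <= (ell s).+1)%N.
  by rewrite E.
have ext i : (1 <= i <= ell s)%N ->
    (if i.+1 == (ell s.+1).+1 then 1 else v (s.+1, i.+1)) = v (s.+1, i.+1).
  by move=> hi; case: eqP => //; lia.
have := box_outer E1 E2 cf => bx; apply/idP/idP.
  move=> /andP[cs /(interlace_growP _ sM) h]; apply/all_iotaP/bx; split => // i hi.
  by rewrite ext// h.
move=> /all_iotaP/bx[cs h]; rewrite cs/=.
by apply/(interlace_growP _ sM) => i hi; rewrite -[X in _ < _ < X]ext// h.
Qed.

Lemma right_box_shrink s v : (M.-1 <= s)%N -> (s.+1 < S)%N -> chamber s v ->
  chamber s.+1 v && interlace s v =
  all (fun i => pts s v i < v (s.+1, i) < pts s v i.+1) (iota 1 (ell s.+1)).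
Proof.
move=> sM sS cf.
have [E1 E2] : (ell s.+1 <= ell s)%N /\ (ell s <= (ell s.+1).+1)%N.
  by rewrite /ell; lia.
have pE i : (1 <= i <= ell s.+1)%N ->
    (pts s v i < v (s.+1, i) < pts s v i.+1) =
    (v (s, i) < v (s.+1, i) < (if i.+1 == (ell s).+1 then 1 else v (s, i.+1))).
  by move=> hi; rewrite (@ptsE s v i)//; lia.
apply/idP/idP.
  move=> /andP[_ /(interlace_shrinkP _ sM) h]; apply/all_iotaP => i hi.
  by rewrite pE// h.
move=> /all_iotaP box; apply/andP; split.
  exact: (box_inner E1 E2 cf box).
by apply/(interlace_shrinkP _ sM) => i hi; rewrite -pE// box.
Qed.

(** * One integration step from the left and from the right *)

Lemma hL_AL s lo hi e v :
  chamber s v && interlace s v =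
    all (fun i => lo i < v (s, i) < hi i) (iota 1 (ell s)) ->
  (forall i, (1 <= i <= ell s)%N -> 0 <= lo i) -> gam s + eL s = e ->
  hL s v * AL s v = rowint s (ell s) lo hi e eta (kL s) v.
Proof. by move=> bE lo0 eE; rewrite /hL /AL /Agen /gw; exact: rowintE. Qed.

Lemma hR_AR s lo hi e v :
  chamber s.+1 v && interlace s v =
    all (fun i => lo i < v (s.+1, i) < hi i) (iota 1 (ell s.+1)) ->
  (forall i, (1 <= i <= ell s.+1)%N -> 0 <= lo i) -> gam s.+1 + eR s.+1 = e ->
  hR s v * AR s.+1 v = rowint s.+1 (ell s.+1) lo hi e theta (kR s.+1) v.
Proof. by move=> bE lo0 eE; rewrite /hR /AR /Agen /gw; exact: rowintE. Qed.

Lemma agree_off_row s r v (w : Om) : s != r ->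
  (forall k, k \notin rowix s (ell s) -> v k = w k) -> agree (pred1 r) v w.
Proof.
move=> sr vw k /= /eqP kr; apply: vw; rewrite mem_rowix kr.
by rewrite eq_sym (negbTE sr).
Qed.

Lemma eq_prodVc s (w : Om) (a : nat -> R) (f : R -> R) c :
  (forall i, (1 <= i <= ell s)%N -> a i = w (s, i)) ->
  (\prod_(1 <= i < (ell s).+1) f (a i)) * Vc c (ell s) a =
  (\prod_(1 <= i < (ell s).+1) f (w (s, i))) * Vc c (ell s) (fun i => w (s, i)).
Proof.
move=> aw; congr (_ * _); last exact: eq_Vc.
by rewrite !big_nat; apply: eq_bigr => i hi; rewrite aw.
Qed.

(** Compared with the next slice, slice s has one entry fewer before the diagonal, and as many or
    one more from the diagonal on. These cases are [J_rowint_inner], [J_rowint_left] and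
    [J_rowint_both]. *)
Lemma left_step s : (s.+1 < S)%N -> exists2 k, k != 0 &
  forall w, chamber s.+1 w ->
    J (rowix s (ell s)) (fun v => (hL s v * AL s v)%:E) w = (k * AL s.+1 w)%:E.
Proof.
move=> sS; have sne : s != s.+1 by rewrite neq_ltn ltnSn.
have [sM|sM] := ltnP s M.-1.
  have E : ell s.+1 = (ell s).+1 by rewrite /ell; lia.
  have eL0 r : (r < M)%N -> eL r = 0 by rewrite /eL => ->.
  have kL0 r : (r < M)%N -> kL r = 0%N by rewrite /kL => ->.
  have [k k0 Jk] := J_rowint_inner heta (ell s); exists k => // w cw.
  rewrite [AL s.+1 w]/AL (eL0 s.+1) ?(kL0 s.+1); [|lia..]; rewrite Agen00 E.
  rewrite -(@eq_Vc _ _ _ (pts s.+1 w)); last by move=> i hi; rewrite ptsE ?E.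
  rewrite -(Jk s _ w); first last.
  - by move=> i j i1 ij jl; apply: pts_lt; rewrite ?E// leqW.
  - by move=> i hi; rewrite pts_ge0 ?pts_le1// E; lia.
  apply: J_local => v vw; congr (_%:E).
  have vw' := agree_off_row sne vw.
  have pE i : pts s.+1 v i = pts s.+1 w i by exact: eq_pts.
  have cv : chamber s.+1 v by rewrite (eq_chamber vw').
  rewrite (hL_AL (lo := pts s.+1 w) (hi := fun i => pts s.+1 w i.+1) (e := eta)).
  - by rewrite kL0//; lia.
  - by rewrite left_box_grow//; apply: eq_all => i; rewrite !pE.
  - by move=> i hi; apply: pts_ge0 => //; rewrite E; lia.
  - by rewrite eL0 ?addr0 /gam ?sM//; lia.
have eE : gam s + eL s = eL s.+1.
  rewrite /gam /eL [in RHS]ltnNge (_ : (M <= s.+1)%N)/=; last by lia.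
  rewrite ltnNge sM/=; case: (eqVneq s M.-1) => [->|sM'].
    by rewrite ifT ?addr0; [rewrite (_ : (_ - M)%N = 0%N) ?mul0r ?addr0//; lia|lia].
  rewrite ifF; last by lia.
  by rewrite subSn; [rewrite -natr1; ring|lia].
have e0 : 0 < eL s.+1.
  rewrite /eL ltnNge (_ : (M <= s.+1)%N)/=; last by lia.
  by rewrite ltr_pwDl ?beta_gt0// mulr_ge0// ltW.
have [E|E] := eqVneq (ell s) (ell s.+1).
  (* From the diagonal on, two consecutive lengths are equal only while they are both M. *)
  have kk : kL s = 0%N /\ kL s.+1 = 0%N.
    by rewrite /kL; split; case: ltnP => // h; move: E; rewrite /ell; lia.
  have [k k0 Jk] := J_rowint_left e0 heta (ell s); exists k => // w cw.
  rewrite [AL s.+1 w]/AL /Agen (proj2 kk).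
  rewrite -(@eq_prodVc s.+1 w (pts s.+1 w) (fun x => x `^ eL s.+1 * (1 - x `^ eta) ^+ 0)); last first.
    by move=> i hi; rewrite ptsE.
  under eq_bigr do rewrite expr0 mulr1.
  rewrite -E -(Jk s _ w); first last.
  - by move=> i j ij jl; apply: pts_lt => //; rewrite -E leqW.
  - by apply: pts_le1 => //; rewrite -E leqW.
  - exact: pts0.
  apply: J_local => v vw; congr (_%:E).
  have vw' := agree_off_row sne vw.
  have pE i : pts s.+1 v i = pts s.+1 w i by exact: eq_pts.
  have cv : chamber s.+1 v by rewrite (eq_chamber vw').
  rewrite (hL_AL (lo := fun i => pts s.+1 w i.-1) (hi := pts s.+1 w) (e := eL s.+1))//.
  - by rewrite (proj1 kk).
  - by rewrite left_box_shrink//; apply: eq_all => i; rewrite !pE.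
  - by move=> i hi; apply: pts_ge0 => //; rewrite -E; lia.
have {}E : ell s = (ell s.+1).+1 by move: E; rewrite /ell; lia.
have kk : kL s.+1 = (kL s).+1.
  by rewrite /kL; case: ltnP; case: ltnP; rewrite /ell in E *; lia.
have [k k0 Jk] := J_rowint_both e0 heta (ell s.+1) (kL s); exists k => // w cw.
rewrite [AL s.+1 w]/AL /Agen kk.
rewrite -(@eq_prodVc s.+1 w (pts s.+1 w) (fun x => x `^ eL s.+1 * (1 - x `^ eta) ^+ (kL s).+1)); last first.
  by move=> i hi; rewrite ptsE.
rewrite -(Jk s _ w); first last.
- by move=> i j ij jl; apply: pts_lt.
- exact: ptsS.
- exact: pts0.
rewrite -E; apply: J_local => v vw; congr (_%:E).
have vw' := agree_off_row sne vw.
have pE i : pts s.+1 v i = pts s.+1 w i by exact: eq_pts.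
have cv : chamber s.+1 v by rewrite (eq_chamber vw').
rewrite (hL_AL (lo := fun i => pts s.+1 w i.-1) (hi := pts s.+1 w) (e := eL s.+1))//.
- by rewrite left_box_shrink//; apply: eq_all => i; rewrite !pE.
- by move=> i hi; apply: pts_ge0 => //; lia.
Qed.

(** Slice s + 1 has one entry more than slice s before the diagonal, and as many or one fewer from
    the diagonal on. These cases are [J_rowint_both], [J_rowint_right] and [J_rowint_inner]. *)
Lemma right_step s : (s.+1 < S)%N -> exists2 k, k != 0 &
  forall w, chamber s w ->
    J (rowix s.+1 (ell s.+1)) (fun v => (hR s v * AR s.+1 v)%:E) w =
    (k * AR s w)%:E.
Proof.
move=> sS; have sne : s.+1 != s by rewrite neq_ltn ltnSn orbT.
have [sM|sM] := ltnP s M.-1.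
  have E : ell s.+1 = (ell s).+1 by rewrite /ell; lia.
  have eE : gam s.+1 + eR s.+1 = eR s.
    rewrite /gam /eR (leqNgt _ s) sM/=.
    have [h|h] := ltnP s.+1 M.-1.
      rewrite (_ : (M - 2 - s)%N = (M - 2 - s.+1).+1); last by lia.
      by rewrite -natr1; ring.
    rewrite ifT; last by lia.
    by rewrite (_ : (M - 2 - s)%N = 0%N) ?mul0r ?addr0//; lia.
  have kk : kR s = (kR s.+1).+1.
    by rewrite /kR (leqNgt _ s) sM/=; case: leqP => h; rewrite E; rewrite /ell in E *; lia.
  have e0 : 0 < eR s.
    by rewrite /eR leqNgt sM/= ltr_pwDl ?beta_gt0// mulr_ge0// ltW.
  have [k k0 Jk] := J_rowint_both e0 htheta (ell s) (kR s.+1); exists k => // w cw.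
  rewrite [AR s w]/AR /Agen kk.
  rewrite -(@eq_prodVc s w (pts s w) (fun x => x `^ eR s * (1 - x `^ theta) ^+ (kR s.+1).+1)); last first.
    by move=> i hi; rewrite ptsE.
  rewrite -(Jk s.+1 _ w); first last.
  - by move=> i j ij jl; apply: pts_lt.
  - exact: ptsS.
  - exact: pts0.
  rewrite -E; apply: J_local => v vw; congr (_%:E).
  have vw' := agree_off_row sne vw.
  have pE i : pts s v i = pts s w i by exact: eq_pts.
  have cv : chamber s v by rewrite (eq_chamber vw').
  rewrite (hR_AR (lo := fun i => pts s w i.-1) (hi := pts s w) (e := eR s))//.
  - by rewrite right_box_grow//; apply: eq_all => i; rewrite !pE.
  - by move=> i hi; apply: pts_ge0 => //; lia.
have eR0 r : (M.-1 <= r)%N -> eR r = 0 by rewrite /eR => ->.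
have kRE r : (M.-1 <= r)%N -> kR r = (S - r - ell r)%N by rewrite /kR => ->.
have eE : gam s.+1 + eR s.+1 = theta.
  by rewrite eR0 ?addr0 /gam; [rewrite !ifF//; lia|lia].
have [E|E] := eqVneq (ell s) (ell s.+1).
  have kk : kR s = (kR s.+1).+1 by rewrite !kRE ?E//; rewrite /ell in E *; lia.
  have [k k0 Jk] := J_rowint_right htheta (ell s) (kR s.+1); exists k => // w cw.
  rewrite [AR s w]/AR /Agen kk eR0//.
  under eq_bigr do rewrite powRr0 mul1r.
  rewrite -(@eq_prodVc s w (pts s w) (fun x => (1 - x `^ theta) ^+ (kR s.+1).+1)); last first.
    by move=> i hi; rewrite ptsE.
  rewrite -(Jk s.+1 _ w); first last.
  - by move=> i j i1 ij jl; apply: pts_lt.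
  - by move=> i hi; apply: pts_ge0 => //; lia.
  - exact: ptsS.
  rewrite -E; apply: J_local => v vw; congr (_%:E).
  have vw' : agree (pred1 s) v w by apply: (agree_off_row sne); rewrite -E.
  have pE i : pts s v i = pts s w i by exact: eq_pts.
  have cv : chamber s v by rewrite (eq_chamber vw').
  rewrite (hR_AR (lo := pts s w) (hi := fun i => pts s w i.+1) (e := theta)) -?E//.
  - by rewrite E right_box_shrink//; apply: eq_all => i; rewrite !pE.
  - by move=> i hi; apply: pts_ge0 => //; lia.
have {}E : ell s = (ell s.+1).+1 by move: E; rewrite /ell; lia.
(* Where the length drops it equals the distance to the right end, so no factor 1 - x^theta has
   appeared yet. *)
have kk : kR s = 0%N /\ kR s.+1 = 0%N.
  by rewrite !kRE//; [rewrite /ell in E *; lia|lia].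
have [k k0 Jk] := J_rowint_inner htheta (ell s.+1); exists k => // w cw.
rewrite [AR s w]/AR eR0// (proj1 kk) Agen00 E.
rewrite -(@eq_Vc _ _ _ (pts s w)); last by move=> i hi; rewrite ptsE ?E.
rewrite -(Jk s.+1 _ w); first last.
- by move=> i j i1 ij jl; apply: pts_lt; rewrite ?E// leqW.
- by move=> i hi; rewrite pts_ge0 ?pts_le1// E; lia.
apply: J_local => v vw; congr (_%:E).
have vw' := agree_off_row sne vw.
have pE i : pts s v i = pts s w i by exact: eq_pts.
have cv : chamber s v by rewrite (eq_chamber vw').
rewrite (hR_AR (lo := pts s w) (hi := fun i => pts s w i.+1) (e := theta)) ?(proj2 kk)//.
- by rewrite right_box_shrink//; apply: eq_all => i; rewrite !pE.
- by move=> i hi; apply: pts_ge0 => //; rewrite E; lia.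
Qed.

Lemma left_formula s : (s < S)%N -> exists2 c, 0 < c &
  forall w, chamber s w -> Lf s w = (c * AL s w)%:E.
Proof.
elim: s => [|s IH] sS.
  exists 1 => // w _; rewrite /Lf /= /FL big_geq// mul1r /AL /eL /kL hM Agen00.
  by rewrite /Vc /ell (_ : minn _ _ = 1%N) ?big_nat1 ?big_geq//; lia.
have [c c0 LfE] := IH (ltnW sS).
have [k k0 JE] := left_step sS.
exists (c * `|k|); first by rewrite mulr_gt0// normr_gt0.
move=> w cw; rewrite LfS.
apply: (@J_step _ _ _ (AL s) _ (chamber s)) => //.
- exact: measurable_hL.
- exact: hL_ge0.
- exact: measurable_Agen.
- by move=> v /negbTE nc; rewrite /hL nc mul0r.
- by move=> v; exact: Agen_gt0.
- exact: Agen_gt0.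
- exact: JE.
Qed.

Lemma right_formula n s : (s + n).+1 = S -> exists2 c, 0 < c &
  forall w, chamber s w -> Rf n s w = (c * AR s w)%:E.
Proof.
elim: n s => [|n IH] s sS.
  exists 1 => // w _; rewrite /Rf /= /FR addn0 big_geq// mul1r.
  have E : ell s = 1%N by rewrite /ell; lia.
  rewrite /AR /eR /kR ifT; last by lia.
  rewrite ifT; last by lia.
  rewrite (_ : (_ - _)%N = 0%N); last by rewrite E; lia.
  by rewrite Agen00 E /Vc big_nat1 big_geq.
have [c c0 RfE] : exists2 c, 0 < c &
    forall w, chamber s.+1 w -> Rf n s.+1 w = (c * AR s.+1 w)%:E.
  by apply: IH; lia.
have [k k0 JE] : exists2 k, k != 0 & forall w, chamber s w ->
    J (rowix s.+1 (ell s.+1)) (fun v => (hR s v * AR s.+1 v)%:E) w =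
    (k * AR s w)%:E by apply: right_step; lia.
exists (c * `|k|); first by rewrite mulr_gt0// normr_gt0.
move=> w cw; rewrite RfS.
apply: (@J_step _ _ _ (AR s.+1) _ (chamber s.+1)) => //.
- exact: measurable_hR.
- exact: hR_ge0.
- exact: measurable_Agen.
- by move=> v /negbTE nc; rewrite /hR nc mul0r.
- by move=> v; exact: Agen_gt0.
- exact: Agen_gt0.
- exact: JE.
Qed.

(** * Weight of the whole array and marginal of one slice *)

Definition hC s (w : Om) : R := (chamber s w)%:R * gw s w.
(** Every link is charged to its left slice here; the last slice, having no right neighbour,
    contributes [hC]. *)
Definition Wt (w : Om) : R := FL S.-1 w * hC S.-1 w.

Lemma hC_ge0 s w : 0 <= hC s w.
Proof. by rewrite mulr_ge0// gw_ge0. Qed.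

Lemma measurable_hC s : measurable_fun setT (hC s).
Proof.
apply: measurable_funM; last exact: measurable_gw.
by apply: measurable_natr_bool; exact: measurable_chamber.
Qed.

Lemma Wt_ge0 w : 0 <= Wt w.
Proof. by rewrite mulr_ge0 ?FL_ge0 ?hC_ge0. Qed.

Lemma measurable_Wt : measurable_fun setT Wt.
Proof. by apply: measurable_funM; [exact: measurable_FL|exact: measurable_hC]. Qed.

(** The splitting slice moves leftwards by [hL s w * hC s.+1 w = hC s w * hR s w], both sides
    carrying the two weights and the one link. *)
Lemma Wt_split n s w : (s + n).+1 = S -> Wt w = FL s w * hC s w * FR s n w.
Proof.
elim: n s => [|n IH] s sS.
  rewrite /FR addn0 big_geq// mulr1 /Wt.
  by have -> : S.-1 = s by lia.
rewrite (IH s.+1); last by rewrite addSnnS.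
have FRE : FR s n.+1 w = hR s w * FR s.+1 n w.
  by rewrite /FR addnS big_nat_recl ?leq_addr//= big_add1.
have FLE : FL s.+1 w = FL s w * hL s w by rewrite /FL big_nat_recr.
rewrite FRE FLE -!mulrA; congr (_ * _); rewrite !mulrA; congr (_ * _).
rewrite /hL /hC /hR; case: (chamber s w); case: (chamber s.+1 w);
 case: (interlace s w); rewrite /= ?mul0r ?mulr0 ?mul0r// !mul1r//.
Qed.

(** * Comparison of [iint01] with integration of one slice *)

Lemma iint01_trunc n (F : (nat -> R) -> \bar R) :
  iint01 n F =
  iint01 n (fun z => F (fun k => if (1 <= k <= n)%N then z k else 0)).
Proof.
elim: n F => [|n IH] F /=.
  by congr F; apply/funext => k; case: ifP.
apply: eq_integral => y _; rewrite IH; congr (iint01 n _).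
apply/funext => z; congr F; apply/funext => k.
by case: (eqVneq k n.+1) => [->|kn]; rewrite ?ltnS ?leqnn//; case: ifP; case: ifP => //; lia.
Qed.

(** The values outside 1, ..., n are kept general because the induction fixes the outermost variable
    in [x]; the origin then matches the default 0 of [iint01]. *)
Lemma iint01_row s n (F : (nat -> R) -> \bar R) (x : Om) :
  measurable_fun setT (fun w : Om => F (fun i => w (s, i))) ->
  (forall z, (0 <= F z)%E) ->
  iint01 n (fun z => F (fun k => if (1 <= k <= n)%N then z k else x (s, k))) =
  J (rowix s n) (fun w => F (fun i => w (s, i))) x.
Proof.
move=> mF F0; elim: n x => [|n IH] x /=.
  by congr F; apply/funext => k; case: ifP => //; lia.
rewrite /J1 integral_unif01; first last.
- by move=> y; apply: J_ge0 => w.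
- by apply: measurable_upd1; apply: measurable_J => // w.
rewrite (_ : [set` _] = `[0%R, 1%R]%classic); last first.
  by apply/seteqP; split => y /=; rewrite inE.
apply: eq_integral => y _; rewrite -IH; congr (iint01 n _).
apply/funext => z; congr F; apply/funext => k; rewrite /upd xpair_eqE eqxx/=.
by case: (eqVneq k n.+1) => [->|kn]; rewrite ?ltnn ?ltnS ?leqnn//=; case: ifP; case: ifP => //; lia.
Qed.

Lemma iint01_J s n (F : (nat -> R) -> \bar R) :
  measurable_fun setT (fun w : Om => F (fun i => w (s, i))) ->
  (forall z, (0 <= F z)%E) ->
  iint01 n F = J (rowix s n) (fun w => F (fun i => w (s, i))) (@origin R _).
Proof. by move=> mF F0; rewrite iint01_trunc -(iint01_row n _ mF F0). Qed.

(** The two sides interact only through slice s. With that slice frozen they integrate independently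
    to multiples of [AR s] and [AL s]. *)
Lemma marginal n s : (s + n).+1 = S -> exists2 c, 0 < c &
  forall (G : Om -> R) x, measurable_fun setT G -> (forall w, 0 <= G w) ->
    (forall v w, agree (pred1 s) v w -> G v = G w) ->
  J (leftix S) (fun w => (Wt w * G w)%:E) x =
  (c%:E * J (rowix s (ell s)) (fun w => (hC s w * AL s w * AR s w * G w)%:E) x)%E.
Proof.
move=> sS; have [cL cL0 LE] : exists2 c, 0 < c &
  forall w, chamber s w -> Lf s w = (c * AL s w)%:E by apply: left_formula; lia.
have [cR cR0 RE] := right_formula sS.
exists (cL * cR); first exact: mulr_gt0.
move=> G x mG G0 Gs.
have nc0 v : ~~ chamber s v -> hC s v = 0 by move=> /negbTE nc; rewrite /hC nc mul0r.
have AL0 v : chamber s v -> 0 < AL s v by exact: Agen_gt0.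
have AR0 v : chamber s v -> 0 < AR s v by exact: Agen_gt0.
have hCAR v : 0 <= hC s v * AR s v.
  case: (boolP (chamber s v)) => cv; last by rewrite nc0// mul0r.
  by rewrite mulr_ge0 ?hC_ge0// ltW// AR0.
have hA0 v : 0 <= hC s v * AL s v * AR s v * G v.
  case: (boolP (chamber s v)) => cv; last by rewrite nc0// !mul0r.
  apply: mulr_ge0 => //; apply: mulr_ge0; last exact/ltW/AR0.
  by apply: mulr_ge0; [exact: hC_ge0|exact/ltW/AL0].
have mAL : measurable_fun setT (AL s) by exact: measurable_Agen.
have mAR : measurable_fun setT (AR s) by exact: measurable_Agen.
have mhC := measurable_hC s.
have mF : measurable_fun setT (fun w => (Wt w * G w)%:E).
  by apply/measurable_EFinP/measurable_funM => //; exact: measurable_Wt.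
have F0 w : (0 <= (Wt w * G w)%:E)%E by rewrite lee_fin mulr_ge0 ?Wt_ge0.
rewrite -{1}sS (perm_J (perm_leftix n s) mF F0) !J_cat.
have mH : measurable_fun setT (fun w => (hC s w * AL s w * AR s w * G w)%:E).
  by apply/measurable_EFinP; do 3 apply: measurable_funM => //.
have H0 w : (0 <= (hC s w * AL s w * AR s w * G w)%:E)%E by rewrite lee_fin.
rewrite -(JZ _ _ mH H0 (ltW (mulr_gt0 cL0 cR0))).
have loc (v w : Om) (r : seq (nat * nat)) : (forall k, k \in r -> k.1 != s) ->
    (forall k, k \notin r -> v k = w k) -> agree (pred1 s) v w.
  by move=> rs vw k /= ks; apply: vw; apply/negP => /rs; rewrite ks.
have locA e c K v w : agree (pred1 s) v w -> Agen e c K s v = Agen e c K s w.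
  move=> vw; congr (_ * _); first by apply: eq_bigr => i _; rewrite !vw//= eqxx.
  by apply: eq_Vc => i _; rewrite !vw//= eqxx.
have lochC v w : agree (pred1 s) v w -> hC s v = hC s w.
  by move=> vw; rewrite /hC (eq_chamber vw) (eq_gw vw).
apply: J_local => u _.
(* All factors but [FR] depend on slices up to s only and leave the integral over the right side. *)
have inner v : J (rightix n s) (fun w => (Wt w * G w)%:E) v =
    ((hC s v * AR s v * (G v * cR))%:E * (FL s v)%:E)%E.
  transitivity (J (rightix n s)
     (fun w => (FL s w * hC s w * G w)%:E * (FR s n w)%:E)%E v).
    by apply: J_local => w _; rewrite -EFinM (Wt_split _ sS); congr (_%:E); ring.
  rewrite (@J_mulconst _ _ _ _ (fun w => FL s w * hC s w * G w)).
  - rewrite -/(Rf n s v); case: (boolP (chamber s v)) => cv.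
      by rewrite RE// -!EFinM; congr (_%:E); ring.
    by rewrite nc0// !(mulr0, mul0r, mul0e).
  - by apply/measurable_EFinP; exact: measurable_FR.
  - by move=> w; rewrite lee_fin FR_ge0.
  - move=> w; apply: mulr_ge0 => //.
    by apply: mulr_ge0; [exact: FL_ge0|exact: hC_ge0].
  - move=> w wv.
    have wv' : agree (pred1 s) w v.
      by apply: (loc _ _ _ _ wv) => k /rightix_gt; rewrite neq_ltn => ->; rewrite orbT.
    rewrite (Gs _ _ wv') (lochC _ _ wv'); congr (_ * _ * _).
    rewrite /FL !big_nat; apply: eq_bigr => r /= rs; apply: eq_hL => k kr.
    apply: wv; apply/negP => /rightix_gt.
    by case/orP: kr => /eqP ->; rewrite ltnNge ?(ltnW rs) ?rs.
rewrite (eq_J _ inner) (@J_mulconst _ _ _ _ (fun v => hC s v * AR s v * (G v * cR))).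
- rewrite -/(Lf s u); case: (boolP (chamber s u)) => cu.
    by rewrite LE// -!EFinM; congr (_%:E); ring.
  by rewrite nc0// !(mulr0, mul0r, mul0e, mule0).
- by apply/measurable_EFinP; exact: measurable_FL.
- by move=> w; rewrite lee_fin FL_ge0.
- by move=> w; apply: mulr_ge0 => //; apply: mulr_ge0 => //; exact: ltW.
- move=> w wu.
  have wu' : agree (pred1 s) w u.
    by apply: (loc _ _ _ _ wu) => k /leftix_lt; rewrite neq_ltn => ->.
  by rewrite (Gs _ _ wu') (lochC _ _ wu') /AR (locA _ _ _ _ _ wu').
Qed.

Lemma ell0 : ell 0 = 1%N. Proof. by rewrite /ell; lia. Qed.

(** Slice 0 has a single entry, so the marginal there reduces the total mass to a one-variable
    integral of beta type, which is finite and positive. *)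
Lemma total_mass : exists2 Z, 0 < Z &
  J (leftix S) (fun w => (Wt w)%:E) (@origin R _) = Z%:E.
Proof.
have sS : (0 + S.-1).+1 = S by lia.
have [c c0 mE] := marginal sS.
have e0 : 0 < gam 0 + eR 0.
  rewrite /eR; case: ifP => _; first by rewrite addr0 gam_gt0.
  by rewrite addr_gt0 ?gam_gt0// ltr_pwDl ?beta_gt0// mulr_ge0// ltW.
have [k k0 Jk] := J_rowint_both e0 htheta 0 (kR 0).
(* The points 0 and 1 alone: [J_rowint_both] with m = 0, all products being empty. *)
pose a (i : nat) : R := (0 < i)%N%:R.
have {}Jk := Jk 0%N a (@origin R _) erefl erefl.
have alt : forall i j, (i < j)%N -> (j <= 1)%N -> a i < a j.
  by move=> [|i] [|[|j]]//= _ _; rewrite /a ltr01.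
have {}Jk := Jk alt; rewrite big_geq// mul1r /Vc big_geq// mulr1 in Jk.
have rE w : hC 0 w * AL 0 w * AR 0 w * 1 =
    rowint 0 1 (fun i => a i.-1) a (gam 0 + eR 0) theta (kR 0) w.
  have -> : AL 0 w = 1.
    by rewrite /AL /eL /kL hM Agen00 ell0 /Vc big_nat1 big_geq.
  rewrite !mulr1 /hC /AR /Agen /gw ell0.
  apply: rowintE => //.
  by rewrite /chamber ell0/= !andbT.
exists (c * k).
  rewrite mulr_gt0// lt_neqAle eq_sym k0/= -lee_fin -Jk.
  apply: J_ge0 => w; rewrite lee_fin rowint_ge0//.
  - by move=> [|[|i]]//= _; split.
  - by move=> i j i1 ij j1; lia.
rewrite EFinM -Jk.
have {mE} := mE (fun=> 1) (@origin R _) (measurable_cst _) (fun=> ler01) (fun _ _ _ => erefl).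
rewrite ell0 (eq_J _ (fun w => congr1 EFin (rE w))) => <-.
by apply: J_local => w _; rewrite mulr1.
Qed.

(** * Identification of the one-slice density *)

Definition sl (t : int) : nat := absz (t + M.-1%:Z)%R.

Lemma t_range_sl t : t_range M N t -> (sl t < S)%N /\ t = (sl t)%:Z - M.-1%:Z.
Proof. by rewrite /t_range /sl => -[h1 h2]; lia. Qed.

Lemma Lt_ell t : t_range M N t -> Lt M N t = ell (sl t).
Proof.
move=> ht; have [h1 h2] := t_range_sl ht.
rewrite /Lt /ell; case: ifP => h; lia.
Qed.

(** [weyl_chamber] bounds only the extreme entries; the bounds on the others follow by monotonicity,
    upwards from the first entry and downwards from the last. *)
Lemma weyl_chamberE s (w : Om) : (0 < ell s)%N ->
  \1_(weyl_chamber (ell s)) (fun i => w (s, i)) = (chamber s w)%:R :> R.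
Proof.
move=> l0; rewrite indicE; congr (_%:R); congr (nat_of_bool _).
apply/idP/idP => [|cw]; rewrite inE /weyl_chamber/=.
  move=> [w0 [wlt w1]].
  have lo i : (1 <= i)%N -> (i <= ell s)%N -> 0 < w (s, i).
    elim: i => // -[|i] IH _ il //.
    by apply: lt_trans (IH _ _) (wlt _ _ _) => //; lia.
  have hi i : (i < ell s)%N -> w (s, (ell s - i)%N) < 1.
    elim: i => [|i IH] il; first by rewrite subn0.
    apply: lt_trans (IH _); last by lia.
    rewrite (_ : (ell s - i = (ell s - i.+1).+1)%N); last by lia.
    by apply: wlt; lia.
  apply/chamberP; split => // i /andP[i1 il]; rewrite lo//=.
  by have := hi (ell s - i)%N; rewrite subKn//; apply; lia.
have [w01 wlt] := chamberP _ _ cw.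
split; first by have /andP[] : 0 < w (s, 1%N) < 1 by apply: w01; lia.
split => //; by have /andP[] : 0 < w (s, ell s) < 1 by apply: w01; lia.
Qed.

Lemma ell_gt0 s : (s < S)%N -> (0 < ell s)%N.
Proof. by rewrite /ell; lia. Qed.

(** The three factors are the weight of the slice itself, the result from the left and the result
    from the right. *)
Lemma wc_split t x : t_range M N t -> 0 < x ->
  wc M N alpha eta theta t x =
  x `^ (gam (sl t) - 1) * (x `^ eL (sl t) * (1 - x `^ eta) ^+ kL (sl t)) *
  (x `^ eR (sl t) * (1 - x `^ theta) ^+ kR (sl t)).
Proof.
move=> ht x0; have [sS tE] := t_range_sl ht.
have pw a b c (d : R) : a + b + c = d -> x `^ a * x `^ b * x `^ c = x `^ d.
  by move=> <-; rewrite -!powRD// (gt_eqF x0) implybT.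
have mm (a b c y z : R) : a * (b * y) * (c * z) = a * b * c * (y * z) by ring.
rewrite mm /wc; move: (sl t) sS tE => s sS tE.
have [t0|t0] := boolP (t <= 0)%R.
  have kE : kL s = 0%N by rewrite /kL ifT//; lia.
  have eE : eL s = 0 by rewrite /eL ifT//; lia.
  rewrite kE eE expr0 mul1r.
  rewrite (pw _ _ _ (alpha + (eta + theta) / 2 + `|t|%:R * eta - 1)).
    by congr (_ * _ ^+ _); rewrite /kR /ell; case: ifP => h; lia.
  rewrite /gam /eR /beta; move: ((eta + theta) / 2) => b2.
  have [h|h] := ltnP s M.-1.
    (* One of the |t| summands eta is the rate of the slice itself; the other |t| - 1 and the
       diagonal rate come from [eR]. *)
    rewrite (_ : `|t|%N = (M - 2 - s).+1%N); last by lia.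
    by rewrite -natr1; ring.
  rewrite ifT; last by lia.
  by rewrite (_ : `|t|%N = 0%N); [ring|lia].
have kRE : kR s = (S - s - ell s)%N by rewrite /kR ifT//; lia.
have kLE : kL s = (M - ell s)%N by rewrite /kL ifF//; lia.
have gE : x `^ (gam s - 1) * x `^ eL s * x `^ eR s =
    x `^ (alpha + (eta + theta) / 2 + `|t|%:R * theta - 1).
  apply: pw; rewrite /gam /eL /eR /beta; move: ((eta + theta) / 2) => b2.
  have -> : (s < M.-1)%N = false by lia.
  have -> : (s == M.-1) = false by lia.
  have -> : (s < M)%N = false by lia.
  have -> : (M.-1 <= s)%N by lia.
  (* Likewise one theta is the rate of the slice itself, and [eL] supplies the rest. *)
  rewrite (_ : `|t|%N = (s - M).+1%N); last by lia.
  by rewrite -natr1; ring.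
rewrite gE; case: ifP => h.
  congr (_ * _); rewrite kLE kRE (_ : (M - ell s)%N = 0%N) ?expr0 ?mul1r; last by rewrite /ell; lia.
  by congr (_ ^+ _); rewrite /ell; lia.
congr (_ * _); rewrite kLE kRE (_ : (S - s - ell s)%N = 0%N) ?expr0 ?mulr1; last by rewrite /ell; lia.
by congr (_ ^+ _); rewrite /ell; lia.
Qed.

Lemma slice_densityE t (w : Om) : t_range M N t ->
  slice_density M N alpha eta theta t (fun i => w (sl t, i)) =
  hC (sl t) w * AL (sl t) w * AR (sl t) w.
Proof.
move=> ht; have [sS tE] := t_range_sl ht.
rewrite /slice_density (Lt_ell ht) weyl_chamberE ?ell_gt0// /hC.
case: (boolP (chamber _ w)) => cw; last by rewrite !mul0r.
rewrite !mul1r; have [w01 _] := chamberP _ _ cw.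
rewrite big_nat (eq_bigr (fun j =>
   (\prod_(1 <= i < j) (w (sl t, j) `^ eta - w (sl t, i) `^ eta)) *
   \prod_(1 <= i < j) (w (sl t, j) `^ theta - w (sl t, i) `^ theta))); last first.
  by move=> j _; rewrite big_split.
rewrite -big_nat big_split/= -/(Vc _ _ _) -/(Vc theta _ _).
rewrite [X in _ * X]big_nat (eq_bigr (fun i =>
   w (sl t, i) `^ (gam (sl t) - 1) *
   (w (sl t, i) `^ eL (sl t) * (1 - w (sl t, i) `^ eta) ^+ kL (sl t)) *
   (w (sl t, i) `^ eR (sl t) * (1 - w (sl t, i) `^ theta) ^+ kR (sl t)))); last first.
  by move=> i /w01/andP[wi0 _]; exact: wc_split.
rewrite -big_nat !big_split/= /AL /AR /Agen /gw !big_split/=; ring.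
Qed.

(** * Cells of the rectangle as positions in slices; volumes as sums over cells *)

Local Notation PP := (PParray M N).
Local Notation cell := ('I_M * 'I_N)%type.

(* Position in the slice picture of the entry in row [p.1 + 1] and column
   [p.2 + 1] of the array. *)
Definition pos (p : cell) : nat * nat :=
  ((p.2 + M.-1 - p.1)%N, (minn p.1 p.2).+1).

Lemma pos_inj : injective pos.
Proof.
move=> [[i hi] [j hj]] [[i' hi'] [j' hj']]; rewrite /pos/= => -[h1 h2].
by congr (_, _); apply: val_inj => /=; lia.
Qed.

Lemma pos_mem p : pos p \in leftix S.
Proof.
by case: p => [[i hi] [j hj]]; rewrite mem_leftix /pos /ell/=; lia.
Qed.

Lemma pos_surj k : k \in leftix S -> exists p, pos p = k.
Proof.
case: k => s k; rewrite mem_leftix /ell/= => h.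
have hi : (k.-1 + (M.-1 - s) < M)%N by lia.
have hj : (k.-1 + (s - M.-1) < N)%N by lia.
by exists (Ordinal hi, Ordinal hj); rewrite /pos/=; congr (_, _); lia.
Qed.

Lemma perm_pos : perm_eq (leftix S) [seq pos p | p <- enum {: cell}].
Proof.
apply: uniq_perm; first exact: uniq_leftix.
  by rewrite map_inj_uniq ?enum_uniq//; exact: pos_inj.
move=> k; apply/idP/mapP => [/pos_surj[p <-]|[p _ ->]]; last exact: pos_mem.
by exists p => //; rewrite mem_enum.
Qed.

(** Out-of-range entries become vanishing sums, so the volumes can be computed by exchanging
    summations, without case distinctions on indices. *)
Lemma pp_entryE (L : PP) i j :
  pp_entry L i j =
  (\sum_(p : cell) ((p.1.+1 == i) && (p.2.+1 == j)) * L p)%N.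
Proof.
rewrite /pp_entry.
case: insubP => [i' _ iE|iM]; last first.
  rewrite big1// => p _; case: eqP => //= pi; exfalso.
  by move/negP: iM; apply; rewrite -pi/=.
case: insubP => [j' _ jE|jN]; last first.
  rewrite big1// => p _; rewrite andbC; case: eqP => //= pj; exfalso.
  by move/negP: jN; apply; rewrite -pj/=.
case: ifPn => [/andP[i0 j0]|ij0]; last first.
  by rewrite big1// => p _; case: eqP => //=; case: eqP => //=; lia.
rewrite (bigD1 (i', j'))//= iE jE !prednK// !eqxx mul1n big1 ?addn0//.
move=> p pij; case: eqP => //= pi; case: eqP => //= pj; exfalso.
move/negP: pij; apply; apply/eqP.
case: p pi pj => a b /= pi pj.
by congr (_, _); apply: val_inj; [rewrite iE -pi|rewrite jE -pj].
Qed.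

Lemma pp_entry_ord (L : PP) (p : cell) : pp_entry L p.1.+1 p.2.+1 = L p.
Proof.
rewrite pp_entryE (bigD1 p)//= !eqxx mul1n big1 ?addn0// => r rp.
case: eqP => //= e1; case: eqP => //= e2; exfalso; move/negP: rp; apply.
by case: r p e1 e2 => a b [a' b'] /= [] e1 [] e2; apply/eqP; congr (_, _); exact: val_inj.
Qed.

Lemma pp_slice_entry (L : PP) s k : (0 < k)%N ->
  pp_slice L (s%:Z - M.-1%:Z) k =
  pp_entry L (k + (M.-1 - s)) (k + (s - M.-1)).
Proof.
move=> k0; rewrite /pp_slice; case: ifP => h.
  by congr (pp_entry L _ _); lia.
by congr (pp_entry L _ _); lia.
Qed.

Lemma pp_slice_pos (L : PP) (p : cell) :
  pp_slice L ((pos p).1%:Z - M.-1%:Z) (pos p).2 = L p.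
Proof.
rewrite pp_slice_entry// -[RHS]pp_entry_ord; case: p => [[i hi] [j hj]] /=.
by congr (pp_entry L _ _); lia.
Qed.

Lemma slice_sizeE (L : PP) (t : int) :
  slice_size L t = (\sum_(p : cell) ((p.2%:Z - p.1%:Z == t)%R * L p))%N.
Proof.
rewrite /slice_size.
transitivity (\sum_(1 <= k < (M + N).+1) \sum_(p : cell)
    (((p.2%:Z - p.1%:Z == t)%R && (k == (minn p.1 p.2).+1)) * L p))%N.
  rewrite !big_nat; apply: eq_bigr => k hk; rewrite /pp_slice; case: ifP => t0;
    rewrite pp_entryE; apply: eq_bigr => p _; congr (_ * _)%N; congr (nat_of_bool _); lia.
rewrite exchange_big/=; apply: eq_bigr => p _.
rewrite -big_distrl/=; congr (_ * _)%N.
case: eqP => //= _; last by rewrite big1.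
rewrite (bigD1_seq (minn p.1 p.2).+1) ?iota_uniq//=; last first.
  by rewrite mem_index_iota; have := ltn_ord p.1; lia.
by rewrite eqxx big1 ?addn0// => k /negbTE ->.
Qed.

Lemma left_volE (L : PP) :
  left_vol L = (\sum_(p : cell) ((p.2 < p.1) * L p))%N.
Proof.
rewrite /left_vol; under eq_bigr do rewrite slice_sizeE.
rewrite exchange_big/=; apply: eq_bigr => p _.
rewrite -big_distrl/=; congr (_ * _)%N; have := ltn_ord p.1.
have [h|h] := ltnP p.2 p.1 => pM.
  rewrite (bigD1_seq (p.1 - p.2)%N) ?iota_uniq//=; last first.
    by rewrite mem_index_iota; lia.
  rewrite big1 ?addn0; first by rewrite (_ : _ == _ = true)//; lia.
  by move=> k kne; rewrite (_ : _ == _ = false)//; lia.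
by rewrite big_nat big1// => k hk; rewrite (_ : _ == _ = false)//; lia.
Qed.

Lemma right_volE (L : PP) :
  right_vol L = (\sum_(p : cell) ((p.1 < p.2) * L p))%N.
Proof.
rewrite /right_vol; under eq_bigr do rewrite slice_sizeE.
rewrite exchange_big/=; apply: eq_bigr => p _.
rewrite -big_distrl/=; congr (_ * _)%N; have := ltn_ord p.2.
have [h|h] := ltnP p.1 p.2 => pM.
  rewrite (bigD1_seq (p.2 - p.1)%N) ?iota_uniq//=; last first.
    by rewrite mem_index_iota; lia.
  rewrite big1 ?addn0; first by rewrite (_ : _ == _ = true)//; lia.
  by move=> k kne; rewrite (_ : _ == _ = false)//; lia.
by rewrite big_nat big1// => k hk; rewrite (_ : _ == _ = false)//; lia.
Qed.

Lemma central_volE (L : PP) :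
  central_vol L = (\sum_(p : cell) ((p.1 == p.2 :> nat) * L p))%N.
Proof.
rewrite /central_vol slice_sizeE; apply: eq_bigr => p _.
by congr (_ * _)%N; congr (nat_of_bool _); lia.
Qed.

(** * Product form of the weight and its geometric discretisation *)

Definition gamp (p : cell) : R := gam (pos p).1.

Lemma gampE p : gamp p =
  eta * (p.2 < p.1)%N%:R + beta * (p.1 == p.2 :> nat)%:R + theta * (p.1 < p.2)%N%:R.
Proof.
rewrite /gamp /gam /pos/=; case: p => [[i hi] [j hj]] /=.
have [h|h|h] := ltngtP j i.
- by rewrite ifT ?mulr0 ?mulr1 ?addr0//; lia.
- by rewrite !ifF ?mulr0 ?mulr1 ?add0r//; lia.
- by rewrite ifF ?ifT ?mulr0 ?mulr1 ?addr0 ?add0r//; lia.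
Qed.

(** Each cell lies on one diagonal, so it enters exactly one of the three volumes, with the rate of
    its slice. *)
Lemma pp_weightE (eps : R) (L : PP) :
  pp_weight (expR (- eps)) (expR (- (alpha * eps))) eta theta L =
  \prod_(p : cell) expR (- (eps * gamp p * (L p)%:R)).
Proof.
have pe (x y : R) : expR x `^ y = expR (x * y) by rewrite expRM.
pose A : R := \sum_(p : cell) (p.2 < p.1)%N%:R * (L p)%:R.
pose B : R := \sum_(p : cell) (p.1 == p.2 :> nat)%:R * (L p)%:R.
pose C : R := \sum_(p : cell) (p.1 < p.2)%N%:R * (L p)%:R.
have lE : (left_vol L)%:R = A.
  by rewrite left_volE natr_sum; apply: eq_bigr => p _; rewrite natrM.
have cE : (central_vol L)%:R = B.
  by rewrite central_volE natr_sum; apply: eq_bigr => p _; rewrite natrM.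
have rE : (right_vol L)%:R = C.
  by rewrite right_volE natr_sum; apply: eq_bigr => p _; rewrite natrM.
rewrite /pp_weight !pe -expRD -expRM_natl -!expRD -expR_sum; congr expR.
rewrite lE cE rE; transitivity (- (eps * (eta * A + beta * B + theta * C))).
  by rewrite /beta; field.
rewrite /A /B /C !mulr_sumr -!big_split/= mulr_sumr -sumrN.
by apply: eq_bigr => p _; rewrite gampE; ring.
Qed.

(* If [y] has density [g y^(g - 1)] on (0, 1], i.e. [- ln y] is exponential with
   rate [g], then [flo eps y] is geometric: it equals [n] with probability
   [(1 - e^(- eps g)) e^(- eps g n)]. *)
Definition flo (eps y : R) : nat := Num.truncn (- ln y / eps).
Definition discr (eps : R) (w : Om) : PP := [ffun p => flo eps (w (pos p))].
Definition W1 (w : Om) : R :=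
  \prod_(p : cell) ((0 < w (pos p) <= 1)%R%:R *
     (gamp p * w (pos p) `^ (gamp p - 1))).
Definition C1 (eps : R) : R := \prod_(p : cell) (1 - expR (- (eps * gamp p))).

Lemma gamp_gt0 p : 0 < gamp p. Proof. exact: gam_gt0. Qed.

Lemma C1_gt0 eps : 0 < eps -> 0 < C1 eps.
Proof.
move=> e0; rewrite prodr_gt0// => p _.
by rewrite subr_gt0 expR_lt1 oppr_lt0 mulr_gt0// gamp_gt0.
Qed.

Lemma flo_eq eps y n : 0 < eps -> 0 < y <= 1 ->
  (flo eps y == n) = (expR (- (eps * n.+1%:R)) < y <= expR (- (eps * n%:R))).
Proof.
move=> e0 /andP[y0 y1]; rewrite /flo truncn_eq; last first.
  by rewrite divr_ge0 ?(ltW e0)// oppr_ge0 ln_le0.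
rewrite andbC ler_pdivlMr// ltr_pdivrMr// ltrNl lerNr.
congr (_ && _).
  by rewrite -[in RHS](lnK y0) ltr_expR mulrC.
by rewrite -[in RHS](lnK y0) ler_expR mulrC.
Qed.

Lemma integral_cell eps g n : 0 < eps -> 0 < g ->
  (\int[unif01 R]_y ((flo eps y == n)%:R *
     ((0 < y <= 1)%R%:R * (g * y `^ (g - 1))))%:E =
   (expR (- (eps * g * n%:R)) * (1 - expR (- (eps * g))))%:E)%E.
Proof.
move=> e0 g0; pose a := expR (- (eps * n.+1%:R)); pose b := expR (- (eps * n%:R)).
have a0 : 0 < a by exact: expR_gt0.
have ab : a <= b by rewrite ler_expR lerN2 ler_pM2l// ler_nat.
have b1 : b <= 1 by rewrite -expR0 ler_expR oppr_le0 mulr_ge0// ltW.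
transitivity (\int[unif01 R]_y (g%:E * ((a < y <= b)%R%:R * y `^ (g - 1))%:E))%E.
  apply: eq_integral => y _; rewrite -EFinM; congr (_%:E).
  case: (boolP (0 < y <= 1)) => [y01|ny].
    by rewrite flo_eq// mul1r mulrCA.
  suff -> : (a < y <= b) = false by rewrite !mul0r !mulr0.
  apply/negbTE; apply: contra ny => /andP[ay yb].
  by rewrite (lt_trans a0 ay) (le_trans yb b1).
rewrite ge0_integralZl//; first last.
- by rewrite lee_fin ltW.
- by move=> y _; rewrite lee_fin mulr_ge0// powR_ge0.
- apply/measurable_EFinP/measurable_funM; last exact: measurable_powR_sub1.
  by apply: measurable_natr_bool; apply: measurable_and;
    [exact: measurable_fun_ltr|exact: measurable_fun_ler].
rewrite integral_powR_itvoc ?(ltW a0)// -EFinM; congr (_%:E).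
rewrite mulrC divfK ?gt_eqF// /a /b.
rewrite -!expRM mulrBr mulr1 -expRD; congr (expR _ - expR _); first ring.
by rewrite -natr1; ring.
Qed.

Lemma measurable_discr eps (L : PP) : measurable [set w : Om | discr eps w = L].
Proof.
rewrite (_ : [set _ | _] = \bigcap_(p in [set: cell])
   [set w : Om | flo eps (w (pos p)) = L p]).
  apply: fin_bigcap_measurable => // p _; apply: measurable_truncn_eq.
  apply: measurable_funM => //; apply: measurable_funN.
  by apply: measurableT_comp (@measurable_ln R) _; exact: measurable_coord.
apply/seteqP; split => [w /= <- p _|w /= h]; first by rewrite /= ffunE.
by apply/ffunP => p; rewrite ffunE; exact: h.
Qed.

Lemma measurable_W1 : measurable_fun setT W1.
Proof.
apply: measurable_prod => p _; apply: measurable_funM.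
  apply: measurable_natr_bool; apply: measurable_and.
    by apply: measurable_fun_ltr => //; exact: measurable_coord.
  by apply: measurable_fun_ler => //; exact: measurable_coord.
apply: measurable_funM => //.
by apply: measurableT_comp (measurable_powR _) _; exact: measurable_coord.
Qed.

Lemma W1_ge0 w : 0 <= W1 w.
Proof.
rewrite prodr_ge0// => p _.
by rewrite !mulr_ge0 ?powR_ge0// ltW// gamp_gt0.
Qed.

Lemma integral_pos_prod (f : cell -> R -> R) (g : cell -> R) :
  (forall p, measurable_fun setT (f p)) -> (forall p y, 0 <= f p y) ->
  (forall p, \int[unif01 R]_y (f p y)%:E = (g p)%:E)%E ->
  (\int[cube R (leftix S)]_w (\prod_(p : cell) f p (w (pos p)))%:E =
   (\prod_(p : cell) g p)%:E)%E.
Proof.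
move=> mf f0 fg.
have mF : measurable_fun setT (fun w : Om => (\prod_(p : cell) f p (w (pos p)))%:E).
  apply/measurable_EFinP/measurable_prod => p _.
  by apply: measurableT_comp (mf p) _; exact: measurable_coord.
have F0 (w : Om) : (0 <= (\prod_(p : cell) f p (w (pos p)))%:E)%E.
  by rewrite lee_fin prodr_ge0.
rewrite integral_cube// (perm_J perm_pos mF F0).
rewrite (eq_J _ (G := fun w : Om => (\prod_(p <- enum {: cell}) f p (w (pos p)))%:E)).
  rewrite (@J_prod _ _ _ pos _ f g)//; last exact: enum_uniq.
    by rewrite big_enum.
  exact: pos_inj.
by move=> w; rewrite big_enum.
Qed.

Lemma measurable_W1p p : measurable_fun setT
  (fun y : R => (0 < y <= 1)%R%:R * (gamp p * y `^ (gamp p - 1))).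
Proof.
apply: measurable_funM.
  apply: measurable_natr_bool; apply: measurable_and.
    exact: measurable_fun_ltr.
  exact: measurable_fun_ler.
by apply: measurable_funM => //; exact: measurable_powR.
Qed.

Lemma integral_W1 : (\int[cube R (leftix S)]_w (W1 w)%:E = 1)%E.
Proof.
rewrite (@integral_pos_prod
  (fun p y => (0 < y <= 1)%R%:R * (gamp p * y `^ (gamp p - 1))) (fun=> 1)).
- by rewrite big1.
- exact: measurable_W1p.
- by move=> p y; rewrite !mulr_ge0 ?powR_ge0// ltW// gamp_gt0.
move=> p; transitivity (\int[unif01 R]_y
    ((gamp p)%:E * ((0 < y <= 1)%R%:R * y `^ (gamp p - 1))%:E))%E.
  by apply: eq_integral => y _; rewrite -EFinM; congr (_%:E); rewrite mulrCA.
rewrite ge0_integralZl//; first last.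
- by rewrite lee_fin ltW// gamp_gt0.
- by move=> y _; rewrite lee_fin mulr_ge0// powR_ge0.
- apply/measurable_EFinP/measurable_funM; last exact: measurable_powR_sub1.
  by apply: measurable_natr_bool; apply: measurable_and;
    [exact: measurable_fun_ltr|exact: measurable_fun_ler].
rewrite integral_powR_itvoc ?gamp_gt0// powR1 powR0 ?gt_eqF ?gamp_gt0//.
by rewrite subr0 -EFinM mul1r mulfV// gt_eqF// gamp_gt0.
Qed.

(** The event that the discretisation equals L is a product over cells, and by [integral_cell] its
    mass under the density [W1] is [C1 eps] times the weight of L. *)
Lemma esum_weight eps (h : PP -> R) : 0 < eps -> (forall L, 0 <= h L) ->
  (\esum_(L in [set: PP]) (h L * \prod_(p : cell) expR (- (eps * gamp p * (L p)%:R)))%:E =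
   \int[cube R (leftix S)]_w (h (discr eps w) * (W1 w / C1 eps))%:E)%E.
Proof.
move=> e0 h0; have C0 := C1_gt0 e0.
rewrite integral_countable_valued//; first last.
- by move=> w; rewrite divr_ge0 ?W1_ge0// ltW.
- by apply: measurable_funM => //; exact: measurable_W1.
- exact: measurable_discr.
apply: eq_esum => L _; rewrite EFinM; congr (_ * _)%E.
transitivity (\int[cube R (leftix S)]_w ((C1 eps)^-1%:E *
   (\prod_(p : cell) ((flo eps (w (pos p)) == L p)%:R *
   ((0 < w (pos p) <= 1)%R%:R * (gamp p * w (pos p) `^ (gamp p - 1)))))%:E))%E; last first.
  apply: eq_integral => w _; rewrite -EFinM; congr (_%:E).
  rewrite mulrC big_split/= -mulrA -/(W1 w); congr (_ * _).
  apply/esym; case: eqP => [<-|ne].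
    by rewrite big1// => p _; rewrite ffunE eqxx.
  transitivity (0 : R) => //; apply/eqP; rewrite eq_sym prodf_seq_eq0; apply/hasP.
  have [p hp] : exists p, flo eps (w (pos p)) != L p.
    apply: contrapT => nh; apply: ne; apply/ffunP => p; rewrite ffunE.
    by apply/eqP; apply: contrapT => hp; apply: nh; exists p; exact/negP.
  by exists p; rewrite ?mem_index_enum//= pnatr_eq0 eqb0.
rewrite ge0_integralZl//; first last.
- by rewrite lee_fin invr_ge0 ltW.
- move=> w _; rewrite lee_fin prodr_ge0// => p _.
  by rewrite !mulr_ge0 ?powR_ge0// ltW// gamp_gt0.
- apply/measurable_EFinP/measurable_prod => p _; apply: measurable_funM.
    apply: (@measurable_countable_factor _ _ _ nat (fun w : Om => flo eps (w (pos p)))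
      (fun n => (n == L p)%:R)) => n.
    apply: measurable_truncn_eq; apply: measurable_funM => //; apply: measurable_funN.
    by apply: measurableT_comp (@measurable_ln R) _; exact: measurable_coord.
  by apply: measurableT_comp (measurable_W1p p) _; exact: measurable_coord.
rewrite (@integral_pos_prod (fun p y => (flo eps y == L p)%:R *
    ((0 < y <= 1)%R%:R * (gamp p * y `^ (gamp p - 1))))
  (fun p => expR (- (eps * gamp p * (L p)%:R)) * (1 - expR (- (eps * gamp p))))).
- by rewrite -EFinM big_split/= -/(C1 eps) mulrCA mulVf ?mulr1// gt_eqF.
- move=> p; apply: measurable_funM; last exact: measurable_W1p.
  apply: (@measurable_countable_factor _ _ _ nat (fun y => flo eps y)
      (fun n => (n == L p)%:R)) => n.
  apply: measurable_truncn_eq; apply: measurable_funM => //; apply: measurable_funN.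
  exact: measurable_ln.
- by move=> p y; rewrite !mulr_ge0 ?powR_ge0// ltW// gamp_gt0.
- by move=> p; apply: integral_cell => //; exact: gamp_gt0.
Qed.

(** * The interlacing domain in terms of neighbouring cells *)

Definition Dom (w : Om) : bool :=
  all (fun s => chamber s w) (iota 0 S) &&
  all (fun s => interlace s w) (iota 0 S.-1).

Lemma WtE w : Wt w = (Dom w)%:R * \prod_(0 <= s < S) gw s w.
Proof.
have iS n : iota 0 n.+1 = iota 0 n ++ [:: n] by rewrite -addn1 iotaD add0n.
have allE n : \prod_(0 <= r < n) hL r w =
    (all (fun s => chamber s w) (iota 0 n) &&
     all (fun s => interlace s w) (iota 0 n))%:R * \prod_(0 <= r < n) gw r w.
  elim: n => [|n IH]; first by rewrite !big_geq// mulr1.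
  rewrite iS !all_cat !big_nat_recr//= IH !andbT /hL mulrACA -natrM mulnb.
  by congr ((nat_of_bool _)%:R * _); rewrite andbACA.
rewrite /Wt /FL allE /hC /Dom.
have -> : S = S.-1.+1 by lia.
rewrite iS all_cat big_nat_recr//= !andbT mulrACA -natrM mulnb.
by congr ((nat_of_bool _)%:R * _); rewrite andbAC.
Qed.

(** Covering relation: r is directly below p or directly to its right. It indexes both the plane
    partition inequalities and, with the order reversed by y = q^n, the strict ones of the limit. *)
Definition nbr (p r : cell) : bool :=
  ((r.1 == p.1.+1 :> nat) && (r.2 == p.2 :> nat)) ||
  ((r.1 == p.1 :> nat) && (r.2 == p.2.+1 :> nat)).

Lemma DomP w : reflect
  ((forall s, (s < S)%N -> chamber s w) /\
   (forall s, (s.+1 < S)%N -> interlace s w)) (Dom w).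
Proof.
apply: (iffP andP) => -[h1 h2]; split.
- by move=> s sS; apply: (allP h1); rewrite mem_iota; lia.
- by move=> s sS; apply: (allP h2); rewrite mem_iota; lia.
- by apply/allP => s; rewrite mem_iota => hs; apply: h1; lia.
- by apply/allP => s; rewrite mem_iota => hs; apply: h2; lia.
Qed.

(** A step down lowers the slice index by one and a step right raises it by one, so every neighbour
    inequality is one half of an interlacing condition; which half depends on the side of the
    diagonal. *)
Lemma Dom_nbr w p r : Dom w -> nbr p r -> w (pos p) < w (pos r).
Proof.
move=> /DomP[ch il]; case: p => [[i hi] [j hj]]; case: r => [[i' hi'] [j' hj']].
rewrite /nbr /pos/= => /orP[/andP[/eqP iE /eqP jE]|/andP[/eqP iE /eqP jE]].
  subst i' j'; pose s := (j + M.-1 - i.+1)%N.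
  have -> : (j + M.-1 - i)%N = s.+1 by rewrite /s; lia.
  have [ji|ij] := leqP j i.
    have sM : (s < M.-1)%N by rewrite /s; lia.
    have /(interlace_growP _ sM) h : interlace s w by apply: il; rewrite /s; lia.
    have -> : minn i.+1 j = j by lia.
    by have /h/andP[] : (1 <= j.+1 <= ell s)%N by rewrite /ell /s; lia.
  have sM : (M.-1 <= s)%N by rewrite /s; lia.
  have /(interlace_shrinkP _ sM) h : interlace s w by apply: il; rewrite /s; lia.
  have -> : minn i.+1 j = i.+1 by lia.
  have /h/andP[_] : (1 <= i.+1 <= ell s.+1)%N by rewrite /ell /s; lia.
  by rewrite ifF// /ell /s; lia.
subst i' j'; pose s := (j + M.-1 - i)%N.
have -> : (j.+1 + M.-1 - i)%N = s.+1 by rewrite /s; lia.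
rewrite -/s; have [ij|ji] := leqP i j.
  have sM : (M.-1 <= s)%N by rewrite /s; lia.
  have /(interlace_shrinkP _ sM) h : interlace s w by apply: il; rewrite /s; lia.
  have -> : minn i j.+1 = i by lia.
  by have /h/andP[] : (1 <= i.+1 <= ell s.+1)%N by rewrite /ell /s; lia.
have sM : (s < M.-1)%N by rewrite /s; lia.
have /(interlace_growP _ sM) h : interlace s w by apply: il; rewrite /s; lia.
have -> : minn i j.+1 = j.+1 by lia.
by have /h/andP[] : (1 <= j.+1 <= ell s)%N by rewrite /ell /s; lia.
Qed.

Lemma pos_ex s k : (s < S)%N -> (1 <= k <= ell s)%N -> exists p, pos p = (s, k).
Proof. by move=> sS hk; apply: pos_surj; rewrite mem_leftix/= sS. Qed.

Lemma nbr_Dom w : (forall p, 0 < w (pos p) < 1) ->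
  (forall p r, nbr p r -> w (pos p) < w (pos r)) -> Dom w.
Proof.
move=> w01 wn.
have lt_nbr s k s' k' : (s < S)%N -> (1 <= k <= ell s)%N ->
    (s' < S)%N -> (1 <= k' <= ell s')%N ->
    (forall p r, pos p = (s, k) -> pos r = (s', k') -> nbr p r) ->
    w (s, k) < w (s', k').
  move=> sS hk sS' hk' h.
  have [p pE] := pos_ex sS hk; have [r rE] := pos_ex sS' hk'.
  by rewrite -pE -rE; apply: wn; apply: h.
have il s : (s.+1 < S)%N -> interlace s w.
  move=> sS; have [sM|sM] := ltnP s M.-1.
    apply/(interlace_growP _ sM) => i hi; apply/andP; split.
      apply: lt_nbr => //; [by rewrite /ell in hi *; lia|lia|].
      move=> [[a ha] [b hb]] [[a' ha'] [b' hb']]; rewrite /pos /nbr/= => -[e1 e2] [e3 e4].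
      by lia.
    apply: lt_nbr => //; [by lia|by rewrite /ell in hi *; lia|].
    move=> [[a ha] [b hb]] [[a' ha'] [b' hb']]; rewrite /pos /nbr/= => -[e1 e2] [e3 e4].
    by lia.
  apply/(interlace_shrinkP _ sM) => i hi; apply/andP; split.
    apply: lt_nbr => //; [lia|by rewrite /ell in hi *; lia|].
    move=> [[a ha] [b hb]] [[a' ha'] [b' hb']]; rewrite /pos /nbr/= => -[e1 e2] [e3 e4].
    by lia.
  case: eqP => [_|ne].
    by have [p <-] := pos_ex sS hi; have /andP[] := w01 p.
  apply: lt_nbr => //; [lia|by rewrite /ell in hi ne *; lia|].
  move=> [[a ha] [b hb]] [[a' ha'] [b' hb']]; rewrite /pos /nbr/= => -[e1 e2] [e3 e4].
  by lia.
apply/DomP; split => // s sS; apply/chamberP; split => [i hi|i i1 il'].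
  by have [p <-] := pos_ex sS hi; exact: w01.
have [p pE] : exists p, pos p = (s, i) by apply: pos_ex => //; lia.
have [r rE] : exists r, pos r = (s, i.+1) by apply: pos_ex => //; lia.
rewrite -pE -rE.
(* Consecutive entries of a slice are diagonally adjacent cells; the path goes down one row, which
   exists because r lies in it, and then right. *)
have hq : (p.1.+1 < M)%N.
  case: p pE => [[a ha] [b hb]]; case: r rE => [[a' ha'] [b' hb']].
  by rewrite /pos/= => -[e1 e2] [e3 e4]; lia.
apply: (@lt_trans _ _ (w (pos (Ordinal hq, p.2)))); apply: wn.
  by rewrite /nbr/= !eqxx.
case: p pE hq => [[a ha] [b hb]]; case: r rE => [[a' ha'] [b' hb']].
by rewrite /pos /nbr/= => -[e1 e2] [e3 e4] hq; lia.
Qed.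

(** * Ties and boundary values have measure zero *)

Lemma J_null (r : seq (nat * nat)) (w : Om) : J r (fun=> 0%E) w = 0%E.
Proof. by elim: r w => //= k r IH w; apply: integral0_eq => y _; exact: IH. Qed.

Lemma unif01_set1 (a : R) : (\int[unif01 R]_y ((y == a)%:R)%:E = 0)%E.
Proof.
transitivity (\int[unif01 R]_y (\1_[set a] y)%:E)%E.
  apply: eq_integral => y _; rewrite indicE; congr (_%:R%:E).
  by congr (nat_of_bool _); apply/eqP/idP => [->|]; rewrite inE.
rewrite integral_indic// setIT.
by apply: (null_content_dominatesP _ _).1 (dominates_uniform_prob _) _ _ _;
  [exact: measurable_set1|exact: lebesgue_measure_set1].
Qed.

(** Excludes the points where the weak inequalities may hold for the discretisation at every scale
    although the strict ones fail in the limit. *)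
Definition generic (w : Om) : Prop :=
  (forall p, w (pos p) != 1) /\ (forall p r, p != r -> w (pos p) != w (pos r)).

(** [a] does not involve the coordinate of p, so with that coordinate integrated innermost the event
    is a single point. *)
Lemma cube_coord_eq (p : cell) (a : Om -> R) :
  measurable_fun setT a ->
  (forall v w, (forall k, k != pos p -> v k = w k) -> a v = a w) ->
  {ae cube R (leftix S), forall w, w (pos p) != a w}.
Proof.
move=> ma aloc; pose A := [set w : Om | w (pos p) == a w].
have mb : measurable_fun setT (fun w : Om => w (pos p) == a w).
  by apply: measurable_fun_eqr => //; exact: measurable_coord.
have mA : measurable A.
  have := mb measurableT [set true] I; rewrite setTI; congr (measurable _).
exists A; split => //; last by move=> w /= /negP; rewrite negbK.
rewrite -[A]setIT -integral_indic//.
have m1 : measurable_fun setT (fun w : Om => ((w (pos p) == a w)%:R : R)%:E).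
  by apply/measurable_EFinP; exact: measurable_natr_bool.
have p1 (w : Om) : (0 <= ((w (pos p) == a w)%:R : R)%:E)%E by rewrite lee_fin.
rewrite (eq_integral (fun w : Om => ((w (pos p) == a w)%:R : R)%:E)); last first.
  move=> w _; rewrite indicE; congr (_%:R%:E); congr (nat_of_bool _).
  by apply/idP/idP; rewrite inE.
have perm : perm_eq (leftix S) (rem (pos p) (leftix S) ++ [:: pos p]).
  by rewrite (perm_trans (perm_to_rem (pos_mem p)))// -cat1s perm_catC.
rewrite integral_cube// (perm_J perm m1 p1) J_cat/=.
rewrite (eq_J _ (G := fun=> 0%E)) ?J_null// => w; rewrite /J1.
rewrite -[RHS](unif01_set1 (a w)); apply: eq_integral => y _.
rewrite /upd eqxx; congr ((_ == _)%:R%:E).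
by apply: aloc => k kp; rewrite (negbTE kp).
Qed.

Lemma ae_generic : {ae cube R (leftix S), forall w, generic w}.
Proof.
have aeF : Filter (nbhs (almost_everywhere (cube R (leftix S)))).
  exact: (ae_filter_ringOfSetsType (cube R (leftix S))).
have h1 : {ae cube R (leftix S), forall w, forall p, w (pos p) != 1}.
  apply: filter_forall => p.
  by apply: (@cube_coord_eq p (fun=> 1)) => //; exact: measurable_cst.
have h2 : {ae cube R (leftix S), forall w, forall pr : cell * cell,
    pr.1 != pr.2 -> w (pos pr.1) != w (pos pr.2)}.
  apply: filter_forall => -[p r]/=.
  have [->|pr] := eqVneq p r; first by apply: aeW => w; rewrite eqxx.
  have : {ae cube R (leftix S), forall w, w (pos p) != w (pos r)}.
    apply: (@cube_coord_eq p (fun w => w (pos r)) (measurable_coord _)) => v w vw.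
    by apply: vw; apply: contra pr => /eqP/pos_inj ->.
  by apply: filterS => w hw _.
by apply: filterS2 h1 h2 => w w1 w2; split => // p r; exact: (w2 (p, r)).
Qed.

(** * When the discretised array is a plane partition *)

Definition ppb (L : PP) : bool := `[< is_plane_partition L >].

Lemma ppP (L : PP) :
  is_plane_partition L <-> (forall p r, nbr p r -> (L r <= L p)%N).
Proof.
split => [pL p r|h i j i0 j0 iM jN].
  have [h1 h2] := pL p.1.+1 p.2.+1 isT isT (ltn_ord _) (ltn_ord _).
  move=> /orP[|] /andP[/eqP e1 /eqP e2]; rewrite -2!pp_entry_ord.
    by move: h1; rewrite -e1 -e2.
  by move: h2; rewrite -e1 -e2.
have hi : (i.-1 < M)%N by lia.
have hj : (j.-1 < N)%N by lia.
have pE : pp_entry L i j = L (Ordinal hi, Ordinal hj).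
  by rewrite -pp_entry_ord/= !prednK.
have out a b : (M < a)%N || (N < b)%N -> pp_entry L a b = 0%N.
  move=> ab; rewrite pp_entryE big1// => p _.
  have := ltn_ord p.1; have := ltn_ord p.2.
  by case: eqP => //= e1; case: eqP => //= e2; lia.
rewrite pE; split.
  have [iM'|iM'] := ltnP i M; last by rewrite out//; lia.
  have -> : pp_entry L i.+1 j = L (Ordinal iM', Ordinal hj).
    by rewrite -pp_entry_ord/= !prednK.
  by apply: h; rewrite /nbr/=; lia.
have [jN'|jN'] := ltnP j N; last by rewrite out//; lia.
have -> : pp_entry L i j.+1 = L (Ordinal hi, Ordinal jN').
  by rewrite -pp_entry_ord/= !prednK.
by apply: h; rewrite /nbr/=; lia.
Qed.

Lemma flo_anti eps y y' : 0 < eps -> 0 < y -> y <= y' ->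
  (flo eps y' <= flo eps y)%N.
Proof.
move=> e0 y0 yy'; apply: le_truncn; rewrite ler_pM2r ?invr_gt0// lerN2.
by rewrite ler_ln// posrE// (lt_le_trans y0).
Qed.

Lemma Dom_pp eps w : 0 < eps -> Dom w -> ppb (discr eps w).
Proof.
move=> e0 dw; apply/asboolP/ppP => p r pr; rewrite !ffunE.
apply: flo_anti => //; last exact/ltW/Dom_nbr.
have [ch _] := DomP _ dw.
have := pos_mem p; rewrite mem_leftix => /andP[sS hk].
have [w01 _] := chamberP _ _ (ch _ sS).
by have := w01 _ hk; rewrite -surjective_pairing => /andP[].
Qed.

(** By genericity a failed strict inequality is a strict inequality in the opposite direction, which
    a fine enough discretisation detects. *)
Lemma not_Dom_pp w : generic w -> (forall p, 0 < w (pos p) <= 1) -> ~~ Dom w ->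
  exists2 e1, 0 < e1 & forall eps, 0 < eps < e1 -> ~~ ppb (discr eps w).
Proof.
move=> [w1 wne] w01 nd.
have [p [r [pr wpr]]] : exists p r, nbr p r /\ ~~ (w (pos p) < w (pos r)).
  apply: contrapT => nh; move/negP: nd; apply; apply: nbr_Dom.
    by move=> p; have /andP[w0 wle] := w01 p; rewrite w0/= lt_neqAle w1.
  move=> p r pr; apply: contrapT => h; apply: nh; exists p, r; split => //.
  exact/negP.
have pner : p != r.
  apply/negP => /eqP E; move: pr; rewrite E /nbr => /orP[|]/andP[]; lia.
have rp : w (pos r) < w (pos p).
  by rewrite lt_neqAle eq_sym wne//= leNgt.
have /andP[r0 _] := w01 r; have /andP[p0 p1] := w01 p.
have lnlt : 0 < ln (w (pos p)) - ln (w (pos r)) by rewrite subr_gt0 ltr_ln// posrE.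
(* For eps below this gap the two quotients differ by more than 1, so their integer parts differ. *)
exists (ln (w (pos p)) - ln (w (pos r))) => // eps /andP[e0 e1].
apply/negP => /asboolP/ppP /(_ _ _ pr); rewrite !ffunE leqNgt => /negP; apply.
rewrite /flo truncn_gt_nat.
have x0 : 0 <= - ln (w (pos p)) / eps by rewrite divr_ge0 ?(ltW e0)// oppr_ge0 ln_le0.
have /andP[h1 _] := truncn_itv x0.
rewrite -natr1; apply: le_trans (_ : - ln (w (pos p)) / eps + 1 <= _); first by rewrite lerD2r.
rewrite -[X in _ + X <= _](mulfV (lt0r_neq0 e0)) -mulrDl ler_pM2r ?invr_gt0//.
lra.
Qed.

Definition Xw (w : Om) (k : Ix M N) : R := w (sl (ix_t k), ix_i k).

Lemma ix_range (k : Ix M N) : t_range M N (ix_t k) /\ sl (ix_t k) = tag k.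
Proof.
rewrite /t_range /sl /ix_t; have := ltn_ord (tag k).
by move: (nat_of_ord (tag k)) => s sS; split; lia.
Qed.

Lemma ix_pos (k : Ix M N) : exists2 p, pos p = (sl (ix_t k), ix_i k) &
  forall L : PP, pp_slice L (ix_t k) (ix_i k) = L p.
Proof.
have [tr slE] := ix_range k; have [sS tE] := t_range_sl tr.
have [p pE] : exists p, pos p = (sl (ix_t k), ix_i k).
  apply: pos_ex => //; rewrite -Lt_ell// /ix_i.
  by have := ltn_ord (tagged k).
exists p => // L; rewrite -(pp_slice_pos L p) pE/=.
by congr (pp_slice L _ _).
Qed.

(** The rounded value z satisfies y <= z < y e^eps; since y <= 1 the error is at most e^eps - 1,
    uniformly in y. *)
Lemma flo_close eps y : 0 < eps -> 0 < y <= 1 ->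
  `|y - expR (- eps) ^+ flo eps y| <= expR eps - 1.
Proof.
move=> e0 y01; have /andP[y0 y1] := y01.
have := flo_eq (flo eps y) e0 y01; rewrite eqxx => /esym/andP[h1 h2].
have -> : expR (- eps) ^+ flo eps y = expR (- (eps * (flo eps y)%:R)).
  by rewrite -expRM_natl; congr expR; ring.
set z := expR (- (eps * (flo eps y)%:R)) in h2 *.
have h3 : z < y * expR eps.
  rewrite -ltr_pdivrMr ?expR_gt0// -expRN /z -expRD; apply: le_lt_trans h1.
  by rewrite ler_expR -natr1; lra.
have e1 : 0 <= expR eps - 1 by rewrite subr_ge0 ltW// expR_gt1.
rewrite distrC ger0_norm ?subr_ge0//.
have : y * (expR eps - 1) <= 1 * (expR eps - 1) by rewrite ler_wpM2r.
by move: h3; rewrite mulrBr mulr1 mul1r; lra.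
Qed.

(** Ratio of the two weights on the domain: the factors of [W1] are normalised densities, those of
    [Wt] are bare powers. *)
Definition Gam : R := \prod_(p : cell) gamp p.

Lemma Gam_gt0 : 0 < Gam.
Proof. by rewrite prodr_gt0// => p _; exact: gamp_gt0. Qed.

Lemma prod_leftix (phi : nat * nat -> R) n :
  \prod_(0 <= s < n) \prod_(1 <= i < (ell s).+1) phi (s, i) =
  \prod_(k <- leftix n) phi k.
Proof.
elim: n => [|n IH]; first by rewrite big_geq// big_nil.
rewrite big_nat_recr//= big_cat/= IH mulrC; congr (_ * _).
elim: (ell n) => [|m IHm]; first by rewrite big_geq// big_nil.
by rewrite big_nat_recr//= big_cons -IHm mulrC.
Qed.

Lemma prod_gw w :
  \prod_(0 <= s < S) gw s w = \prod_(p : cell) w (pos p) `^ (gamp p - 1).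
Proof.
rewrite (prod_leftix (fun k => w k `^ (gam k.1 - 1))) (perm_big _ perm_pos)/=.
by rewrite big_map big_enum.
Qed.

Lemma Dom_01 w p : Dom w -> 0 < w (pos p) < 1.
Proof.
move=> dw; have [ch _] := DomP _ dw.
have := pos_mem p; rewrite mem_leftix => /andP[sS hk].
have [w01 _] := chamberP _ _ (ch _ sS).
by have := w01 _ hk; rewrite -surjective_pairing.
Qed.

Lemma W1_Dom w : (Dom w)%:R * W1 w = Gam * Wt w.
Proof.
rewrite WtE prod_gw; case: (boolP (Dom w)) => dw; last by rewrite !mul0r mulr0.
rewrite !mul1r -big_split/=; apply: eq_bigr => p _.
by have /andP[w0 w1] := Dom_01 p dw; rewrite w0 (ltW w1) mul1r.
Qed.

Lemma measurable_Dom : measurable_fun setT Dom.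
Proof.
apply: measurable_and; apply: measurable_all => s.
  exact: measurable_chamber.
exact: measurable_interlace.
Qed.

Lemma pp_array_discr eps w k :
  pp_array (expR (- eps)) (discr eps w) k = expR (- eps) ^+ flo eps (Xw w k).
Proof.
have [p pE sE] := ix_pos k.
by rewrite /pp_array sE ffunE pE.
Qed.

Lemma measurable_fX (f : (Ix M N -> R) -> R) :
  (forall x (e : R), 0 < e -> exists d : R, 0 < d /\
     forall y, (forall k, `|x k - y k| < d) -> `|f x - f y| < e) ->
  measurable_fun setT (fun w : Om => f (Xw w)).
Proof.
move=> fc.
apply: (@measurable_continuous_coords _ _ _ _ (fun k (w : Om) => Xw w k)) => // k.
exact: measurable_coord.
Qed.

(** * Dominated convergence as eps tends to 0 *)

Section limit.
Context (f : (Ix M N -> R) -> R) (K : R).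
Context (f0 : forall x, 0 <= f x) (fK : forall x, f x <= K).
Context (fc : forall x (e : R), 0 < e -> exists d : R, 0 < d /\
     forall y, (forall k, `|x k - y k| < d) -> `|f x - f y| < e).

Definition hpp (eps : R) (L : PP) : R :=
  (ppb L)%:R * f (pp_array (expR (- eps)) L).

Lemma measurable_hpp eps :
  measurable_fun setT (fun w : Om => hpp eps (discr eps w) * W1 w).
Proof.
apply: measurable_funM; last exact: measurable_W1.
by apply: measurable_countable_factor => L; exact: measurable_discr.
Qed.

Lemma integrand_cvg (u : nat -> R) w : (forall n, 0 < u n) ->
  u n @[n --> \oo] --> (0 : R) -> generic w ->
  hpp (u n) (discr (u n) w) * W1 w @[n --> \oo] -->
  ((Dom w)%:R * f (Xw w) * W1 w : R).
Proof.
move=> u0 cu gw.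
(* If some coordinate leaves (0, 1], the factor [W1] vanishes and both sides are 0. *)
have [/allP w01|] := boolP (all (fun p => 0 < w (pos p) <= 1) (enum {: cell})); last first.
  move=> /allPn[p _ np]; have W0 : W1 w = 0.
    by rewrite /W1 (bigD1 p)//= (negbTE np) !mul0r.
  by rewrite W0 mulr0; under eq_fun do rewrite mulr0; exact: cvg_cst.
have {}w01 p : 0 < w (pos p) <= 1 by apply: w01; rewrite mem_enum.
apply: cvgM; last exact: cvg_cst.
have fcvg : f (pp_array (expR (- u n)) (discr (u n) w)) @[n --> \oo] --> f (Xw w).
  apply/cvgrPdist_lt => e e0; have [dl [d0 fd]] := fc (Xw w) e0.
  have cexp : expR (u n) @[n --> \oo] --> (1 : R).
    rewrite -expR0; apply: continuous_cvg => //; exact: continuous_expR.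
  near=> n; apply: fd => k; rewrite pp_array_discr.
  have [p pE _] := ix_pos k.
  apply: (@le_lt_trans _ _ (expR (u n) - 1)).
    by apply: flo_close => //; rewrite /Xw -pE.
  rewrite ltrBlDr addrC; near: n; apply: (cvgr_lt _ cexp).
  by rewrite ltrDl.
case: (boolP (Dom w)) => dw.
  rewrite mul1r; apply: cvg_trans fcvg; apply: near_eq_cvg; near=> n.
  by rewrite /hpp Dom_pp// mul1r.
rewrite mul0r; have [e1 e10 ne] := not_Dom_pp gw w01 dw.
apply: cvg_trans (@cvg_cst _ (0 : R) _ \oo _); apply: near_eq_cvg; near=> n.
rewrite /hpp (negbTE (ne _ _)) ?mul0r// u0/=.
by near: n; exact: cvgr_lt cu _ e10.
Unshelve. all: by end_near. Qed.

Lemma limit_integral (u : nat -> R) : (forall n, 0 < u n) ->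
  u n @[n --> \oo] --> (0 : R) ->
  (\int[cube R (leftix S)]_w (hpp (u n) (discr (u n) w) * W1 w)%:E)%E
    @[n --> \oo] -->
  (\int[cube R (leftix S)]_w ((Dom w)%:R * f (Xw w) * W1 w)%:E)%E.
Proof.
move=> u0 cu.
(* The dominating function: [f] is bounded by K and [W1] has total mass 1. *)
have iK : (cube R (leftix S)).-integrable setT (fun w => (K * W1 w)%:E).
  apply/integrableP; split.
    by apply/measurable_EFinP/measurable_funM => //; exact: measurable_W1.
  under eq_integral do rewrite abse_EFin normrM (ger0_norm (W1_ge0 _)) EFinM.
  rewrite ge0_integralZl//; first last.
  - by move=> w _; rewrite lee_fin W1_ge0.
  - by apply/measurable_EFinP; exact: measurable_W1.
  by rewrite integral_W1 mule1 ltry.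
have [] := @dominated_convergence _ Om R (cube R (leftix S)) setT measurableT
  (fun n w => (hpp (u n) (discr (u n) w) * W1 w)%:E)
  (fun w => ((Dom w)%:R * f (Xw w) * W1 w)%:E) (fun w => (K * W1 w)%:E).
- by move=> n; apply/measurable_EFinP; exact: measurable_hpp.
- apply/measurable_EFinP; apply: measurable_funM; last exact: measurable_W1.
  apply: measurable_funM; last exact: measurable_fX.
  by apply: measurable_natr_bool; exact: measurable_Dom.
- have aeF : Filter (nbhs (almost_everywhere (cube R (leftix S)))).
    exact: (ae_filter_ringOfSetsType (cube R (leftix S))).
  apply: filterS ae_generic => w gw _.
  by apply: cvg_EFin; [near=> n|exact: integrand_cvg].
- exact: iK.
- apply: aeW => w n _; rewrite abse_EFin lee_fin ger0_norm ?mulr_ge0 ?W1_ge0//.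
    rewrite ler_wpM2r ?W1_ge0// /hpp; case: ppb; rewrite ?mul1r// mul0r.
    exact: le_trans (f0 (fun=> 0)) (fK _).
by [].
Unshelve. all: by end_near. Qed.

End limit.

Lemma pp_sumE eps (H : PP -> R) : 0 < eps -> (forall L, 0 <= H L) ->
  (pp_sum (fun L : PP => pp_weight (expR (- eps)) (expR (- (alpha * eps))) eta theta L * H L)%R =
   (C1 eps)^-1%:E *
   \int[cube R (leftix S)]_w ((ppb (discr eps w))%:R * H (discr eps w) * W1 w)%:E)%E.
Proof.
move=> e0 H0; have h0 L : 0 <= (ppb L)%:R * H L by rewrite mulr_ge0.
rewrite -ge0_integralZl//; first last.
- by rewrite lee_fin invr_ge0 ltW// C1_gt0.
- by move=> w _; rewrite lee_fin mulr_ge0// W1_ge0.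
- apply/measurable_EFinP/measurable_funM; last exact: measurable_W1.
  apply: (@measurable_countable_factor _ _ _ _ (discr eps) (fun L => (ppb L)%:R * H L)) => L.
  exact: measurable_discr.
transitivity (\int[cube R (leftix S)]_w
    ((ppb (discr eps w))%:R * H (discr eps w) * (W1 w / C1 eps))%:E)%E; last first.
  by apply: eq_integral => w _; rewrite -EFinM mulrA mulrC.
rewrite -(esum_weight e0 h0) /pp_sum esum_mkcond; apply: eq_esum => L _.
case: ifPn => [|nL].
  by rewrite inE/= => pL; rewrite /ppb asboolT// mul1r pp_weightE mulrC.
rewrite (_ : ppb L = false) ?mul0r//; apply/negbTE; apply: contra nL => /asboolP.
by rewrite inE.
Qed.

(** Used for the positive and negative parts of a test function, both obtained by composing with a
    1-Lipschitz map. *)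
Lemma coord_continuous_comp_contraction (f : (Ix M N -> R) -> R) (g : R -> R) :
  (forall x y, `|g x - g y| <= `|x - y|) ->
  (forall x (e : R), 0 < e -> exists d : R, 0 < d /\
     forall y, (forall k, `|x k - y k| < d) -> `|f x - f y| < e) ->
  forall x (e : R), 0 < e -> exists d : R, 0 < d /\
     forall y, (forall k, `|x k - y k| < d) -> `|g (f x) - g (f y)| < e.
Proof.
move=> g1 fc x e e0; have [dl [d0 fd]] := fc x e e0; exists dl; split => // y xy.
exact: le_lt_trans (g1 _ _) (fd _ xy).
Qed.

(** Limit of the unnormalised plane partition sums rescaled by [C1 eps]. *)
Definition Ilim (f : (Ix M N -> R) -> R) : \bar R :=
  (\int[cube R (leftix S)]_w ((Dom w)%:R * f (Xw w) * W1 w)%:E)%E.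

Lemma fine_pp_sum_cvg (f : (Ix M N -> R) -> R) (K : R) (u : nat -> R) :
  (forall x, 0 <= f x) -> (forall x, f x <= K) ->
  (forall x (e : R), 0 < e -> exists d : R, 0 < d /\
     forall y, (forall k, `|x k - y k| < d) -> `|f x - f y| < e) ->
  (forall n, 0 < u n) -> u n @[n --> \oo] --> (0 : R) ->
  Ilim f \is a fin_num /\
  (C1 (u n) * fine (pp_sum (fun L => pp_weight (expR (- u n))
     (expR (- (alpha * u n))) eta theta L * f (pp_array (expR (- u n)) L))))
    @[n --> \oo] --> fine (Ilim f).
Proof.
move=> f0 fK fc u0 cu.
have mfX : measurable_fun setT (fun w : Om => f (Xw w)) by exact: measurable_fX.
have bnd (h : Om -> R) : measurable_fun setT h -> (forall w, 0 <= h w <= K) ->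
    (\int[cube R (leftix S)]_w (h w * W1 w)%:E)%E \is a fin_num.
  move=> mh hK; have K0 : 0 <= K.
    by have /andP[h0 /(le_trans h0)] := hK (@origin R _).
  rewrite ge0_fin_numE; last first.
    by apply: integral_ge0 => w _; rewrite lee_fin mulr_ge0 ?W1_ge0//; have /andP[] := hK w.
  apply: (@le_lt_trans _ _ (\int[cube R (leftix S)]_w (K%:E * (W1 w)%:E))%E).
    apply: ge0_le_integral => //.
    - by move=> w _; rewrite lee_fin mulr_ge0 ?W1_ge0//; have /andP[] := hK w.
    - by apply/measurable_EFinP/measurable_funM => //; exact: measurable_W1.
    - by apply: measurable_funeM; apply/measurable_EFinP; exact: measurable_W1.
    - by move=> w _; rewrite -EFinM lee_fin ler_wpM2r ?W1_ge0//; have /andP[] := hK w.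
  rewrite ge0_integralZl//; first last.
  - by move=> w _; rewrite lee_fin W1_ge0.
  - by apply/measurable_EFinP; exact: measurable_W1.
  by rewrite integral_W1 mule1 ltry.
have K0 : 0 <= K by exact: le_trans (f0 (fun=> 0)) (fK _).
have fin : Ilim f \is a fin_num.
  apply: (bnd (fun w => (Dom w)%:R * f (Xw w))).
    by apply: measurable_funM => //; apply: measurable_natr_bool; exact: measurable_Dom.
  by move=> w; rewrite mulr_ge0//=; case: Dom; rewrite ?mul1r ?mul0r.
split => //.
have finn n : (\int[cube R (leftix S)]_w (hpp f (u n) (discr (u n) w) * W1 w)%:E)%E
    \is a fin_num.
  apply: (bnd (fun w => hpp f (u n) (discr (u n) w))).
    by apply: measurable_countable_factor => L; exact: measurable_discr.
  by move=> w; rewrite /hpp mulr_ge0//=; case: ppb; rewrite ?mul1r ?mul0r.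
rewrite (_ : (fun n => _) = (fun n => fine
    (\int[cube R (leftix S)]_w (hpp f (u n) (discr (u n) w) * W1 w)%:E)%E)); last first.
  apply/funext => n; rewrite pp_sumE// fineM//; last exact: finn.
  by rewrite mulrA mulfV ?mul1r// gt_eqF// C1_gt0.
apply: fine_cvg; rewrite fineK//.
exact: (limit_integral f0 fK fc u0 cu).
Qed.

Lemma Ilim_Wt (f : (Ix M N -> R) -> R) : Ilim f =
  (\int[cube R (leftix S)]_w (Gam * (f (Xw w) * Wt w))%:E)%E.
Proof.
apply: eq_integral => w _; congr (_%:E).
by rewrite mulrAC W1_Dom; ring.
Qed.

Lemma Dom_props w : Dom w -> limit_array_props M N (fun t i => w (sl t, i)).
Proof.
move=> /DomP[ch il]; split; [|split; [|split]].
- move=> t i ht hi; have [sS tE] := t_range_sl ht.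
  by have [w01 _] := chamberP _ _ (ch _ sS); apply: w01; rewrite -Lt_ell.
- move=> t i ht i1 hi; have [sS tE] := t_range_sl ht.
  by have [_ wlt] := chamberP _ _ (ch _ sS); apply: wlt; rewrite -?Lt_ell.
- move=> t i t1 t2 hi.
  have ht : t_range M N t by rewrite /t_range; lia.
  have [sS tE] := t_range_sl ht.
  have -> : sl (t + 1) = (sl t).+1 by rewrite /sl in tE *; lia.
  have sM : (sl t < M.-1)%N by lia.
  have /(interlace_growP _ sM) h : interlace (sl t) w by apply: il; lia.
  by apply: h; rewrite -Lt_ell.
- move=> t i t1 t2 hi.
  have ht : t_range M N t by rewrite /t_range; lia.
  have ht1 : t_range M N (t + 1) by rewrite /t_range; lia.
  have [sS tE] := t_range_sl ht; have [sS1 tE1] := t_range_sl ht1.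
  have sE : sl (t + 1) = (sl t).+1 by rewrite /sl in tE *; lia.
  have sM : (M.-1 <= sl t)%N by lia.
  have /(interlace_shrinkP _ sM) h : interlace (sl t) w by apply: il; lia.
  rewrite /xext Lt_ell// sE; apply: h.
  by rewrite -sE -Lt_ell.
Qed.

(** * The limit law: support, slice marginals and convergence *)

Section limit_probability.
Context (Z : R) (Z0 : 0 < Z).
Context (ZE : J (leftix S) (fun w => (Wt w)%:E) (@origin R _) = Z%:E).

Definition dens (w : Om) : R := Wt w / Z.

Lemma dens_ge0 w : 0 <= dens w.
Proof. by rewrite divr_ge0 ?Wt_ge0// ltW. Qed.

Lemma measurable_dens : measurable_fun setT dens.
Proof. by apply: measurable_funM => //; exact: measurable_Wt. Qed.

Lemma integral_dens : (\int[cube R (leftix S)]_w (dens w)%:E = 1)%E.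
Proof.
transitivity (\int[cube R (leftix S)]_w (Z^-1%:E * (Wt w)%:E))%E.
  by apply: eq_integral => w _; rewrite -EFinM mulrC.
rewrite ge0_integralZl//; first last.
- by rewrite lee_fin invr_ge0 ltW.
- by move=> w _; rewrite lee_fin Wt_ge0.
- by apply/measurable_EFinP; exact: measurable_Wt.
rewrite integral_cube; first last.
- by move=> w; rewrite lee_fin Wt_ge0.
- by apply/measurable_EFinP; exact: measurable_Wt.
by rewrite ZE -EFinM mulVf// gt_eqF.
Qed.

Definition Plim : probability Om R :=
  density_prob measurable_dens dens_ge0 integral_dens.

Lemma integral_Plim (F : Om -> R) : measurable_fun setT F -> (forall w, 0 <= F w) ->
  (\int[Plim]_w (F w)%:E =
   Z^-1%:E * \int[cube R (leftix S)]_w (F w * Wt w)%:E)%E.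
Proof.
move=> mF F0; rewrite ge0_integral_density//; last exact/measurable_EFinP.
rewrite -ge0_integralZl//; first last.
- by rewrite lee_fin invr_ge0 ltW.
- by move=> w _; rewrite lee_fin mulr_ge0// Wt_ge0.
- by apply/measurable_EFinP/measurable_funM => //; exact: measurable_Wt.
by apply: eq_integral => w _; rewrite -!EFinM /dens; congr (_%:E); ring.
Qed.

Lemma Plim_ae : {ae Plim, forall w, limit_array_props M N (fun t i => w (sl t, i))}.
Proof.
exists [set w | ~~ Dom w]; split.
- have := measurable_neg measurable_Dom.
  by move=> /(_ measurableT [set true] I); rewrite setTI.
- rewrite /Plim/= /density_prob; apply: integral0_eq => w /= /negbTE nd.
  by rewrite /dens WtE nd !mul0r.
- move=> w /= nP; apply/negP => dw; apply: nP; exact: Dom_props.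
Qed.

Lemma Plim_slice t : t_range M N t -> exists c : R, 0 < c /\
  forall B : nat -> set R, (forall i, measurable (B i)) ->
    Plim [set w | forall i, (1 <= i <= Lt M N t)%N -> B i (w (sl t, i))] =
    (c%:E * iint01 (Lt M N t)
       (fun x => (slice_density M N alpha eta theta t x *
          \prod_(1 <= i < (Lt M N t).+1) \1_(B i) (x i))%:E))%E.
Proof.
move=> ht; have [sS tE] := t_range_sl ht.
have [c c0 mE] : exists2 c, 0 < c &
    forall (G : Om -> R) x, measurable_fun setT G -> (forall w, 0 <= G w) ->
    (forall v w, agree (pred1 (sl t)) v w -> G v = G w) ->
  J (leftix S) (fun w => (Wt w * G w)%:E) x =
  (c%:E * J (rowix (sl t) (ell (sl t))) (fun w =>
    (hC (sl t) w * AL (sl t) w * AR (sl t) w * G w)%:E) x)%E.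
  by apply: (@marginal (S.-1 - sl t)); lia.
(* [c] comes from integrating out the other slices, Z from normalising the law. *)
exists (c / Z); split; first exact: divr_gt0.
move=> B mB; rewrite Lt_ell//; set s := sl t; set n := ell s.
pose G (w : Om) : R := \prod_(1 <= i < n.+1) \1_(B i) (w (s, i)).
have mG : measurable_fun setT G.
  apply: measurable_prod => i _.
  have mi : measurable_fun setT (\1_(B i) : R -> R) by exact: measurable_indic.
  by apply: measurableT_comp mi _; exact: measurable_coord.
have G0 w : 0 <= G w by rewrite prodr_ge0.
have GE w : G w = \1_[set w : Om | forall i, (1 <= i <= n)%N -> B i (w (s, i))] w.
  rewrite /G indicE; case: (boolP (w \in _)).
    rewrite inE/= => h; rewrite big_nat big1// => i hi.
    by rewrite indicE mem_set//; exact: h.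
  rewrite notin_setE/= => nh.
  have [i [hi nB]] : exists i, (1 <= i <= n)%N /\ ~ B i (w (s, i)).
    by apply: contrapT => h; apply: nh => i hi; apply: contrapT => nB; apply: h; exists i.
  rewrite (big_rem i)/= ?mem_index_iota//.
  by rewrite indicE memNset// mul0r.
have mA : measurable [set w : Om | forall i, (1 <= i <= n)%N -> B i (w (s, i))].
  have := mG measurableT [set 1] (measurable_set1 _); rewrite setTI.
  congr (measurable _); apply/seteqP; split => w /=; rewrite GE indicE.
    by case: (boolP (w \in _)) => [|_ /eqP]; [rewrite inE|rewrite eq_sym oner_eq0].
  by move=> h; rewrite mem_set.
rewrite -[X in Plim X]setIT -integral_indic//.
rewrite (eq_integral (fun w => (G w)%:E)); last by move=> w _; rewrite GE.
rewrite integral_Plim// integral_cube; first last.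
- by move=> w; rewrite lee_fin mulr_ge0// Wt_ge0.
- by apply/measurable_EFinP/measurable_funM => //; exact: measurable_Wt.
rewrite (eq_J _ (G := fun w => (Wt w * G w)%:E)); last by move=> w; rewrite mulrC.
rewrite mE//; last first.
  move=> v w vw; apply: eq_bigr => i _; rewrite vw//=; exact: eqxx.
rewrite muleA -EFinM mulrC; congr (_ * _)%E.
have dE (w : Om) : slice_density M N alpha eta theta t (fun i => w (s, i)) =
  hC s w * AL s w * AR s w by exact: slice_densityE.
rewrite -[in RHS]/n (@iint01_J s n).
- by apply: J_local => w _; rewrite dE.
- rewrite (_ : (fun w : Om => _) =
      (fun w : Om => (hC s w * AL s w * AR s w * G w)%:E)); last first.
    by apply/funext => w; rewrite dE.
  apply/measurable_EFinP; apply: measurable_funM => //.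
  apply: measurable_funM; last exact: measurable_Agen.
  by apply: measurable_funM; [exact: measurable_hC|exact: measurable_Agen].
- move=> z; rewrite lee_fin mulr_ge0// ?prodr_ge0//.
  (* An arbitrary sequence z is realised as a slice of the array all of whose slices are z. *)
  have := dE (fun k => z k.2) => /= ->.
  case: (boolP (chamber s (fun k => z k.2))) => cz; last first.
    by rewrite /hC (negbTE cz) !mul0r.
  apply: mulr_ge0; last exact/ltW/Agen_gt0.
  by apply: mulr_ge0; [exact: hC_ge0|exact/ltW/Agen_gt0].
Qed.

Lemma Ilim_mass (g : (Ix M N -> R) -> R) :
  measurable_fun setT (fun w : Om => g (Xw w)) -> (forall x, 0 <= g x) ->
  Ilim g = (Gam%:E * \int[cube R (leftix S)]_w (g (Xw w) * Wt w)%:E)%E.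
Proof.
move=> mg g0; rewrite Ilim_Wt -ge0_integralZl//.
- by apply/measurable_EFinP/measurable_funM => //; exact: measurable_Wt.
- by move=> w _; rewrite lee_fin mulr_ge0// Wt_ge0.
- by rewrite lee_fin ltW// Gam_gt0.
Qed.

Lemma Plim_cvg (f : (Ix M N -> R) -> R) : bounded_continuous f ->
  (fun eps : R =>
     pp_expect (expR (- eps)) (expR (- (alpha * eps))) eta theta
       (fun L => f (pp_array (expR (- eps)) L)))
  @ (0 : R)^'+ --> (fine (\int[Plim]_w (f (Xw w))%:E)%E : R).
Proof.
(* The one-sided limit is tested along sequences, as dominated convergence requires. *)
move=> [[K fK] fc]; apply/cvg_at_rightP => u [u0 cu].
pose fp x := Num.max (f x) 0; pose fm x := Num.max (- f x) 0.
have fp0 x : 0 <= fp x by rewrite le_max lexx orbT.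
have fm0 x : 0 <= fm x by rewrite le_max lexx orbT.
have K0 : 0 <= K by exact: le_trans (normr_ge0 _) (fK (fun=> 0)).
have fpK x : fp x <= K by rewrite ge_max K0 andbT; exact: le_trans (ler_norm _) (fK x).
have fmK x : fm x <= K.
  by rewrite ge_max K0 andbT; apply: le_trans (ler_norm _) _; rewrite normrN.
have fpc := @coord_continuous_comp_contraction f (fun y => Num.max y 0) _ fc.
have fmc := @coord_continuous_comp_contraction f (fun y => Num.max (- y) 0) _ fc.
have lipp (x y : R) : `|Num.max x 0 - Num.max y 0| <= `|x - y|.
  by rewrite !maxEle; do 2 case: ifP => ?; rewrite ler_norml; apply/andP; split;
     case: (ler0P (x - y)); lra.
have lipm (x y : R) : `|Num.max (- x) 0 - Num.max (- y) 0| <= `|x - y|.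
  by apply: le_trans (lipp _ _) _; rewrite -opprD normrN.
have [finp cp] := fine_pp_sum_cvg fp0 fpK (fpc lipp) u0 cu.
have [finm cm] := fine_pp_sum_cvg fm0 fmK (fmc lipm) u0 cu.
have c1 : forall (x : Ix M N -> R) (e : R), 0 < e -> exists d : R, 0 < d /\
     forall y, (forall k, `|x k - y k| < d) -> `|(1 : R) - 1| < e.
  by move=> x e e0; exists 1; split => // y _; rewrite subrr normr0.
(* The constant function 1 gives the partition function in the denominator. *)
have [fin1 c1'] := @fine_pp_sum_cvg (fun=> 1) 1 u (fun=> ler01) (fun=> lexx _) c1 u0 cu.
have mfX : measurable_fun setT (fun w : Om => f (Xw w)) by exact: (measurable_fX fc).
have IZ (g : (Ix M N -> R) -> R) : measurable_fun setT (fun w : Om => g (Xw w)) ->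
    (forall x, 0 <= g x) ->
    (\int[Plim]_w (g (Xw w))%:E = (Z^-1 * Gam^-1)%:E * Ilim g)%E.
  move=> mg g0; rewrite integral_Plim// Ilim_mass//.
  by rewrite muleA -EFinM -mulrA mulVf ?mulr1// gt_eqF// Gam_gt0.
have mfp : measurable_fun setT (fun w : Om => fp (Xw w)).
  by apply: measurable_maxr => //; exact: measurable_cst.
have mfm : measurable_fun setT (fun w : Om => fm (Xw w)).
  apply: measurable_maxr; last exact: measurable_cst.
  exact: measurable_funN.
have I1 : Ilim (fun=> 1) = (Gam * Z)%:E.
  rewrite (@Ilim_mass (fun=> 1) (measurable_cst _) (fun=> ler01)).
  rewrite EFinM -ZE -integral_cube; first last.
  - by move=> w; rewrite lee_fin Wt_ge0.
  - by apply/measurable_EFinP; exact: measurable_Wt.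
  by congr (_ * _)%E; apply: eq_integral => w _; rewrite mul1r.
have -> : (fine (\int[Plim]_w (f (Xw w))%:E)%E : R) =
    (fine (Ilim fp) - fine (Ilim fm)) / fine (Ilim (fun=> 1)).
  rewrite integralE.
  have -> : (\int[Plim]_w (fun w => (f (Xw w))%:E)^\+ w =
      \int[Plim]_w (fp (Xw w))%:E)%E.
    by apply: eq_integral => w _; rewrite funeposE -EFin_max.
  have -> : (\int[Plim]_w (fun w => (f (Xw w))%:E)^\- w =
      \int[Plim]_w (fm (Xw w))%:E)%E.
    by apply: eq_integral => w _; rewrite funenegE -EFinN -EFin_max.
  rewrite !IZ// -(fineK finp) -(fineK finm) -!EFinM -EFinB/= I1/= invfM.
  by ring.
have GZ : fine (Ilim (fun=> 1)) != 0.
  by rewrite I1/= gt_eqF// mulr_gt0// Gam_gt0.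
(* The diverging normalisation does not affect the quotient: [C1] rescales numerator and denominator
   alike and cancels at each n. *)
have h := cvgM (cvgB cp cm) (cvgV GZ c1').
set g := (X in X n @[n --> _] --> _) in h.
suff -> : (fun n => pp_expect (expR (- u n)) (expR (- (alpha * u n))) eta theta
       (fun L => f (pp_array (expR (- u n)) L))) = g by exact: h.
apply/funext => n; rewrite /g /=.
have C0 : C1 (u n) != 0 by rewrite gt_eqF// C1_gt0.
rewrite /pp_expect /=.
have -> : (fun L : PP =>
    pp_weight (expR (- u n)) (expR (- (alpha * u n))) eta theta L * 1) =
    pp_weight (expR (- u n)) (expR (- (alpha * u n))) eta theta.
  by apply/funext => L; rewrite mulr1.
by rewrite -mulrBr invfM mulrACA mulfV// mul1r.
Qed.

End limit_probability.

End slices.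

Theorem mainTheorem3 (R : realType) (alpha eta theta : R) (M N : nat)
  (halpha : 0 <= alpha) (heta : 0 < eta) (htheta : 0 < theta)
  (hM : (1 <= M)%N) (hMN : (M <= N)%N) :
  exists (d : measure_display) (T : measurableType d) (P : probability T R)
         (X : int -> nat -> T -> R),
    (forall t i, measurable_fun setT (X t i)) /\
    (* convergence in distribution of (q^{lambda^(t)_i}) to X, q = e^{-eps}, a = e^{-alpha eps} *)
    (forall f : (Ix M N -> R) -> R, bounded_continuous f ->
       (fun eps : R =>
          pp_expect (expR (- eps)) (expR (- (alpha * eps))) eta theta
            (fun L => f (pp_array (expR (- eps)) L)))
       @ (0 : R)^'+ --> (fine (\int[P]_w (f (fun k => X (ix_t k) (ix_i k) w))%:E)%E : R)) /\
    (* almost sure ordering / interlacing *)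
    {ae P, forall w, limit_array_props M N (fun t i => X t i w)} /\
    (* law of each slice x^(t) *)
    (forall t, t_range M N t ->
       exists c : R, 0 < c /\
       forall B : nat -> set R, (forall i, measurable (B i)) ->
         P [set w | forall i, (1 <= i <= Lt M N t)%N -> B i (X t i w)] =
         (c%:E * iint01 (Lt M N t)
            (fun x => (slice_density M N alpha eta theta t x *
                       \prod_(1 <= i < (Lt M N t).+1) \1_(B i) (x i))%:E))%E).
Proof.
have [Z Z0 ZE] := total_mass halpha heta htheta hM hMN.
exists _, (coord_space R (nat * nat)%type), (Plim Z0 ZE),
  (fun t i w => w (sl M t, i)); split; first by move=> t i; exact: measurable_coord.
split; first by move=> f; exact: Plim_cvg.
by split; [exact: Plim_ae | exact: Plim_slice].
Qed.
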